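(* If CNF-SAT on $n$ variables can be solved in $O^*(2^{(1-\varepsilon)n})$ time for some $\varepsilon>0$, then there is an $\varepsilon'>0$ such that, for all $c>0$, there is a $\delta>0$ such that the satisfiability of threshold circuits with $n$ inputs, depth $(\log n)^{1+\delta}$ and at most $cn$ wires can be determined in time $O(2^{(1-\varepsilon')n})$.
   Context: CNF-SAT: satisfiability of CNF formulas of unbounded clause width with $n$ variables. A threshold circuit is a directed acyclic graph whose in-degree-$0$ vertices are input gates ($n$ of them) and whose other vertices are gates labeled by NEG (fan-in 1), AND, OR, or $\mathrm{TH}_\theta$ (unbounded fan-in; output $1$ iff at least $\theta$ inputs are $1$), with exactly one output gate; edges are wires, depth is the length of the longest directed path; it is satisfiable if some input setting makes the output $1$. $O^*(\cdot)$ suppresses factors polynomial in the input size. *)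

(* Defs.v *)
From mathcomp Require Import all_boot all_order all_algebra.
From mathcomp Require Import reals exp.

Set Implicit Arguments.
Unset Strict Implicit.
Unset Printing Implicit Defensive.

Import Order.TTheory GRing.Theory Num.Theory.

(******************************************************************************)
(* Model of computation: the WHILE language of N. D. Jones (Computability and *)
(* Complexity From a Programming Perspective), i.e. imperative programs with  *)
(* finitely many variables holding binary trees, each elementary operation    *)
(* costing one unit. Only pointers are copied and trees can only be inspected *)
(* one node at a time (there is no tree equality), so a unit cost is          *)
(* realistic. A computation of length T is simulated with a factor O(log T)   *)
(* by a logarithmic-cost RAM, and conversely (RAM memory is kept in a         *)
(* balanced tree). For T = 2^O(n) * poly(input) that factor is polynomial in  *)
(* n and log(input): it is absorbed by O* and, in a bound O(2^((1-e)n)), by   *)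
(* an arbitrarily small decrease of e.                                        *)
(******************************************************************************)

Inductive tree := leaf | node of tree & tree.

Fixpoint tree_size (d : tree) : nat :=
  if d is node d1 d2 then (tree_size d1 + tree_size d2).+1 else 1.

Inductive expr :=
  | Var of nat
  | Leaf
  | Node of expr & expr
  | Left of expr
  | Right of expr.

Inductive cmd :=
  | Assign of nat & expr
  | Seq of cmd & cmd
  | If of expr & cmd & cmd
  | While of expr & cmd.

Definition store := nat -> tree.

Definition update (s : store) (x : nat) (d : tree) : store :=
  fun y => if y == x then d else s y.

Definition is_node (d : tree) : bool := if d is node _ _ then true else false.

Fixpoint eval (s : store) (e : expr) : tree :=
  match e with
  | Var x => s x
  | Leaf => leaf
  | Node e1 e2 => node (eval s e1) (eval s e2)
  | Left e1 => if eval s e1 is node d _ then d else leaf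
  | Right e1 => if eval s e1 is node _ d then d else leaf
  end.

Fixpoint cost (e : expr) : nat :=
  match e with
  | Var _ | Leaf => 1
  | Node e1 e2 => (cost e1 + cost e2).+1
  | Left e1 | Right e1 => (cost e1).+1
  end.

(* [exec c s t s']: started in store [s], [c] halts after [t] units of time   *)
(* in store [s'].                                                             *)
Inductive exec : cmd -> store -> nat -> store -> Prop :=
  | ExecAssign x e s :
      exec (Assign x e) s (cost e).+1 (update s x (eval s e))
  | ExecSeq c1 c2 s1 s2 s3 t1 t2 :
      exec c1 s1 t1 s2 -> exec c2 s2 t2 s3 -> exec (Seq c1 c2) s1 (t1 + t2) s3
  | ExecIfTrue e c1 c2 s s' t :
      is_node (eval s e) -> exec c1 s t s' ->
      exec (If e c1 c2) s ((cost e).+1 + t) s'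
  | ExecIfFalse e c1 c2 s s' t :
      ~~ is_node (eval s e) -> exec c2 s t s' ->
      exec (If e c1 c2) s ((cost e).+1 + t) s'
  | ExecWhileTrue e c s1 s2 s3 t1 t2 :
      is_node (eval s1 e) -> exec c s1 t1 s2 -> exec (While e c) s2 t2 s3 ->
      exec (While e c) s1 ((cost e).+1 + t1 + t2) s3
  | ExecWhileFalse e c s :
      ~~ is_node (eval s e) -> exec (While e c) s (cost e).+1 s.

(* Input and output are in variable 0; a non-leaf output means acceptance.    *)
Definition initial_store (d : tree) : store :=
  fun x => if x == 0 then d else leaf.

Definition decides_within (R : realType) (c : cmd) (d : tree) (answer : bool)
    (bound : R) : Prop :=
  exists t s, [/\ exec c (initial_store d) t s,
                  is_node (s 0) = answer & (t%:R <= bound)%R].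

(******************************************************************************)
(* Encodings of instances as trees.  Numbers are written in unary; since      *)
(* variables and gates are numbered consecutively and their number is bounded *)
(* by the size of an instance, sizes are polynomially related to those of a   *)
(* binary encoding.                                                           *)
(******************************************************************************)

Definition enc_nat (k : nat) : tree := iter k (node leaf) leaf.

Definition enc_bool (b : bool) : tree := if b then node leaf leaf else leaf.

Definition enc_seq (T : Type) (enc : T -> tree) (s : seq T) : tree :=
  foldr (fun x d => node (enc x) d) leaf s.

(* The literal [(true, i)] is the variable [i], [(false, i)] its negation.    *)
Definition literal (n : nat) : Type := (bool * 'I_n)%type.
Definition clause (n : nat) : Type := seq (literal n).
Definition cnf (n : nat) : Type := seq (clause n).

Definition cnf_sat (n : nat) (F : cnf n) : bool :=
  [exists a : {ffun 'I_n -> bool},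
     all (fun C : clause n => has (fun l : literal n => a l.2 == l.1) C) F].

Definition enc_literal (n : nat) (l : literal n) : tree :=
  node (enc_bool l.1) (enc_nat l.2).

Definition enc_cnf (n : nat) (F : cnf n) : tree :=
  node (enc_nat n) (enc_seq (enc_seq (@enc_literal n)) F).

Inductive gate_label := NEG | AND | OR | TH of nat.

(* [inl i] is the i-th input gate, [inr g] the g-th other gate.               *)
Definition vertex (n m : nat) : finType := ('I_n + 'I_m)%type.

(* The output is a designated vertex.                                         *)
Record circuit (n : nat) := Circuit {
  ngates : nat;
  label : 'I_ngates -> gate_label;
  fanin : 'I_ngates -> {set vertex n ngates};
  output : vertex n ngates }.

Section Circuits.

Variables (n : nat) (C : circuit n).

Local Notation V := (vertex n (ngates C)).

Definition wire (u v : V) : bool := if v is inr g then u \in fanin g else false.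

Definition acyclic : Prop := forall p : seq V, cycle wire p -> p = [::].

Definition threshold_circuit : Prop :=
  [/\ acyclic,
      forall g : 'I_(ngates C), fanin g != set0
    & forall g : 'I_(ngates C), label g = NEG -> #|fanin g| = 1].

Definition nwires : nat := #|[set e : V * V | wire e.1 e.2]|.

(* In an acyclic graph, a path has fewer than #|V| edges.                     *)
Definition depth : nat :=
  \max_(k < #|{: V}| | [exists x : V, exists p : k.-tuple V, path wire x p]) k.

Definition gate_value (l : gate_label) (S : {set V}) (v : V -> bool) : bool :=
  match l with
  | NEG => [forall u in S, ~~ v u]
  | AND => [forall u in S, v u]
  | OR => [exists u in S, v u]
  | TH theta => theta <= #|[set u in S | v u]|
  end.

(* [v] gives the values of all the vertices on input [a] (on an acyclic       *)
(* circuit there is exactly one such [v] for each [a]).                       *)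
Definition valuation (a : 'I_n -> bool) (v : V -> bool) : bool :=
  [forall i, v (inl i) == a i] &&
  [forall g, v (inr g) == gate_value (label g) (fanin g) v].

Definition circuit_sat : bool :=
  [exists a : {ffun 'I_n -> bool}, exists v : {ffun V -> bool},
     valuation a v && v (output C)].

Definition enc_vertex (u : V) : tree :=
  match u with
  | inl i => node (enc_bool false) (enc_nat i)
  | inr g => node (enc_bool true) (enc_nat g)
  end.

Definition enc_label (l : gate_label) : tree :=
  match l with
  | NEG => node (enc_nat 0) leaf
  | AND => node (enc_nat 1) leaf
  | OR => node (enc_nat 2) leaf
  | TH theta => node (enc_nat 3) (enc_nat theta)
  end.

Definition enc_gate (g : 'I_(ngates C)) : tree :=
  node (enc_label (label g)) (enc_seq enc_vertex (enum (fanin g))).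

Definition enc_circuit : tree :=
  node (enc_nat n)
    (node (enc_seq enc_gate (enum 'I_(ngates C))) (enc_vertex (output C))).

End Circuits.

Local Open Scope ring_scope.

Definition log2 (R : realType) (x : R) : R := ln x / ln 2.

(* CNF-SAT in time O*(2^((1-eps)n)).                                          *)
Definition cnf_sat_solvable (R : realType) (eps : R) : Prop :=
  exists (c : cmd) (K : R) (k : nat), forall (n : nat) (F : cnf n),
    decides_within c (enc_cnf F) (cnf_sat F)
      (K * (tree_size (enc_cnf F))%:R ^+ k * 2 `^ ((1 - eps) * n%:R)).

(* Satisfiability, in time O(2^((1-eps)n)), of threshold circuits with n      *)
(* inputs, depth at most (log n)^(1+delta) and at most cw * n wires.          *)
Definition threshold_sat_solvable (R : realType) (eps cw delta : R) : Prop :=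
  exists (c : cmd) (K : R), forall (n : nat) (C : circuit n),
    threshold_circuit C ->
    (depth C)%:R <= log2 (n%:R : R) `^ (1 + delta) ->
    (nwires C)%:R <= cw * n%:R ->
    decides_within c (enc_circuit C) (circuit_sat C)
      (K * 2 `^ ((1 - eps) * n%:R)).

(* Main.v *)
Require Import Defs.
From mathcomp Require Import all_boot all_order all_algebra.
From mathcomp Require Import zify lra reals exp.

(** A threshold circuit is rewritten, in time [2 ^ o(n)], as a single CNF formula
on [(1 + gamma) n] variables with [gamma] arbitrarily small.  Valiant's depth
reduction: number the gates by their levels, written with [q] digits in
base [b], where [b ^ q] exceeds the depth, and sort the wires by the most
significant digit in which the levels of their ends differ.  Naming by a fresh
variable the value carried by each wire of the smallest class costs at most
[c n / q] variables, and the paths that avoid these wires have length at most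
[b ^ (q - 1)], which is [(log n) ^ (1 - 1 / q ^ 2)] up to constants when the
depth is [(log n) ^ (1 + 1 / q)].  Large fan-ins are handled by scanning the
wires of a gate and naming the [O(log n)] bits of the partial count of true
inputs once every [q log n] wires; this costs another [c n / q] variables.  Each
constraint relating named quantities then depends on [n ^ o(1)] variables only,
so that it can be expanded into [2 ^ (n ^ o(1))] clauses. *)

Set Implicit Arguments.
Unset Strict Implicit.
Unset Printing Implicit Defensive.

(** * Running programs inside larger programs *)

(** Removing one digit out of [q] turns a depth [D] into about [D ^ (1 - 1 / q)], and
    [(1 + 1 / q) * (1 - 1 / q) < 1]: hence the choice [delta = 1 / q]. The exponent has to fall
    below 1 because each level multiplies the number of named variables on which a gate depends by a
    factor of order [log n]; over [(log n) ^ (1 - 1 / q ^ 2)] levels this amounts to [n ^ o(1)],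
    over [log n] levels it would not. The constant [c] enters only through [q], which is taken large
    enough for the [2 c n / q] new variables to be at most [gamma n]. So [eps'] depends on [eps]
    alone, and [delta] pays for [c].

    The reduction has to be carried out by a concrete program, so it is built from folds and
    iterations over lists, and its time is measured against 2 to the power of a bound on the length
    of the terms that it handles. The intermediate values of each loop must be bounded as well as
    its result: this is why the size estimates cover unfinished tables and partial scans of a gate,
    and not only the final formula. *)

Fixpoint rename_expr (r : nat -> nat) (e : expr) : expr :=
  match e with
  | Var x => Var (r x)
  | Leaf => Leaf
  | Node e1 e2 => Node (rename_expr r e1) (rename_expr r e2)
  | Left e1 => Left (rename_expr r e1)
  | Right e1 => Right (rename_expr r e1)
  end.

Fixpoint rename (r : nat -> nat) (c : cmd) : cmd :=
  match c with
  | Assign x e => Assign (r x) (rename_expr r e)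
  | Seq c1 c2 => Seq (rename r c1) (rename r c2)
  | If e c1 c2 => If (rename_expr r e) (rename r c1) (rename r c2)
  | While e c1 => While (rename_expr r e) (rename r c1)
  end.

Fixpoint expr_below (M : nat) (e : expr) : bool :=
  match e with
  | Var x => x < M
  | Leaf => true
  | Node e1 e2 => expr_below M e1 && expr_below M e2
  | Left e1 | Right e1 => expr_below M e1
  end.

Fixpoint cmd_below (M : nat) (c : cmd) : bool :=
  match c with
  | Assign x e => (x < M) && expr_below M e
  | Seq c1 c2 => cmd_below M c1 && cmd_below M c2
  | If e c1 c2 => [&& expr_below M e, cmd_below M c1 & cmd_below M c2]
  | While e c1 => expr_below M e && cmd_below M c1
  end.

Lemma expr_below_leq M N e : M <= N -> expr_below M e -> expr_below N e.
Proof.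
move=> leMN; elim: e => //= [x|e1 IH1 e2 IH2]; first by move/leq_trans; apply.
by case/andP => /IH1 -> /IH2 ->.
Qed.

Lemma cmd_below_leq M N c : M <= N -> cmd_below M c -> cmd_below N c.
Proof.
move=> leMN; have leE := expr_below_leq leMN.
elim: c => /= [x e|c1 IH1 c2 IH2|e c1 IH1 c2 IH2|e c1 IH1].
- by case/andP => /leq_trans -> // /leE.
- by case/andP => /IH1 -> /IH2 ->.
- by case/and3P => /leE -> /IH1 -> /IH2 ->.
- by case/andP => /leE -> /IH1 ->.
Qed.

Lemma expr_below_ex e : exists M, expr_below M e.
Proof.
elim: e => /= [x| |e1 [M1 h1] e2 [M2 h2]|e1 IH|e1 IH] //.
- by exists x.+1.
- by exists 0.
- exists (maxn M1 M2); rewrite (expr_below_leq (leq_maxl _ _) h1).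
  exact: expr_below_leq (leq_maxr _ _) h2.
Qed.

Lemma cmd_below_ex c : exists M, cmd_below M c.
Proof.
elim: c => /= [x e|c1 [M1 h1] c2 [M2 h2]|e c1 [M1 h1] c2 [M2 h2]|e c1 [M1 h1]].
- have [M h] := expr_below_ex e; exists (maxn x.+1 M).
  by rewrite leq_maxl (expr_below_leq (leq_maxr _ _) h).
- exists (maxn M1 M2); rewrite (cmd_below_leq (leq_maxl _ _) h1).
  exact: cmd_below_leq (leq_maxr _ _) h2.
- have [M h] := expr_below_ex e; exists (maxn M (maxn M1 M2)).
  rewrite (expr_below_leq (leq_maxl _ _) h).
  rewrite (cmd_below_leq _ h1) ?(cmd_below_leq _ h2) //; lia.
- have [M h] := expr_below_ex e; exists (maxn M M1).
  by rewrite (expr_below_leq _ h) ?(cmd_below_leq _ h1) //; lia.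
Qed.

Lemma eval_rename M r s1 s e :
    expr_below M e -> (forall x, x < M -> s (r x) = s1 x) ->
  eval s (rename_expr r e) = eval s1 e.
Proof.
move=> + hs; elim: e => //= [e1 IH1 e2 IH2 /andP[h1 h2]|e1 IH h1|e1 IH h1].
- by rewrite (IH1 h1) (IH2 h2).
- by rewrite (IH h1).
- by rewrite (IH h1).
Qed.

Lemma cost_rename r e : cost (rename_expr r e) = cost e.
Proof. by elim: e => //= [e1 -> e2 ->|e1 ->|e1 ->]. Qed.

Lemma exec_rename r M c s1 t s2 :
    injective r -> exec c s1 t s2 -> cmd_below M c ->
    forall s, (forall x, x < M -> s (r x) = s1 x) ->
  exists s', [/\ exec (rename r c) s t s', forall x, x < M -> s' (r x) = s2 x
               & forall y, (forall x, y <> r x) -> s' y = s y].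
Proof.
move=> r_inj ex.
elim: c s1 t s2 / ex => [x e s1|c1 c2 s1 s2 s3 t1 t2 _ IH1 _ IH2
  |e c1 c2 s1 s2 t ev _ IH|e c1 c2 s1 s2 t ev _ IH
  |e c1 s1 s2 s3 t1 t2 ev _ IH1 _ IH2|e c1 s1 ev] /=.
- case/andP=> hx he s hs; exists (update s (r x) (eval s (rename_expr r e))); split.
  + by rewrite -(cost_rename r); exact: ExecAssign.
  + by move=> y hy; rewrite /update (inj_eq r_inj) (eval_rename he hs) hs.
  + by move=> y hy; rewrite /update; case: eqP => // /hy.
- case/andP=> h1 h2 s hs.
  have [s' [ex1 hs' fr1]] := IH1 h1 s hs.
  have [s'' [ex2 hs'' fr2]] := IH2 h2 s' hs'.
  exists s''; split=> //; first exact: ExecSeq ex1 ex2.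
  by move=> y hy; rewrite fr2 ?fr1.
- case/and3P=> he h1 h2 s hs; have [s' [ex1 hs' fr1]] := IH h1 s hs.
  exists s'; split=> //; rewrite -(cost_rename r).
  by apply: ExecIfTrue => //; rewrite (eval_rename he hs).
- case/and3P=> he h1 h2 s hs; have [s' [ex1 hs' fr1]] := IH h2 s hs.
  exists s'; split=> //; rewrite -(cost_rename r).
  by apply: ExecIfFalse => //; rewrite (eval_rename he hs).
- move=> /[dup] hw /andP[he h1] s hs.
  have [s' [ex1 hs' fr1]] := IH1 h1 s hs.
  have [s'' [ex2 hs'' fr2]] := IH2 hw s' hs'.
  exists s''; split=> //; last by move=> y hy; rewrite fr2 ?fr1.
  rewrite -(cost_rename r); apply: ExecWhileTrue ex1 ex2.
  by rewrite (eval_rename he hs).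
- case/andP=> he h1 s hs; exists s; split=> //; rewrite -(cost_rename r).
  by apply: ExecWhileFalse; rewrite (eval_rename he hs).
Qed.

Definition shift m := rename (addn m).

(** This is how subroutines are called: the variables below [m] are the frame of the caller, which
    the shifted program cannot touch. *)
Lemma exec_shift m c s t s' : exec c (fun x => s (m + x)) t s' ->
  exists s'', [/\ exec (shift m c) s t s'', s'' m = s' 0
                & forall y, y < m -> s'' y = s y].
Proof.
move=> ex; have [M hM] := cmd_below_ex c.
have [//|s'' [ex' hs' fr]] := exec_rename (@addnI m) ex (cmd_below_leq (leqnSn M) hM) (s := s).
exists s''; split=> //; first by rewrite -[m in LHS]addn0 hs'.
by move=> y hy; apply: fr => x hx; move: hy; rewrite hx ltnNge leq_addr.
Qed.

Lemma rename_id c : rename id c = c.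
Proof.
have idE e : rename_expr id e = e.
  by elim: e => //= [e1 -> e2 ->|e1 ->|e1 ->].
by elim: c => /= [x e|c1 -> c2 ->|e c1 -> c2 ->|e c1 ->]; rewrite ?idE.
Qed.

(** The case [r := id] of [exec_rename]. The solver is specified on a store that is empty everywhere
    else, while only finitely many variables can be cleared; this lemma bridges the gap. *)
Lemma exec_agree M c s1 t s2 s : exec c s1 t s2 -> cmd_below M c ->
    (forall x, x < M -> s x = s1 x) ->
  exists2 s', exec c s t s' & forall x, x < M -> s' x = s2 x.
Proof.
move=> ex hM hs; have [|s' []] := exec_rename (r := id) _ ex hM hs; first by [].
by rewrite rename_id => ex' hs' _; exists s'.
Qed.

Fixpoint clear (M : nat) : cmd :=
  if M is M'.+1 then Seq (clear M') (Assign M' Leaf) else Assign 0 Leaf.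

(** Prepares a call of a program that is specified on initial stores only. Variable [M] saves the
    input meanwhile and may keep it, as a program whose variables are below [M] does not see it. *)
Lemma exec_clear M s d : exists t s',
  [/\ exec (Seq (Assign M (Var 0)) (Seq (clear M) (Assign 0 (Var M)))) s t s',
      s 0 = d -> forall x, x < M -> s' x = initial_store d x & t <= 2 * M + 6].
Proof.
have cl N s0 : exists t s', [/\ exec (clear N) s0 t s', forall x, x < N -> s' x = leaf,
    forall x, N <= x -> 0 < x -> s' x = s0 x & t <= 2 * N + 2].
  elim: N => [|N [t [s' [ex h1 h2 ht]]]] /=.
    exists 2, (update s0 0 leaf); split=> //; first exact: (ExecAssign 0 Leaf).
    by move=> [|x].
  exists (t + 2), (update s' N leaf); split.
  - by apply: ExecSeq ex _; apply: (ExecAssign N Leaf).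
  - by move=> x; rewrite /update ltnS; case: eqP => // /eqP ne le; apply: h1; lia.
  - by move=> x lx x0; rewrite /update; case: eqP; [lia|move=> _; apply: h2; lia].
  - lia.
have [t [s' [ex h1 h2 ht]]] := cl M (update s M (s 0)).
exists (2 + (t + 2)), (update s' 0 (s' M)); split; last lia.
- apply: ExecSeq; first exact: (ExecAssign M (Var 0)).
  by apply: ExecSeq ex _; apply: (ExecAssign 0 (Var M)).
- move=> sd [|x] xM; rewrite /update /initial_store /=; last by rewrite h1.
  by rewrite h2 //= /update eqxx.
Qed.

(** * Functions computed in polynomial time *)

Class encoding (T : Type) := enc : T -> tree.
#[global] Instance nat_encoding : encoding nat := enc_nat.
#[global] Instance bool_encoding : encoding bool := enc_bool.
#[global] Instance seq_encoding T `{encoding T} : encoding (seq T) := enc_seq enc.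
#[global] Instance pair_encoding S T `{encoding S} `{encoding T} : encoding (S * T) :=
  fun z => node (enc z.1) (enc z.2).

(* The arguments [x] of a computation satisfy the precondition [dom x]; they
   are given to the program as the tree [env x], and time is measured against
   [mu x] rather than against the size of [env x] (a threshold written in
   unary may be arbitrarily large). *)
Record ctx := Ctx {
  carrier :> Type;
  dom : carrier -> Prop;
  env : carrier -> tree;
  mu : carrier -> nat }.

(** The base is at least 2, so that constants and sums are absorbed by a larger exponent. *)
Definition bounded (X : ctx) (h : X -> nat) :=
  exists k, forall x, dom x -> h x <= (mu x).+2 ^ k.

(** The variables other than 0 are arbitrary at the start: the program can then be called, after a
    shift, in whatever store its caller has reached. *)
Definition computes (X : ctx) (c : cmd) (h : X -> nat) (a b : X -> tree) :=
  forall x, dom x -> forall s, s 0 = a x ->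
  exists t s', [/\ exec c s t s', s' 0 = b x & t <= h x].

Definition FP (X : ctx) (T : Type) `{encoding T} (f : X -> T) :=
  exists c, exists2 h, bounded h & computes c h (@env X) (fun x => enc (f x)).

Section Bounded.
Variable X : ctx.
Implicit Types f g h : X -> nat.

Lemma bounded_le g f : bounded g -> (forall x, dom x -> f x <= g x) -> bounded f.
Proof. by case=> k hk le; exists k => x hx; exact: leq_trans (le x hx) (hk x hx). Qed.

Lemma bounded_const n : bounded (fun _ : X => n).
Proof.
exists n => x _; apply: leq_trans (ltnW (ltn_expl n (ltnSn 1))) _.
by case: n => // n; rewrite leq_exp2r.
Qed.

Lemma bounded_mul f g : bounded f -> bounded g -> bounded (fun x => f x * g x).
Proof.
by move=> [k hk] [l hl]; exists (k + l) => x hx; rewrite expnD leq_mul ?hk ?hl.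
Qed.

Lemma bounded_add f g : bounded f -> bounded g -> bounded (fun x => f x + g x).
Proof.
move=> [k hk] [l hl]; exists (maxn k l).+1 => x hx.
have h1 : (mu x).+2 ^ k <= (mu x).+2 ^ maxn k l by rewrite leq_exp2l ?leq_maxl.
have h2 : (mu x).+2 ^ l <= (mu x).+2 ^ maxn k l by rewrite leq_exp2l ?leq_maxr.
have := hk x hx; have := hl x hx; rewrite expnS; nia.
Qed.

Lemma bounded_exp f n : bounded f -> bounded (fun x => f x ^ n).
Proof.
move=> bf; elim: n => [|n IH]; first exact: (bounded_const 1).
by apply: bounded_le (bounded_mul bf IH) _ => x _; rewrite expnS.
Qed.

Lemma bounded_mu : bounded (@mu X).
Proof. by exists 1 => x _; rewrite expn1; lia. Qed.

End Bounded.

(** * Elementary closure properties of [FP] *)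

Section Core.
Variable X : ctx.

Lemma FP_subst (Y : ctx) T `{encoding T} (r : X -> Y) (f : Y -> T) :
    (forall x, dom x -> dom (r x) /\ mu (r x) <= mu x) ->
    (exists c, exists2 h, bounded h & computes c h (@env X) (fun x => env (r x))) ->
  FP f -> FP (fun x => f (r x)).
Proof.
move=> hr [c1 [h1 b1 ex1]] [c2 [h2 [k hk] ex2]].
exists (Seq c1 c2); exists (fun x => h1 x + (mu x).+2 ^ k).
  apply: bounded_add b1 _; apply: bounded_exp.
  by apply: bounded_le (bounded_add (bounded_mu X) (bounded_const X 2)) _ => x _; lia.
move=> x hx s hs; have [dx mx] := hr x hx.
have [t [s' [ex s'0 ht]]] := ex1 x hx s hs.
have [t2 [s2 [ex' s20 ht2]]] := ex2 (r x) dx s' s'0.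
exists (t + t2), s2; split=> //; first exact: ExecSeq ex ex'.
apply: leq_add => //; apply: leq_trans (leq_trans ht2 (hk _ dx)) _.
by case: (k) => // k'; rewrite leq_exp2r.
Qed.

Lemma FP_expr T `{encoding T} S `{encoding S} (e : expr) (f : X -> S) (g : X -> T) :
    (forall x s, s 0 = enc (f x) -> eval s e = enc (g x)) ->
  FP f -> FP g.
Proof.
move=> he [c [h bh ex]]; exists (Seq c (Assign 0 e)), (fun x => h x + (cost e).+1).
  exact: bounded_add bh (bounded_const _ _).
move=> x hx s /(ex x hx) [t [s' [ex' s'0 ht]]].
exists (t + (cost e).+1), (update s' 0 (eval s' e)); split.
- exact: ExecSeq ex' (ExecAssign _ _ _).
- by rewrite /update eqxx; exact: he.
- by rewrite leq_add2r.
Qed.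

Lemma FP_const T `{encoding T} (v : T) : FP (fun _ : X => v).
Proof.
have [e he] : exists e, forall s, eval s e = enc v.
  elim: (enc v) => [|d1 [e1 h1] d2 [e2 h2]]; first by exists Leaf.
  by exists (Node e1 e2) => s /=; rewrite h1 h2.
exists (Assign 0 e), (fun _ => (cost e).+1); first exact: bounded_const.
move=> x _ s _; exists (cost e).+1, (update s 0 (eval s e)); split=> //.
  exact: ExecAssign.
by rewrite /update /= he.
Qed.

Lemma FP_pair S T `{encoding S} `{encoding T} (f : X -> S) (g : X -> T) :
  FP f -> FP g -> FP (fun x => (f x, g x)).
Proof.
move=> [c1 [h1 b1 ex1]] [c2 [h2 b2 ex2]].
exists (Seq (Seq (Assign 1 (Var 0)) (shift 1 c1))
        (Seq (Seq (Assign 2 (Var 0)) (shift 2 c2)) (Assign 0 (Node (Var 1) (Var 2))))).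
exists (fun x => (2 + h1 x) + ((2 + h2 x) + 4)).
  by do !apply: bounded_add => //; exact: bounded_const.
move=> x hx s s0.
have [t1 [s1 [e1 s10 ht1]]] := ex1 x hx (fun y => update s 1 (s 0) (1 + y)) s0.
have [s1' [e1' s11 fr1]] := exec_shift e1.
have [t2 [s2 [e2 s20 ht2]]] := ex2 x hx (fun y => update s1' 2 (s1' 0) (2 + y))
  (etrans (fr1 0 isT) s0).
have [s2' [e2' s21 fr2]] := exec_shift e2.
exists ((2 + t1) + ((2 + t2) + 4)), (update s2' 0 (node (s2' 1) (s2' 2))); split.
- apply: ExecSeq; first exact: ExecSeq (ExecAssign 1 (Var 0) _) e1'.
  apply: ExecSeq; first exact: ExecSeq (ExecAssign 2 (Var 0) _) e2'.
  exact: (ExecAssign 0 (Node (Var 1) (Var 2))).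
- by rewrite /update /= s21 s20 fr2 //= /update /= s11 s10.
- lia.
Qed.

Lemma FP_fst S T `{encoding S} `{encoding T} (f : X -> S * T) :
  FP f -> FP (fun x => (f x).1).
Proof. by apply: (FP_expr (e := Left (Var 0))) => x s /= ->. Qed.

Lemma FP_snd S T `{encoding S} `{encoding T} (f : X -> S * T) :
  FP f -> FP (fun x => (f x).2).
Proof. by apply: (FP_expr (e := Right (Var 0))) => x s /= ->. Qed.

Lemma FP_cons T `{encoding T} (f : X -> T) (g : X -> seq T) :
  FP f -> FP g -> FP (fun x => f x :: g x).
Proof.
move=> ff fg; apply: (FP_expr (e := Var 0) _ (FP_pair ff fg)) => x s /= ->.
by [].
Qed.

Lemma FP_behead T `{encoding T} (f : X -> seq T) : FP f -> FP (fun x => behead (f x)).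
Proof. by apply: (FP_expr (e := Right (Var 0))) => x s /= ->; case: (f x). Qed.

Lemma FP_succ (f : X -> nat) : FP f -> FP (fun x => (f x).+1).
Proof. by apply: (FP_expr (e := Node Leaf (Var 0))) => x s /= ->. Qed.

Lemma FP_pred (f : X -> nat) : FP f -> FP (fun x => (f x).-1).
Proof. by apply: (FP_expr (e := Right (Var 0))) => x s /= ->; case: (f x). Qed.

Lemma FP_if_node S T `{encoding S} `{encoding T} (b : X -> S) (f g : X -> T) :
    FP b -> FP f -> FP g ->
  FP (fun x => if is_node (enc (b x)) then f x else g x).
Proof.
move=> [c [h bh ex]] [c1 [h1 b1 ex1]] [c2 [h2 b2 ex2]].
exists (Seq (Seq (Assign 1 (Var 0)) (shift 1 c)) (If (Var 1) c1 c2)).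
exists (fun x => (2 + h x) + (2 + (h1 x + h2 x))).
  by do !apply: bounded_add => //; exact: bounded_const.
move=> x hx s s0.
have [t [s1 [e s10 ht]]] := ex x hx (fun y => update s 1 (s 0) (1 + y)) s0.
have [s1' [e' s11 fr]] := exec_shift e.
have s1'0 : s1' 0 = env x by rewrite fr.
have [t1 [s2 [e1 s20 ht1]]] := ex1 x hx s1' s1'0.
have [t2 [s3 [e2 s30 ht2]]] := ex2 x hx s1' s1'0.
have ev : is_node (eval s1' (Var 1)) = is_node (enc (b x)) by rewrite /= s11 s10.
have e0 := ExecSeq (ExecAssign 1 (Var 0) s) e'.
case: ifP ev => _ ev.
- exists ((2 + t) + (2 + t1)), s2; split=> //; last lia.
  by apply: ExecSeq e0 _; apply: (ExecIfTrue _ _ e1); rewrite ev.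
- exists ((2 + t) + (2 + t2)), s3; split=> //; last lia.
  by apply: ExecSeq e0 _; apply: (ExecIfFalse _ _ e2); rewrite ev.
Qed.

End Core.

(** The body of a loop is a function of the arguments [x] and of the loop variables, which form the
    second component. The predicate [P] records the values that they can take during the loop, so
    that sizes have to be bounded for these values only. *)
Definition ext (X : ctx) T `{encoding T} (P : X -> T -> Prop) : ctx :=
  @Ctx (X * T) (fun z => dom z.1 /\ P z.1 z.2)
    (fun z => node (enc z.2) (env z.1)) (fun z => mu z.1).

Section Extension.
Variables (X : ctx) (T : Type) (eT : encoding T) (P : X -> T -> Prop).

Lemma bounded_weak (h : X -> nat) : bounded h -> bounded (X := ext P) (fun z => h z.1).
Proof. by case=> k hk; exists k => z [hz _]; exact: hk. Qed.

Lemma FP_weak S `{encoding S} (f : X -> S) : FP f -> FP (X := ext P) (fun z => f z.1).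
Proof.
apply: (@FP_subst (ext P) X); first by move=> z [].
exists (Assign 0 (Right (Var 0))), (fun _ => 3); first exact: bounded_const.
move=> z _ s s0; exists 3, (update s 0 (eval s (Right (Var 0)))); split=> //.
  exact: (ExecAssign 0 (Right (Var 0))).
by rewrite /update /= s0.
Qed.

Lemma FP_var : FP (X := ext P) (fun z => z.2).
Proof.
exists (Assign 0 (Left (Var 0))), (fun _ => 3); first exact: bounded_const.
move=> z _ s s0; exists 3, (update s 0 (eval s (Left (Var 0)))); split=> //.
  exact: (ExecAssign 0 (Left (Var 0))).
by rewrite /update /= s0.
Qed.

End Extension.

Arguments bounded_weak {X T eT P h}.
Arguments FP_weak {X T eT P S H f}.
Arguments FP_var {X T eT P}.

(** * Loops over lists *)

Section Loops.
Variable X : ctx.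

Lemma FP_foldl Y S `{encoding Y} `{encoding S} (l : X -> seq Y) (z : X -> S)
    (g : X -> Y -> S -> S) :
    FP l -> FP z -> bounded (fun x => size (l x)) ->
    FP (X := ext (fun x (ys : Y * S) => exists l1 l2,
          l x = l1 ++ ys.1 :: l2 /\ ys.2 = foldl (fun s y => g x y s) (z x) l1))
       (fun w => g w.1 w.2.1 w.2.2) ->
  FP (fun x => foldl (fun s y => g x y s) (z x) (l x)).
Proof.
move=> [cl [hl bl exl]] [cz [hz bz exz]] bs [cg [hg [k bg] exg]].
(* Variable 0 keeps the environment, 1 the rest of the list and 2 the accumulator; the program for
   [g] is called on the variables from 3 on. *)
pose body := Seq (Seq (Assign 3 (Node (Node (Left (Var 1)) (Var 2)) (Var 0))) (shift 3 cg))
  (Seq (Assign 2 (Var 3)) (Assign 1 (Right (Var 1)))).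
exists (Seq (Seq (Assign 1 (Var 0)) (shift 1 cl))
       (Seq (Seq (Assign 2 (Var 0)) (shift 2 cz))
       (Seq (While (Var 1) body) (Assign 0 (Var 2))))).
exists (fun x => (2 + hl x) + ((2 + hz x) + ((size (l x) * ((mu x).+2 ^ k + 14) + 2) + 2))).
  do !apply: bounded_add => //; try exact: bounded_const.
  apply: bounded_mul => //; apply: bounded_add; last exact: bounded_const.
  by exists k.
move=> x hx s s0.
have [t1 [s1 [e1 s10 ht1]]] := exl x hx (fun y => update s 1 (s 0) (1 + y)) s0.
have [s1' [e1' s11 fr1]] := exec_shift e1.
have s1'0 : s1' 0 = env x by rewrite fr1.
have [t2 [s2 [e2 s20 ht2]]] := exz x hx (fun y => update s1' 2 (s1' 0) (2 + y)) s1'0.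
have [s2' [e2' s21 fr2]] := exec_shift e2.
have loop l1 l2 s3 : l x = l1 ++ l2 -> s3 0 = env x -> s3 1 = enc l2 ->
    s3 2 = enc (foldl (fun s y => g x y s) (z x) l1) ->
  exists t s4, [/\ exec (While (Var 1) body) s3 t s4,
    s4 2 = enc (foldl (fun s y => g x y s) (z x) (l x)) &
    t <= size l2 * ((mu x).+2 ^ k + 14) + 2].
  elim: l2 l1 s3 => [|y l2 IH] l1 s3 lE s30 s31 s32.
    exists 2, s3; split=> //; last by rewrite lE cats0.
    by apply: (@ExecWhileFalse (Var 1)); rewrite /= s31.
  pose st := foldl (fun s y => g x y s) (z x) l1.
  have dw : @dom (ext (fun x (ys : Y * S) => exists l1 l2,
      l x = l1 ++ ys.1 :: l2 /\ ys.2 = foldl (fun s y => g x y s) (z x) l1)) (x, (y, st)).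
    by split=> //; exists l1, l2.
  pose s4 := update s3 3 (eval s3 (Node (Node (Left (Var 1)) (Var 2)) (Var 0))).
  have s43 : s4 3 = node (node (enc y) (enc st)) (env x).
    by rewrite /s4 /update /= s31 s32 s30.
  have [t [s5 [e5 s50 ht]]] := exg _ dw (fun y => s4 (3 + y)) s43.
  have [s5' [e5' s53 fr5]] := exec_shift e5.
  pose s6 := update s5' 2 (s5' 3).
  pose s7 := update s6 1 (eval s6 (Right (Var 1))).
  have [|||| t' [s8 [e8 s82 ht']]] := IH (rcons l1 y) s7.
  - by rewrite cat_rcons.
  - by rewrite /s7 /s6 /update /= fr5.
  - by rewrite /s7 /s6 /update /= fr5 //= /s4 /update /= s31.
  - by rewrite /s7 /s6 /update /= s53 s50 foldl_rcons.
  exists (2 + ((7 + t) + (2 + 3)) + t'), s8; split=> //.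
    apply: ExecWhileTrue e8; first by rewrite /= s31.
    apply: ExecSeq; first exact: ExecSeq (ExecAssign 3 _ _) e5'.
    exact: ExecSeq (ExecAssign 2 (Var 3) _) (ExecAssign 1 (Right (Var 1)) _).
  have := bg _ dw; rewrite /= mulSn => bt; lia.
have [|||| t3 [s3 [e3 s32 ht3]]] := loop [::] (l x) s2'.
- by [].
- by rewrite fr2.
- by rewrite fr2 //= /update /= s11 s10.
- by rewrite s21 s20.
exists ((2 + t1) + ((2 + t2) + (t3 + 2))), (update s3 0 (s3 2)); split; last by lia.
  apply: ExecSeq (ExecSeq (ExecAssign 1 (Var 0) s) e1') _.
  apply: ExecSeq (ExecSeq (ExecAssign 2 (Var 0) s1') e2') _.
  exact: ExecSeq e3 (ExecAssign 0 (Var 2) _).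
by rewrite /update.
Qed.

Lemma FP_rev T `{encoding T} (l : X -> seq T) :
  bounded (fun x => size (l x)) -> FP l -> FP (fun x => rev (l x)).
Proof.
move=> bl fl.
have := @FP_foldl T (seq T) _ _ l (fun _ => [::]) (fun _ y s => y :: s) fl
  (FP_const _ _) bl.
have revE (r : seq T) : foldl (fun s y => y :: s) [::] r = rev r.
  suff gen s0 : foldl (fun s y => y :: s) s0 r = rev r ++ s0 by rewrite gen cats0.
  by elim: r s0 => //= y r IH s0; rewrite IH rev_cons cat_rcons.
case.
  apply: FP_cons; first exact: FP_fst (FP_var).
  exact: FP_snd (FP_var).
by move=> c [h bh ex]; exists c, h => // x hx s /(ex x hx); rewrite revE.
Qed.

End Loops.

Lemma FP_eq (X : ctx) T `{encoding T} (f g : X -> T) :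
  (forall x : X, dom x -> f x = g x) -> FP f -> FP g.
Proof.
move=> fg [c [h bh ex]]; exists c, h => // x hx s /(ex x hx).
by rewrite (fg x hx).
Qed.

Lemma FP_subst_expr (X Y : ctx) T `{encoding T} (f : Y -> T) (ff : FP f)
    (r : X -> Y) (e : expr) :
    (forall x, dom x -> dom (r x) /\ mu (r x) <= mu x) ->
    (forall x s, dom x -> s 0 = env x -> eval s e = env (r x)) ->
  FP (fun x => f (r x)).
Proof.
move=> hr he; apply: (@FP_subst X Y) => //.
exists (Assign 0 e), (fun _ => (cost e).+1); first exact: bounded_const.
move=> x hx s s0; exists (cost e).+1, (update s 0 (eval s e)); split=> //.
  exact: ExecAssign.
by rewrite /update /= (he x).
Qed.

Lemma FP_strengthen (X : ctx) S T `{encoding S} `{encoding T} (P Q : X -> S -> Prop)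
    (f : X * S -> T) :
    (forall x a, dom x -> P x a -> Q x a) ->
  FP (X := ext Q) f -> FP (X := ext P) f.
Proof.
move=> PQ [c [h [k hk] ex]]; exists c, h.
  by exists k => w [hx /PQ hQ]; apply: (hk w); split=> //; exact: hQ.
by move=> w [hx /PQ hQ]; apply: (ex w); split=> //; exact: hQ.
Qed.

(** * Lists and unary arithmetic *)

Section Library.
Variable X : ctx.

Lemma FP_foldr Y S `{encoding Y} `{encoding S} (l : X -> seq Y) (z : X -> S)
    (g : X -> Y -> S -> S) :
    FP l -> FP z -> bounded (fun x => size (l x)) ->
    FP (X := ext (fun x (ys : Y * S) => exists l1 l2,
          l x = l1 ++ ys.1 :: l2 /\ ys.2 = foldr (g x) (z x) l2))
       (fun w => g w.1 w.2.1 w.2.2) ->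
  FP (fun x => foldr (g x) (z x) (l x)).
Proof.
move=> fl fz bl fg; apply: (@FP_eq _ _ _ (fun x => foldl (fun s y => g x y s) (z x) (rev (l x)))).
  by move=> x _; rewrite foldl_rev.
apply: (FP_foldl (g := g)) => //; first exact: FP_rev.
  by apply: bounded_le bl _ => x _; rewrite size_rev.
apply: FP_strengthen fg => x [y s] hx /= [l1 [l2 [lE ->]]].
exists (rev l2), (rev l1); split; first by rewrite -[LHS]revK lE rev_cat rev_cons cat_rcons.
by rewrite -[in LHS](revK l1) foldl_rev.
Qed.

(** With this encoding a list of units has the same tree as its length, so that an iteration is a
    fold over a list that is available without any computation. *)
#[local] Instance unit_encoding : encoding unit := fun _ => leaf.

Lemma FP_iter S `{encoding S} (n : X -> nat) (z : X -> S) (g : X -> S -> S) :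
    FP n -> FP z -> bounded n ->
    FP (X := ext (fun x s => exists2 j, j < n x & s = iter j (g x) (z x)))
       (fun w => g w.1 w.2) ->
  FP (fun x => iter (n x) (g x) (z x)).
Proof.
move=> fn fz bn fg.
have itE x j : foldl (fun s _ => g x s) (z x) (nseq j tt) = iter j (g x) (z x).
  elim: j (z x) => //= j IH s; rewrite -iterS iterSr /= -IH.
  by congr foldl.
apply: FP_eq (fun x _ => itE x (n x)) _.
apply: (FP_foldl (g := fun x _ s => g x s)) => //.
- apply: (FP_expr (e := Var 0) _ fn) => x s /= ->; rewrite /enc.
  by elim: (n x) => //= j; rewrite /enc_nat /= => ->.
- by apply: bounded_le bn _ => x _; rewrite size_nseq.
- apply: (@FP_subst_expr (ext _) _ _ _ _ fg (fun w => (w.1, w.2.2))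
    (Node (Right (Left (Var 0))) (Right (Var 0)))).
    move=> [x [y s]] [/= hx [l1 [l2 [lE ->]]]]; split=> //; split=> //=.
    have := congr1 size lE; rewrite size_nseq size_cat /= => nE.
    exists (size l1); first by lia.
    suff -> : l1 = nseq (size l1) tt by rewrite itE size_nseq.
    by elim: (l1) => //= -[] r {1}->.
  by move=> [x [y s]] st _ /= ->.
Qed.

Lemma FP_map (Y : eqType) Z `{encoding Y} `{encoding Z} (l : X -> seq Y)
    (f : X -> Y -> Z) :
    FP l -> bounded (fun x => size (l x)) ->
    FP (X := ext (fun x y => y \in l x)) (fun w => f w.1 w.2) ->
  FP (fun x => [seq f x y | y <- l x]).
Proof.
move=> fl bl ff.
apply: (FP_foldr (g := fun x y s => f x y :: s) fl (FP_const X (T := seq Z) [::]) bl).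
apply: FP_cons; last exact: FP_snd (FP_var).
apply: (@FP_subst_expr (ext _) _ _ _ _ ff (fun w => (w.1, w.2.1))
   (Node (Left (Left (Var 0))) (Right (Var 0)))).
  move=> [x [y s]] [/= hx [l1 [l2 [lE _]]]]; split=> //; split=> //=.
  by rewrite lE mem_cat inE eqxx orbT.
by move=> [x [y s]] st _ /= ->.
Qed.

Lemma FP_cat T `{encoding T} (l1 l2 : X -> seq T) :
  FP l1 -> FP l2 -> bounded (fun x => size (l1 x)) -> FP (fun x => l1 x ++ l2 x).
Proof.
move=> f1 f2 b1.
apply: (@FP_eq _ _ _ (fun x => foldr cons (l2 x) (l1 x))).
  by move=> x _; elim: (l1 x) => //= y l ->.
apply: (FP_foldr (g := fun _ => cons)) => //.
by apply: FP_cons; [apply: FP_fst|apply: FP_snd]; exact: FP_var.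
Qed.

Lemma FP_if (b : X -> bool) T `{encoding T} (f g : X -> T) :
  FP b -> FP f -> FP g -> FP (fun x => if b x then f x else g x).
Proof.
move=> fb ff fg; apply: FP_eq _ (FP_if_node fb ff fg) => x _.
by case: (b x).
Qed.

Lemma FP_pos (f : X -> nat) : FP f -> FP (fun x => 0 < f x).
Proof.
move=> ff; apply: FP_eq _ (FP_if_node ff (FP_const X true) (FP_const X false)) => x _.
by case: (f x).
Qed.

Lemma FP_nonnil T `{encoding T} (f : X -> seq T) : FP f -> FP (fun x => 0 < size (f x)).
Proof.
move=> ff; apply: FP_eq _ (FP_if_node ff (FP_const X true) (FP_const X false)) => x _.
by case: (f x).
Qed.

Lemma FP_not (b : X -> bool) : FP b -> FP (fun x => ~~ b x).
Proof.
move=> fb; apply: FP_eq _ (FP_if fb (FP_const X false) (FP_const X true)) => x _.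
by case: (b x).
Qed.

Lemma FP_and (b c : X -> bool) : FP b -> FP c -> FP (fun x => b x && c x).
Proof.
move=> fb fc; apply: FP_eq _ (FP_if fb fc (FP_const X false)) => x _.
by case: (b x).
Qed.

Lemma FP_addn (f g : X -> nat) : FP f -> FP g -> bounded f -> FP (fun x => f x + g x).
Proof.
move=> ff fg bf; apply: (@FP_eq _ _ _ (fun x => iter (f x) succn (g x))).
  by move=> x _; rewrite iter_succn addnC.
by apply: (FP_iter (g := fun _ => succn)) => //; apply/FP_succ/FP_var.
Qed.

Lemma FP_subn (f g : X -> nat) : FP f -> FP g -> bounded g -> FP (fun x => f x - g x).
Proof.
move=> ff fg bg; apply: (@FP_eq _ _ _ (fun x => iter (g x) predn (f x))).
  by move=> x _; rewrite iter_predn.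
by apply: (FP_iter (g := fun _ => predn)) => //; apply/FP_pred/FP_var.
Qed.

(** Truncated subtraction removes one unit of [f] per unit of [g], so that only the right-hand side
    has to be bounded. The left-hand side can be the threshold of a gate, which may be arbitrarily
    large. *)
Lemma FP_leq (f g : X -> nat) : FP f -> FP g -> bounded g -> FP (fun x => f x <= g x).
Proof.
move=> ff fg bg; apply: FP_eq (FP_not (FP_pos (FP_subn ff fg bg))) => x _.
by rewrite -eqn0Ngt.
Qed.

Lemma FP_eqn (f g : X -> nat) :
  FP f -> FP g -> bounded f -> bounded g -> FP (fun x => f x == g x).
Proof.
move=> ff fg bf bg; apply: FP_eq (FP_and (FP_leq ff fg bg) (FP_leq fg ff bf)) => x _.
by rewrite -eqn_leq.
Qed.

Lemma FP_maxn (f g : X -> nat) :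
  FP f -> FP g -> bounded f -> bounded g -> FP (fun x => maxn (f x) (g x)).
Proof.
move=> ff fg bf bg; apply: FP_eq (FP_addn ff (FP_subn fg ff bf) bf) => x _.
by rewrite maxnE.
Qed.

Lemma FP_size T `{encoding T} (l : X -> seq T) :
  FP l -> bounded (fun x => size (l x)) -> FP (fun x => size (l x)).
Proof.
move=> fl bl; apply: (@FP_eq _ _ _ (fun x => foldr (fun _ => succn) 0 (l x))).
  by move=> x _; elim: (l x) => //= y r ->.
apply: (FP_foldr (g := fun _ _ => succn)) => //; first exact: FP_const.
by apply/FP_succ/FP_snd/FP_var.
Qed.

End Library.

Section Library2.
Variable X : ctx.

Lemma FP_flatten (T : eqType) `{encoding T} (l : X -> seq (seq T)) (B : X -> nat) :
    bounded B -> (forall x, dom x -> size (l x) <= B x) ->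
    (forall x r, dom x -> r \in l x -> size r <= B x) ->
  FP l -> FP (fun x => flatten (l x)).
Proof.
move=> bB h1 h2 fl.
apply: (FP_foldr (g := fun _ => cat) fl (FP_const X (T := seq T) [::])).
  exact: bounded_le bB h1.
apply: FP_cat.
- exact: FP_fst (FP_var).
- exact: FP_snd (FP_var).
- apply: bounded_le (bounded_weak bB) _ => -[x [r s]] [/= hx [l1 [l2 [lE _]]]].
  by apply: h2 => //; rewrite lE mem_cat inE eqxx orbT.
Qed.

Lemma FP_muln (f g : X -> nat) :
  FP f -> FP g -> bounded f -> bounded g -> FP (fun x => f x * g x).
Proof.
move=> ff fg bf bg; apply: (@FP_eq _ _ _ (fun x => iter (f x) (addn (g x)) 0)).
  by move=> x _; rewrite iter_addn_0 mulnC.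
apply: (FP_iter (g := fun x => addn (g x))) => //; first exact: FP_const.
apply: FP_addn; [exact: FP_weak|exact: FP_var|exact: bounded_weak].
Qed.

Lemma FP_exp (f : X -> nat) k : FP f -> bounded f -> FP (fun x => f x ^ k).
Proof.
move=> ff bf; elim: k => [|k IH]; first exact: FP_const.
apply: FP_eq (fun x _ => esym (expnS (f x) k)) _.
by apply: FP_muln => //; exact: bounded_exp.
Qed.

Lemma FP_pow2 (f : X -> nat) :
  FP f -> bounded f -> bounded (fun x => 2 ^ f x) -> FP (fun x => 2 ^ f x).
Proof.
move=> ff bf b2; apply: (@FP_eq _ _ _ (fun x => iter (f x) (fun m => m + m) 1)).
  by move=> x _; elim: (f x) => //= j ->; rewrite addnn -mul2n expnS.
apply: (FP_iter (g := fun _ m => m + m)) => //; first exact: FP_const.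
apply: FP_addn; [exact: FP_var|exact: FP_var|].
apply: bounded_le (bounded_weak b2) _ => -[x m] [_ [j jlt /= ->]].
have -> : iter j (fun m => m + m) 1 = 2 ^ j.
  by elim: (j) => //= i ->; rewrite addnn -mul2n expnS.
by rewrite leq_exp2l // ltnW.
Qed.

End Library2.

Section Library3.
Variable X : ctx.

Lemma iter_divn B q j : 0 < B ->
  iter j (fun m => if B * m.+1 <= q then m.+1 else m) 0 = minn j (q %/ B).
Proof.
move=> B0; elim: j => [|j IH]; first by rewrite min0n.
rewrite iterS IH mulnC -leq_divRL //; case: leqP; lia.
Qed.

Lemma FP_divn (f g : X -> nat) : (forall x, dom x -> 0 < g x) ->
  FP f -> FP g -> bounded f -> bounded g -> FP (fun x => f x %/ g x).
Proof.
move=> g0 ff fg bf bg.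
apply: (@FP_eq _ _ _ (fun x => iter (f x) (fun m => if g x * m.+1 <= f x then m.+1 else m) 0)).
  by move=> x hx; rewrite iter_divn ?g0 //; apply/minn_idPr; rewrite leq_div.
apply: (FP_iter (g := fun x m => if g x * m.+1 <= f x then m.+1 else m)) => //.
  exact: FP_const.
apply: FP_if; [|exact/FP_succ/FP_var|exact: FP_var].
apply: FP_leq; [|exact: FP_weak|exact: bounded_weak].
apply: FP_muln; [exact: FP_weak|exact/FP_succ/FP_var|exact: bounded_weak|].
apply: bounded_le (bounded_add (bounded_weak bf) (bounded_const _ 1)) _.
move=> -[x m] [hx [j jlt /= ->]]; rewrite iter_divn ?g0 // addn1 ltnS.
by apply: leq_trans (geq_minr _ _) _; rewrite leq_div.
Qed.

Lemma FP_nth T `{encoding T} (x0 : T) (l : X -> seq T) (i : X -> nat) :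
    FP l -> FP i -> bounded (fun x => size (l x)) -> bounded i ->
  FP (fun x => nth x0 (l x) (i x)).
Proof.
move=> fl fi bl bi; apply: (@FP_eq _ _ _ (fun x => foldr (fun y _ => y) x0 (drop (i x) (l x)))).
  move=> x _; rewrite -[i x in RHS]addn0 -nth_drop nth0.
  by case: (drop _ _).
apply: (FP_foldr (g := fun _ y _ => y)).
- apply: (@FP_eq _ _ _ (fun x => iter (i x) behead (l x))).
    by move=> x _; elim: (i x) => [|j IH]; rewrite ?drop0 // iterS IH -drop1 drop_drop add1n.
  by apply: (FP_iter (g := fun _ => behead)) => //; apply/FP_behead/FP_var.
- exact: FP_const.
- by apply: bounded_le bl _ => x _; rewrite size_drop leq_subr.
- exact: FP_fst (FP_var).
Qed.

Lemma FP_allpairs (S T : eqType) Z `{encoding S} `{encoding T} `{encoding Z}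
    (s : X -> seq S) (t : X -> seq T) (f : X -> S -> T -> Z) :
    FP s -> FP t -> bounded (fun x => size (s x)) -> bounded (fun x => size (t x)) ->
    FP (X := ext (fun x (ab : S * T) => (ab.1 \in s x) && (ab.2 \in t x)))
       (fun w => f w.1 w.2.1 w.2.2) ->
  FP (fun x => [seq f x a b | a <- s x, b <- t x]).
Proof.
move=> fs ft bs bt ff.
apply: (@FP_eq _ _ _ (fun x => foldr (fun a r => [seq f x a b | b <- t x] ++ r) [::] (s x))).
  by move=> x _; elim: (s x) => //= a r ->.
apply: (FP_foldr (g := fun x a r => [seq f x a b | b <- t x] ++ r)) => //.
  exact: FP_const.
apply: FP_cat; [|exact: FP_snd (FP_var)|].
  apply: (@FP_map (ext _) T Z _ _ (fun w => t w.1) (fun w b => f w.1 w.2.1 b)); [exact: FP_weak ft|exact: bounded_weak bt|].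
  apply: (@FP_subst_expr (ext (X := ext _) _) _ _ _ _ ff (fun w => (w.1.1, (w.1.2.1, w.2)))
    (Node (Node (Left (Left (Right (Var 0)))) (Left (Var 0))) (Right (Right (Var 0))))).
    move=> [[x [a r]] b] [[/= hx [l1 [l2 [lE _]]]] bt']; do !split=> //=.
    by rewrite bt' lE mem_cat inE eqxx orbT.
  by move=> [[x [a r]] b] st _ /= ->.
by apply: bounded_le (bounded_weak bt) _ => w _; rewrite size_map.
Qed.

End Library3.

(** * Tables: unions of cylinders carrying a value *)

(* As in [literal n], [(true, i)] is the variable [i], [(false, i)] its
   negation.  A term is a conjunction, a clause a disjunction. *)
Notation lit := (bool * nat)%type (only parsing).

(* A pair [(w, t)] in a table says that the represented number is [w] for the
   assignments that satisfy [t]. *)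
Notation ntable := (seq (nat * seq lit)) (only parsing).

Definition sat_lit (x : nat -> bool) (l : lit) := x l.2 == l.1.
Definition sat_term x (t : seq lit) := all (sat_lit x) t.
Definition sat_clause x (c : seq lit) := has (sat_lit x) c.

(** The terms need not be disjoint. That some true term exists makes equality clauses strong enough
    to force equality; that all true terms agree makes them hold when the values are equal. *)
Definition represents x (S : ntable) w :=
  (exists2 t, t \in S & (t.1 == w) && sat_term x t.2) /\
  {in S, forall t, sat_term x t.2 -> t.1 = w}.

Definition double_table (S : ntable) : ntable := [seq (s.1 + s.1, s.2) | s <- S].

Definition add_table (S T : ntable) : ntable :=
  [seq (s.1 + t.1, s.2 ++ t.2) | s <- S, t <- T].

Definition var_table v : ntable := [:: (0, [:: (false, v)]); (1, [:: (true, v)])].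

Definition bits_table (vs : seq nat) : ntable :=
  foldr (fun v S => add_table (var_table v) (double_table S)) [:: (0, [::])] vs.

Definition bits_value (x : nat -> bool) (vs : seq nat) :=
  foldr (fun v n => x v + n.*2) 0 vs.

Definition neg_term (t : seq lit) : seq lit := [seq (~~ l.1, l.2) | l <- t].

(** Each clause forbids two terms with different values to hold together. No variable is added, and
    the number of clauses is at most the product of the sizes of the tables. *)
Definition equality_clauses (S T : ntable) : seq (seq lit) :=
  flatten [seq if s.1 == t.1 then [::] else [:: neg_term (s.2 ++ t.2)] | s <- S, t <- T].

Lemma sat_neg_term x t : sat_clause x (neg_term t) = ~~ sat_term x t.
Proof.
elim: t => //= l t IH; rewrite negb_and -IH /=; congr orb.
by rewrite /sat_lit /=; case: (x _); case: l.1.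
Qed.

Lemma sat_term_cat x s t : sat_term x (s ++ t) = sat_term x s && sat_term x t.
Proof. exact: all_cat. Qed.

Lemma represents_add x S T w w' :
  represents x S w -> represents x T w' -> represents x (add_table S T) (w + w').
Proof.
move=> [[s sS /andP[/eqP sw sx]] hS] [[t tT /andP[/eqP tw tx]] hT]; split.
  exists (s.1 + t.1, s.2 ++ t.2).
    exact: (allpairs_f (fun s t => (s.1 + t.1, s.2 ++ t.2))).
  by rewrite /= sw tw eqxx sat_term_cat sx.
move=> _ /allpairsP[[s' t'] [/= s'S t'T ->]] /=.
rewrite sat_term_cat => /andP[sx' tx'].
by rewrite (hS s') // (hT t').
Qed.

Lemma represents_double x S w :
  represents x S w -> represents x (double_table S) (w + w).
Proof.
move=> [[s sS /andP[/eqP sw sx]] hS]; split.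
  by exists (s.1 + s.1, s.2); [apply/mapP; exists s|rewrite /= sw eqxx].
by move=> _ /mapP[s' s'S ->] /= sx'; rewrite (hS s').
Qed.

Lemma represents_unit x w : represents x [:: (w, [::])] w.
Proof.
split; first by exists (w, [::]); rewrite ?mem_head //= eqxx.
by move=> t; rewrite inE => /eqP ->.
Qed.

Lemma represents_var x v : represents x (var_table v) (x v).
Proof.
split; first exists (nat_of_bool (x v), [:: (x v, v)]).
- by rewrite !inE; case: (x v); rewrite eqxx ?orbT.
- by rewrite /sat_term /= /sat_lit /= !eqxx.
- by move=> t; rewrite !inE => /orP[] /eqP ->; rewrite /sat_term /= /sat_lit /= andbT => /eqP ->.
Qed.

Lemma represents_bits x vs : represents x (bits_table vs) (bits_value x vs).
Proof.
elim: vs => [|v vs IH]; first exact: represents_unit.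
rewrite /= -addnn; apply: represents_add (represents_var _ _) _.
exact: represents_double.
Qed.

Lemma represents_map x S w (h : nat -> nat) :
  represents x S w -> represents x [seq (h s.1, s.2) | s <- S] (h w).
Proof.
move=> [[s sS /andP[/eqP sw sx]] hS]; split.
  by exists (h s.1, s.2); [apply/mapP; exists s|rewrite /= sw eqxx].
by move=> _ /mapP[s' s'S ->] /= sx'; rewrite (hS s').
Qed.

Lemma equality_clausesP x S T w w' : represents x S w -> represents x T w' ->
  all (sat_clause x) (equality_clauses S T) = (w == w').
Proof.
move=> [[s sS /andP[/eqP sw sx]] hS] [[t tT /andP[/eqP tw tx]] hT].
apply/allP/eqP => [hall|ww' c].
  apply/eqP/negPn/negP => ne.
  have /hall : neg_term (s.2 ++ t.2) \in equality_clauses S T.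
    apply/flattenP; exists [:: neg_term (s.2 ++ t.2)]; last exact: mem_head.
    by apply/allpairsP; exists (s, t); rewrite /= sw tw (negbTE ne).
  by rewrite sat_neg_term sat_term_cat sx tx.
case/flattenP => _ /allpairsP[[s' t'] [/= s'S t'T ->]].
case: eqP => // ne; rewrite inE => /eqP ->.
rewrite sat_neg_term sat_term_cat; apply/negP => /andP[sx' tx'].
by case: ne; rewrite (hS s') ?(hT t').
Qed.

(** * The formula attached to an annotated circuit *)

(* As in [enc_vertex]: [(false, i)] is an input gate, [(true, g)] another gate. *)
Notation vert := (bool * nat)%type (only parsing).

(* Each wire [u] into a gate carries two lists of variables: the first is empty
   or holds one variable standing for the value of [u] along this wire; the
   second is empty or holds the bits of the number of true inputs of the gate
   found so far, the wires into a gate being scanned from the last one. *)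
Notation awire := (vert * (seq nat * seq nat))%type (only parsing).
Notation agate := (nat * nat * seq awire)%type (only parsing).
Notation entry := (ntable * seq (seq lit))%type (only parsing).

(* The codes of labels are those of [enc_label]. *)
Definition gate_bit (l : nat * nat) (fan w : nat) : bool :=
  if 0 < l.1 then
    (if 0 < l.1.-1 then if 0 < l.1.-2 then l.2 else 1 else fan) <= w
  else ~~ (0 < w).

Definition vert_table (tab : seq entry) (u : vert) : ntable :=
  if u.1 then (nth ([::], [::]) tab u.2).1 else bits_table [:: u.2].

(** Wherever a quantity is named, the table obtained so far goes into clauses, and the scan
    continues with a table over the new variables only. This is what stops the growth of the
    tables. *)
Definition wire_step (tab : seq entry) (w : awire) (e : entry) : entry :=
  let S := add_table e.1
    (if 0 < size w.2.1 then bits_table w.2.1 else vert_table tab w.1) in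
  let F := (if 0 < size w.2.1
    then equality_clauses (vert_table tab w.1) (bits_table w.2.1) else [::]) ++ e.2 in
  if 0 < size w.2.2
  then (bits_table w.2.2, equality_clauses S (bits_table w.2.2) ++ F) else (S, F).

Definition wires_entry tab ws : entry :=
  foldr (wire_step tab) ([:: (0, [::])], [::]) ws.

Definition gate_entry (tab : seq entry) (g : agate) : entry :=
  ([seq (gate_bit g.1 (size g.2) s.1 : nat, s.2) | s <- (wires_entry tab g.2).1],
   (wires_entry tab g.2).2).

(* After [r] rounds the entries of the gates of level less than [r] are final,
   whatever the order of the gates. *)
Definition tables (A : seq agate) r : seq entry :=
  iter r (fun tab => [seq gate_entry tab g | g <- A]) [::].

Definition formula (A : seq agate) (out : vert) r : seq (seq lit) :=
  equality_clauses (vert_table (tables A r) out) [:: (1, [::])] ++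
  flatten [seq e.2 | e <- tables A r].

Section Correctness.
Variables (x v : nat -> bool).

Definition vert_value (u : vert) : bool := if u.1 then v u.2 else x u.2.

Definition wires_count (ws : seq awire) := count (fun w => vert_value w.1) ws.

Fixpoint consistent (ws : seq awire) : Prop :=
  if ws is w :: ws' then
    [/\ 0 < size w.2.1 -> bits_value x w.2.1 = vert_value w.1,
        0 < size w.2.2 -> bits_value x w.2.2 = wires_count ws
      & consistent ws']
  else True.

(** The two claims need each other: the clauses at a wire express the intended equality only if the
    table of the wires already scanned is correct, and this in turn requires these wires to be
    consistent. *)
Lemma wires_entryP tab ws :
    {in ws, forall w, represents x (vert_table tab w.1) (vert_value w.1)} ->
  (all (sat_clause x) (wires_entry tab ws).2 <-> consistent ws) /\
  (consistent ws -> represents x (wires_entry tab ws).1 (wires_count ws)).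
Proof.
elim: ws => [|[u [cut ren]] ws IH] hrep; first by split=> // _; exact: represents_unit.
have hu := hrep _ (mem_head _ _).
have [|IH1 IH2] := IH; first by move=> w hw; apply: hrep; rewrite inE hw orbT.
rewrite /= /wire_step /=; set S := add_table _ _.
set E1 := (if 0 < size cut then _ else _).
have hE1 : all (sat_clause x) E1 <-> (0 < size cut -> bits_value x cut = vert_value u).
  rewrite /E1; case: ifP => // _.
  rewrite (equality_clausesP hu (represents_bits x cut)).
  by split=> [/eqP <-|/(_ isT) ->].
have hS : consistent ws -> (0 < size cut -> bits_value x cut = vert_value u) ->
    represents x S (wires_count ((u, (cut, ren)) :: ws)).
  move=> hc hcut; rewrite /wires_count /= addnC; apply: represents_add (IH2 hc) _.
  by case: ifP hcut => // _ /(_ isT) <-; exact: represents_bits.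
case: ifP => hren /=; split.
- rewrite !all_cat; split.
    case/and3P=> hc /hE1 h1 /IH1 h2; split=> // _.
    by move: hc; rewrite (equality_clausesP (hS h2 h1) (represents_bits x ren)) => /eqP.
  case=> h1 h2 h3; apply/and3P; split; [|exact/hE1|exact/IH1].
  by rewrite (equality_clausesP (hS h3 h1) (represents_bits x ren)) h2.
- by case=> h1 h2 h3; rewrite -h2 //; exact: represents_bits.
- rewrite all_cat; split; first by case/andP=> /hE1 h1 /IH1.
  by case=> /hE1 -> _ /IH1.
- by case=> h1 _ h3; exact: hS.
Qed.

Variables (A : seq agate) (lev : nat -> nat).
Local Notation gt := (nth ((0, 0), [::]) A).

Hypothesis lev_lt : forall i w, i < size A -> w \in (gt i).2 -> w.1.1 ->
  w.1.2 < size A /\ lev w.1.2 < lev i.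
Hypothesis v_valid : forall i, i < size A ->
  v i = gate_bit (gt i).1 (size (gt i).2) (wires_count (gt i).2).

Lemma nth_tables r i : i < size A ->
  nth ([::], [::]) (tables A r.+1) i = gate_entry (tables A r) (gt i).
Proof. by move=> hi; rewrite /= (nth_map ((0, 0), [::])). Qed.

Lemma represents_vert r (u : vert) :
    (u.1 -> represents x (nth ([::], [::]) (tables A r) u.2).1 (v u.2)) ->
  represents x (vert_table (tables A r) u) (vert_value u).
Proof.
rewrite /vert_table /vert_value; case: ifP => _ hu; first exact: hu.
have -> : x u.2 = bits_value x [:: u.2] :> nat by rewrite /= ?double0 addn0.
exact: represents_bits.
Qed.

(** Consistency is assumed only up to the level of [i], which allows [formulaP] to derive
    consistency itself by induction on levels. *)
Lemma tables_represent r i :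
    (forall j, j < size A -> lev j <= lev i -> consistent (gt j).2) ->
    i < size A -> lev i < r ->
  represents x (nth ([::], [::]) (tables A r) i).1 (v i).
Proof.
elim: r i => // r IH i hc hi hr; rewrite nth_tables // v_valid //.
apply: (represents_map (fun c => gate_bit (gt i).1 (size (gt i).2) c : nat)).
apply: (wires_entryP _).2; last exact: hc.
move=> w hw; apply: represents_vert => hw1.
have [hs hl] := lev_lt hi hw hw1; apply: IH; [|exact: hs|exact: leq_trans hl hr].
by move=> j hj hlj; apply: hc => //; exact: leq_trans hlj (ltnW hl).
Qed.

Variables (out : vert) (r : nat).
Hypothesis lev_r : forall i, i < size A -> lev i < r.
Hypothesis out_size : out.1 -> out.2 < size A.

Lemma all_represent : (forall j, j < size A -> consistent (gt j).2) ->
  forall u : vert, (u.1 -> u.2 < size A) ->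
  represents x (vert_table (tables A r) u) (vert_value u).
Proof.
move=> hc u hu; apply: represents_vert => u1.
by apply: tables_represent => //; [move=> j hj _; exact: hc|exact: hu|exact/lev_r/hu].
Qed.

Lemma sat_entriesP :
  all (sat_clause x) (flatten [seq e.2 | e <- tables A r.+1]) <->
  forall j, j < size A -> all (sat_clause x) (wires_entry (tables A r) (gt j).2).2.
Proof.
split=> [/allP h j hj|h].
  apply/allP => c hc; apply: h; apply/flattenP.
  exists (wires_entry (tables A r) (gt j).2).2 => //.
  apply/mapP; exists (gate_entry (tables A r) (gt j)) => //.
  by apply: map_f; exact: mem_nth.
apply/allP => c /flattenP[_ /mapP[_ /mapP[g /(nthP ((0, 0), [::]))[j hj <-] ->] ->] hc].
exact: (allP (h j hj)).
Qed.

(** The clauses of a gate are produced from the tables of the preceding round. After [r] rounds all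
    tables are final, so the clauses of round [r.+1] are the right ones. *)
Lemma formulaP : all (sat_clause x) (formula A out r.+1) <->
  (forall j, j < size A -> consistent (gt j).2) /\ vert_value out.
Proof.
have rep_out : (forall j, j < size A -> consistent (gt j).2) ->
    represents x (vert_table (tables A r.+1) out) (vert_value out).
  move=> hc; apply: represents_vert => o1.
  apply: tables_represent; [by move=> j hj _; exact: hc|exact: out_size|].
  exact/leqW/lev_r/out_size.
rewrite /formula all_cat; split.
  case/andP=> ho /sat_entriesP hA.
  have hc : forall j, j < size A -> consistent (gt j).2.
    (* Strong induction on the level of [j]: the gates that feed [j] are lower, hence consistent
       together with everything below them, so that their tables are correct and the clauses of [j]
       can be interpreted. *)
    move=> j; have [n] := ubnP (lev j); elim: n j => // n IH j hn hj.
    apply: (wires_entryP _).1.1 (hA j hj) => w hw.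
    apply: represents_vert => w1; have [hs hl] := lev_lt hj hw w1.
    apply: tables_represent => //; last exact: lev_r.
    by move=> i hi hl'; apply: IH => //; exact: leq_ltn_trans hl' (leq_trans hl hn).
  split=> //; move: ho; rewrite (equality_clausesP (rep_out hc) (represents_unit x 1)).
  by case: vert_value.
case=> hc ho; apply/andP; split.
  by rewrite (equality_clausesP (rep_out hc) (represents_unit x 1)) ho.
apply/sat_entriesP => j hj; apply: (wires_entryP _).1.2; last exact: hc.
move=> w hw; apply: all_represent => // w1.
by case: (lev_lt hj hw w1).
Qed.

End Correctness.

(** * Choosing the auxiliary variables *)

Notation rgate := (nat * nat * seq vert)%type (only parsing).

Definition fresh f p : seq nat := iter p (fun l => (f + size l) :: l) [::].

Definition annotate_wire p L (cut : vert -> bool) (u : vert)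
    (st : nat * nat * seq awire) : nat * nat * seq awire :=
  let f := if cut u then st.1.2.+1 else st.1.2 in
  let c := if cut u then [:: st.1.2] else [::] in
  if L <= st.1.1.+1 then (0, f + p, (u, (c, fresh f p)) :: st.2)
  else (st.1.1.+1, f, (u, (c, [::])) :: st.2).

(** The counter of wires is handed over from gate to gate instead of being reset. Small gates then
    need no bits of their own, and bits are introduced at most once per [L] wires of the whole
    circuit. *)
Definition annotate_gate p L (cut : rgate -> vert -> bool) (g : rgate)
    (st : nat * nat * seq agate) : nat * nat * seq agate :=
  let r := foldr (annotate_wire p L (cut g)) (st.1, [::]) g.2 in
  (r.1, (g.1, r.2) :: st.2).

(* The state is the number of wires since bits were last introduced and the
   first unused variable. *)
Definition annotate p L cut n (G : seq rgate) : nat * nat * seq agate :=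
  foldr (annotate_gate p L cut) (0, n, [::]) G.

Definition wires_vars (ws : seq awire) := flatten [seq w.2.1 ++ w.2.2 | w <- ws].
Definition gates_vars (A : seq agate) := flatten [seq wires_vars g.2 | g <- A].

Definition fresh_in (l : seq nat) f f' :=
  [&& f <= f', uniq l & all (fun i => f <= i < f') l].

Definition well_sized p (cut : vert -> bool) (w : awire) :=
  (size w.2.1 == cut w.1) && (size w.2.2 \in [:: 0; p]).

(* Number of wires scanned since bits were last introduced. *)
Definition gap (ws : seq awire) : nat :=
  foldr (fun (w : awire) m => if 0 < size w.2.2 then 0 else m.+1) 0 ws.

Lemma freshE f p : fresh f p = rev (iota f p).
Proof.
elim: p => // p IH; rewrite /fresh iterS -/(fresh f p) IH -addn1 iotaD rev_cat /=.
by rewrite size_rev size_iota.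
Qed.

Lemma size_fresh f p : size (fresh f p) = p.
Proof. by rewrite freshE size_rev size_iota. Qed.

Lemma fresh_in_cat l1 l2 f1 f2 f3 :
  fresh_in l1 f2 f3 -> fresh_in l2 f1 f2 -> fresh_in (l1 ++ l2) f1 f3.
Proof.
case/and3P=> le23 u1 /allP a1 /and3P[le12 u2 /allP a2].
apply/and3P; split; first exact: leq_trans le12 le23.
  rewrite cat_uniq u1 u2 andbT; apply/hasPn => i /a2 /andP[_ i2].
  by apply/negP => /a1; rewrite leqNgt i2.
rewrite all_cat; apply/andP; split; apply/allP => i; [move/a1|move/a2]; lia.
Qed.

Lemma fresh_in_perm l1 l2 f f' : perm_eq l1 l2 -> fresh_in l1 f f' = fresh_in l2 f f'.
Proof. by move=> e; rewrite /fresh_in (perm_uniq e) (perm_all _ e). Qed.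

Lemma fresh_in_nil f : fresh_in [::] f f.
Proof. by rewrite /fresh_in leqnn. Qed.

Lemma fresh_in_fresh f p : fresh_in (fresh f p) f (f + p).
Proof.
rewrite /fresh_in freshE rev_uniq iota_uniq leq_addr all_rev /=.
by apply/allP => i; rewrite mem_iota.
Qed.

Section Annotate.
Variables (p L : nat) (p_gt0 : 0 < p).

(** Here [k] is the number of times that bits are introduced. The last inequality is an
    amortization: each introduction resets a counter that was about to reach [L], and each wire
    increases it by at most one. *)
Lemma annotate_wiresP cut c f us :
  let r := foldr (annotate_wire p L cut) (c, f, [::]) us in
  [/\ [seq w.1 | w <- r.2] = us, fresh_in (wires_vars r.2) f r.1.2,
      all (well_sized p cut) r.2
    & exists2 k, r.1.2 = f + count cut us + p * k & L * k + r.1.1 <= c + size us].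
Proof.
elim: us => [|u us] /=.
  split=> //; first exact: fresh_in_nil.
  by exists 0; rewrite ?muln0 ?addn0.
case: (foldr _ _ us) => -[c1 f1] ws /= [IH1 IH2 IH3 [k f1E kL]].
rewrite /annotate_wire /=; set f2 := if cut u then _ else _.
set cu := if cut u then _ else _.
have f2E : f2 = f1 + cut u by rewrite /f2; case: (cut u); rewrite ?addn1 ?addn0.
have scu : size cu = cut u by rewrite /cu; case: (cut u).
have fcu : fresh_in cu f1 f2.
  by rewrite /cu f2E; case: (cut u); rewrite ?addn0 ?fresh_in_nil // /fresh_in /=; lia.
case: ifP => cL /=; (split; [by rewrite IH1| | |]).
- rewrite /wires_vars /= -/(wires_vars ws); apply: fresh_in_cat IH2.
  by rewrite (fresh_in_perm _ _ (permEl (perm_catC _ _))); exact: fresh_in_cat (fresh_in_fresh f2 p) fcu.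
- by rewrite /well_sized /= scu eqxx size_fresh !inE eqxx orbT.
- by exists k.+1; lia.
- by rewrite /wires_vars /= -/(wires_vars ws) cats0; apply: fresh_in_cat IH2.
- by rewrite /well_sized /= scu eqxx !inE.
- by exists k; lia.
Qed.

Lemma annotate_wires_gap cut c f us : c < L ->
  let r := foldr (annotate_wire p L cut) (c, f, [::]) us in
  [/\ r.1.1 < L, gap r.2 <= r.1.1 & forall l1 l2, r.2 = l1 ++ l2 -> gap l2 < L].
Proof.
move=> cL; have L0 : 0 < L by case: L cL.
elim: us => [|u us] /=; first by split=> // -[|? ?] [|? ?].
case: (foldr _ _ us) => -[c1 f1] ws /= [IH1 IH2 IH3].
have suffix w : gap (w :: ws) < L ->
    forall l1 l2, w :: ws = l1 ++ l2 -> gap l2 < L.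
  by move=> hw [|w' l1] l2 /=; [move=> <-|case=> _; exact: IH3].
rewrite /annotate_wire /=; case: ifP => cL'.
  by split=> //=; last apply: suffix; rewrite /= size_fresh p_gt0.
split=> //=; first by rewrite ltnNge cL'.
by apply: suffix => //=; lia.
Qed.

Lemma annotateP cut n G : 0 < L ->
  let r := annotate p L cut n G in
  [/\ [seq (g.1, [seq w.1 | w <- g.2]) | g <- r.2] = G,
      fresh_in (gates_vars r.2) n r.1.2,
      all (fun g : agate => all (well_sized p (cut (g.1, [seq w.1 | w <- g.2]))) g.2) r.2,
      exists2 k, r.1.2 = n + \sum_(g <- G) count (cut g) g.2 + p * k &
        L * k <= \sum_(g <- G) size g.2
    & forall g, g \in r.2 -> forall l1 l2, g.2 = l1 ++ l2 -> gap l2 < L].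
Proof.
move=> L0; rewrite /annotate.
(* The induction needs the final value of the counter in the inequality, and its bound by [L] as
   well; both are dropped afterwards. *)
suff: let r := foldr (annotate_gate p L cut) (0, n, [::]) G in
  [/\ [seq (g.1, [seq w.1 | w <- g.2]) | g <- r.2] = G,
      fresh_in (gates_vars r.2) n r.1.2,
      all (fun g : agate => all (well_sized p (cut (g.1, [seq w.1 | w <- g.2]))) g.2) r.2,
      exists2 k, r.1.2 = n + \sum_(g <- G) count (cut g) g.2 + p * k &
        L * k + r.1.1 <= \sum_(g <- G) size g.2
    & r.1.1 < L /\ forall g, g \in r.2 -> forall l1 l2, g.2 = l1 ++ l2 -> gap l2 < L].
  case=> h1 h2 h3 [k hk1 hk2] [_ h5]; split=> //; exists k => //.
  by apply: leq_trans hk2; exact: leq_addr.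
elim: G => [|g G] /=.
  by split=> //; [exact: fresh_in_nil|exists 0; rewrite ?big_nil ?muln0 ?addn0].
case: (foldr _ _ G) => -[c f] A /= [IH1 IH2 IH3 [k fE kL] [cL IH5]].
have := annotate_wiresP (cut g) c f g.2.
have := annotate_wires_gap (cut g) f g.2 cL.
rewrite /annotate_gate /=; case: (foldr _ _ g.2) => -[c' f'] ws /=.
case=> g1 g2 g3 [h1 h2 h3 [k' f'E k'L]]; split.
- by rewrite IH1 h1 -surjective_pairing.
- exact: fresh_in_cat h2 IH2.
- by rewrite h1 -surjective_pairing h3.
- by exists (k + k'); rewrite !big_cons; lia.
- by split=> // g'; rewrite inE => /predU1P[-> //|]; exact: IH5.
Qed.

End Annotate.

(** * Equisatisfiability *)

Lemma bits_value_eq x y vs : {in vs, x =1 y} -> bits_value x vs = bits_value y vs.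
Proof.
elim: vs => //= v vs IH xy; rewrite (xy v (mem_head _ _)) IH // => i hi.
by apply: xy; rewrite inE hi orbT.
Qed.

Lemma exists_bits vs w : uniq vs -> w < 2 ^ size vs -> exists x, bits_value x vs = w.
Proof.
elim: vs w => [|v vs IH] w /=; first by rewrite expn0 ltnS leqn0 => _ /eqP ->; exists xpred0.
case/andP=> vvs uvs; rewrite expnS => hw.
have [|x hx] := IH w./2 uvs; first by rewrite -divn2 ltn_divLR // mulnC.
exists (fun i => if i == v then odd w else x i); rewrite eqxx.
rewrite (@bits_value_eq _ x) ?hx ?odd_double_half // => i hi.
by case: eqP => // iv; rewrite -iv hi in vvs.
Qed.

(** Disjoint groups of variables can be set independently. This gives the auxiliary variables the
    values prescribed by an accepting valuation without changing the inputs. *)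
Lemma exists_assignment (R : seq (seq nat * nat)) x0 :
    uniq (flatten [seq r.1 | r <- R]) -> (forall r, r \in R -> r.2 < 2 ^ size r.1) ->
  exists x, (forall r, r \in R -> bits_value x r.1 = r.2) /\
            {in [predC flatten [seq r.1 | r <- R]], x =1 x0}.
Proof.
elim: R => [|[vs w] R IH] /=; first by exists x0.
rewrite cat_uniq => /and3P[uvs /hasPn hvs uR] hR.
have [|x [hx1 hx2]] := IH uR; first by move=> r hr; apply: hR; rewrite inE hr orbT.
have [y hy] := exists_bits uvs (hR _ (mem_head _ _)).
exists (fun i => if i \in vs then y i else x i); split; last first.
  by move=> i; rewrite !inE mem_cat negb_or => /andP[/negbTE -> hi]; apply: hx2.
move=> r; rewrite inE => /predU1P[->|hr] /=.
  by rewrite -[RHS]hy; apply: bits_value_eq => i ->.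
rewrite -hx1 //; apply: bits_value_eq => i hi; case: ifP => // ivs.
have /hvs /negP[] // : i \in flatten [seq r.1 | r <- R].
by apply/flattenP; exists r.1 => //; exact: map_f.
Qed.

Section Equisat.
Variables (n : nat) (G : seq rgate) (out : vert).
Local Notation gt := (nth ((0, 0), [::]) G).

Definition is_vertex (u : vert) := u.2 < (if u.1 then size G else n).

Definition is_valuation (a v : nat -> bool) := forall i, i < size G ->
  v i = gate_bit (gt i).1 (size (gt i).2) (count (vert_value a v) (gt i).2).

Definition raw_sat := exists a v, is_valuation a v /\ vert_value a v out.

Variable lev : nat -> nat.
Hypothesis wires_ok : forall i u, i < size G -> u \in (gt i).2 ->
  is_vertex u /\ (u.1 -> lev u.2 < lev i).
Hypothesis out_ok : is_vertex out.

Lemma exists_valuation a : exists v, is_valuation a v.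
Proof.
pose step v i := gate_bit (gt i).1 (size (gt i).2) (count (vert_value a v) (gt i).2).
pose val r := iter r step xpred0.
(* Starting from the constant false, each round of simultaneous evaluation settles one more
   level. *)
have stable r i : i < size G -> lev i < r -> val r.+1 i = val r i.
  elim: r i => // r IH i hi hr; rewrite /val iterS [in RHS]iterS -/(val r) -/(val r.+1).
  rewrite [in LHS]/step [in RHS]/step; congr (gate_bit _ _ _); apply: eq_in_count => u hu.
  have [hv hl] := wires_ok hi hu; rewrite /vert_value.
  case: ifP hl hv => // u1 /(_ isT) hl; rewrite /is_vertex u1 => hv.
  by apply: IH => //; exact: leq_trans hl hr.
pose M := (\max_(i < size G) lev i).+1.
exists (val M) => i hi; rewrite -[LHS]stable //.
by rewrite ltnS; exact: (leq_bigmax (Ordinal hi)).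
Qed.

Variables (p : nat) (A : seq agate) (n' r : nat) (cut : rgate -> vert -> bool).
Hypothesis A_G : [seq (g.1, [seq w.1 | w <- g.2]) | g <- A] = G.
Hypothesis A_fresh : fresh_in (gates_vars A) n n'.
Hypothesis A_sized : all (fun g : agate => all (well_sized p (cut (g.1, [seq w.1 | w <- g.2]))) g.2) A.
Hypothesis fanin_p : forall g, g \in G -> size g.2 < 2 ^ p.
Hypothesis lev_r : forall i, i < size G -> lev i < r.

Local Notation gtA := (nth ((0, 0), [::]) A).

Lemma size_AG : size A = size G. Proof. by rewrite -A_G size_map. Qed.

Lemma nth_AG i : i < size A ->
  (gtA i).1 = (gt i).1 /\ [seq w.1 | w <- (gtA i).2] = (gt i).2.
Proof. by move=> hi; rewrite -A_G (nth_map ((0, 0), [::])). Qed.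

Lemma wires_countE x v i : i < size A ->
  wires_count x v (gtA i).2 = count (vert_value x v) (gt i).2.
Proof. by move=> hi; have [_ <-] := nth_AG hi; rewrite count_map. Qed.

Fixpoint requirements x v (ws : seq awire) : seq (seq nat * nat) :=
  if ws is w :: ws' then
    (if 0 < size w.2.1 then [:: (w.2.1, nat_of_bool (vert_value x v w.1))] else [::]) ++
    (if 0 < size w.2.2 then [:: (w.2.2, wires_count x v ws)] else [::]) ++
    requirements x v ws'
  else [::].

Lemma requirements_vars x v ws :
  flatten [seq r.1 | r <- requirements x v ws] = wires_vars ws.
Proof.
elim: ws => //= -[u [c d]] ws IH; rewrite /wires_vars /= -/(wires_vars ws) -IH.
by rewrite !map_cat !flatten_cat; case: c d => [|? ?] [|? ?] //=; rewrite ?cats0 -?catA.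
Qed.

Lemma requirements_consistent x y v ws :
    {in ws, forall w, vert_value x v w.1 = vert_value y v w.1} ->
    (forall r, r \in requirements x v ws -> bits_value y r.1 = r.2) ->
  consistent y v ws.
Proof.
elim: ws => //= w ws IH xy hr; split.
- move=> cw; rewrite -xy ?mem_head //; apply: (hr (w.2.1, _)).
  by rewrite cw mem_cat mem_head.
- move=> cw; rewrite (hr (w.2.2, wires_count x v (w :: ws))).
    by apply: eq_in_count.
  by rewrite cw !mem_cat mem_head orbT.
- apply: IH => [w' hw'|q hq]; first by apply: xy; rewrite inE hw' orbT.
  by apply: hr; rewrite !mem_cat hq !orbT.
Qed.

Lemma requirements_bound x v cutg ws : all (well_sized p cutg) ws -> size ws < 2 ^ p ->
  forall q, q \in requirements x v ws -> q.2 < 2 ^ size q.1.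
Proof.
elim: ws => //= w ws IH /andP[/andP[/eqP s1 s2] hws] hp q.
rewrite !mem_cat => /or3P[||].
- case: ifP => // s1'; rewrite inE => /eqP -> /=.
  by move: s1'; rewrite s1; case: (cutg _) => // _; case: vert_value.
- case: ifP => // s2'; rewrite inE => /eqP -> /=.
  move: s2 s2'; rewrite !inE => /orP[] /eqP -> // _.
  by apply: leq_ltn_trans hp; exact: (count_size _ (w :: ws)).
- by apply: IH => //; exact: ltn_trans hp.
Qed.

Lemma formula_sat : raw_sat <-> exists x, all (sat_clause x) (formula A out r.+1).
Proof.
have lev_ltA : forall i w, i < size A -> w \in (gtA i).2 -> w.1.1 ->
  w.1.2 < size A /\ lev w.1.2 < lev i.
  move=> i w hi hw w1; have [_ e] := nth_AG hi.
  have : w.1 \in (gt i).2 by rewrite -e map_f.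
  case/(wires_ok _) => [|hv hl]; first by rewrite -size_AG.
  by move: hv; rewrite size_AG /is_vertex w1; split=> //; exact: hl.
have valA x v : is_valuation x v -> forall i, i < size A ->
    v i = gate_bit (gtA i).1 (size (gtA i).2) (wires_count x v (gtA i).2).
  move=> hv i hi; rewrite wires_countE // hv -?size_AG //.
  by have [-> <-] := nth_AG hi; rewrite size_map.
have lev_rA : forall i, i < size A -> lev i < r by rewrite size_AG.
have outA : out.1 -> out.2 < size A by move=> o1; move: out_ok; rewrite /is_vertex o1 size_AG.
split=> [[a [v [hv ho]]]|[x hx]]; last first.
  (* The inputs are read off from the solution [x], and the gates are evaluated anew; [formulaP]
     then says that the output is true. *)
  have [v hv] := exists_valuation x; exists x, v; split=> //.
  by have /(formulaP lev_ltA (valA _ _ hv) lev_rA outA)[] := hx.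
(* Each group of auxiliary variables, paired with the value that it has to encode under the
   valuation [v]. *)
pose R := flatten [seq requirements a v g.2 | g <- A].
have R_vars : flatten [seq q.1 | q <- R] = gates_vars A.
  rewrite /R /gates_vars; elim: (A) => //= g A' IH.
  by rewrite map_cat flatten_cat IH requirements_vars.
have [leq_n uA /allP allA] := and3P A_fresh.
have [||x [hx1 hx2]] := @exists_assignment R a.
- by rewrite R_vars.
- move=> q /flattenP[_ /mapP[g gA ->] hq].
  apply: (requirements_bound (allP A_sized g gA) _ hq).
  rewrite -(size_map (fun w => w.1)); apply: (fanin_p (g := (g.1, _))).
  by rewrite -A_G; apply: (map_f (fun g : agate => (g.1, [seq w.1 | w <- g.2]))).
have xa u : is_vertex u -> vert_value a v u = vert_value x v u.
  rewrite /is_vertex /vert_value; case: ifP => // _ un; rewrite hx2 // inE R_vars.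
  by apply/negP => /allA; lia.
have hvx : is_valuation x v.
  move=> i hi; rewrite hv //; congr (gate_bit _ _ _); apply: eq_in_count => u hu.
  by have [/xa] := wires_ok hi hu.
exists x; apply/(formulaP lev_ltA (valA _ _ hvx) lev_rA outA); split; last by rewrite -xa.
move=> j hj; apply: (requirements_consistent (x := a)) => [w hw|q hq].
  apply: xa; have [_ e] := nth_AG hj.
  have /(wires_ok _)[|//] : w.1 \in (gt j).2 by rewrite -e map_f.
  by rewrite -size_AG.
apply: hx1; apply/flattenP; exists (requirements a v (gtA j).2) => //.
by apply/mapP; exists (gtA j) => //; exact: mem_nth.
Qed.

End Equisat.

(** * Levels and the choice of the wires to cut *)

Definition vert_level (lv : seq nat) (u : vert) := if u.1 then nth 0 lv u.2 else 0.

Definition gate_level lv (us : seq vert) :=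
  foldr (fun u m => maxn (vert_level lv u).+1 m) 0 us.

Definition levels (G : seq rgate) r : seq nat :=
  iter r (fun lv => [seq gate_level lv g.2 | g <- G]) [::].

Lemma gate_level_ge lv us u : u \in us -> vert_level lv u < gate_level lv us.
Proof.
elim: us => //= w us IH; rewrite inE leq_max => /predU1P[<-|/IH ->]; last exact: orbT.
by rewrite ltnSn.
Qed.

Lemma vert_level_le lv M u : {in lv, forall l, l <= M} -> vert_level lv u <= M.
Proof.
move=> lvM; rewrite /vert_level; case: ifP => // _.
by case: (ltnP u.2 (size lv)) => h; [apply: lvM; exact: mem_nth|rewrite nth_default].
Qed.

Lemma gate_level_le lv us M : {in lv, forall l, l <= M} -> gate_level lv us <= M.+1.
Proof.
move=> lvM; elim: us => //= u us IH; rewrite geq_max IH andbT ltnS.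
exact: vert_level_le.
Qed.

Lemma levels_le G r : {in levels G r, forall l, l <= r}.
Proof. by elim: r => // r IH _ /mapP[g _ ->]; exact: gate_level_le. Qed.

Lemma size_levels G r : size (levels G r) <= size G.
Proof. by case: r => //= r; rewrite size_map. Qed.

(* The interval from [l] to [l'] contains a multiple of [B], but no multiple of
   [B * b]. *)
Definition crossing B b l l' := (l %/ (B * b) == l' %/ (B * b)) && (l %/ B != l' %/ B).

(* [l] written in base [b], without its digit number [j]. *)
Definition drop_digit b j l := l %/ b ^ j.+1 * b ^ j + l %% b ^ j.

Lemma drop_digit_lt b j k l : 0 < b -> j <= k -> l < b ^ k.+1 -> drop_digit b j l < b ^ k.
Proof.
move=> b0 jk lk; have bj n : 0 < b ^ n by rewrite expn_gt0 b0.
have h1 : l %/ b ^ j.+1 < b ^ (k - j).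
  by rewrite ltn_divLR // -expnD; congr (_ < b ^ _): lk; lia.
have h2 : l %% b ^ j < b ^ j by rewrite ltn_mod.
have -> : b ^ k = b ^ (k - j) * b ^ j by rewrite -expnD; congr (b ^ _); lia.
rewrite /drop_digit; nia.
Qed.

(** Either the digits above [j] increase as a number, or all digits from [j] on agree and the
    increase happens below [j]; erasing digit [j] preserves the order in both cases. The wires that
    are not cut thus still go strictly up in a numbering with only [b ^ k] levels, which bounds the
    length of the remaining paths without mentioning paths. *)
Lemma drop_digit_mono b j l l' : 0 < b -> l < l' -> ~~ crossing (b ^ j) b l l' ->
  drop_digit b j l < drop_digit b j l'.
Proof.
move=> b0 ll'; have bj n : 0 < b ^ n by rewrite expn_gt0 b0.
rewrite /crossing -expnSr negb_and negbK /drop_digit => /orP[ne|/eqP e].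
  have h : l %/ b ^ j.+1 < l' %/ b ^ j.+1 by rewrite ltn_neqAle ne leq_div2r // ltnW.
  have := ltn_pmod l (bj j); have := leq0n (l' %% b ^ j); nia.
rewrite expnSr !divnMA e ltn_add2l.
by move: ll'; rewrite {1}(divn_eq l (b ^ j)) {1}(divn_eq l' (b ^ j)) e ltn_add2l.
Qed.

Lemma crossing_disjoint b i j l l' :
  i < j -> crossing (b ^ i) b l l' -> ~~ crossing (b ^ j) b l l'.
Proof.
move=> ij /andP[/eqP e _]; rewrite /crossing negb_and negbK; apply/orP; right.
have -> : b ^ j = b ^ i * b * b ^ (j - i.+1).
  by rewrite -expnSr -expnD; congr (b ^ _); lia.
by rewrite !divnMA in e *; rewrite e.
Qed.

Lemma sum_crossing b k l l' : \sum_(j < k) crossing (b ^ j) b l l' <= 1.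
Proof.
case: (pickP (fun j : 'I_k => crossing (b ^ j) b l l')) => [j hj|no]; last first.
  by rewrite big1 // => j _; rewrite no.
rewrite (bigD1 j) //= hj big1 ?addn0 // => i ij.
case: (ltngtP i j) => h.
- by apply/eqP; rewrite eqb0; apply: contraL hj => hi; exact: crossing_disjoint hi.
- by apply/eqP; rewrite eqb0; exact: crossing_disjoint hj.
- by case/eqP: ij; exact: val_inj.
Qed.

Definition cut_wire lv B b (g : rgate) (u : vert) :=
  crossing B b (vert_level lv u) (gate_level lv g.2).

Lemma sum_cut_wires lv b k (G : seq rgate) :
  \sum_(j < k) \sum_(g <- G) count (cut_wire lv (b ^ j) b g) g.2 <= \sum_(g <- G) size g.2.
Proof.
rewrite exchange_big; apply: leq_sum => g _.
under eq_bigr => j _ do rewrite -sum1_count big_mkcond /=.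
rewrite exchange_big -sum1_size; apply: leq_sum => u _.
exact: sum_crossing.
Qed.

(** * The reduction *)

(** A linear search in the form of an iteration, which is directly programmable; [N] rounds suffice
    since [N < 2 ^ N]. *)
Definition find_bits N := iter N (fun p => if 2 ^ p <= N then p.+1 else p) 0.

Definition find_base k D := iter D (fun b => if b ^ k <= D then b.+1 else b) 1.

(** Stated for every round, because the program also needs a bound on the intermediate values. In
    [(2 * N).+1] the successor takes care of [N = 0]. *)
Lemma find_bits_iter N j (p := iter j (fun p => if 2 ^ p <= N then p.+1 else p) 0) :
  2 ^ p <= (2 * N).+1 /\ (j <= p \/ N < 2 ^ p).
Proof.
rewrite {}/p; elim: j => [|j [IH1 IH2]]; first by split=> //; left.
rewrite iterS; case: ifP => h; last by split=> //; right; rewrite ltnNge h.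
by split; [rewrite expnS; lia|left; lia].
Qed.

Lemma find_bitsP N : N < 2 ^ find_bits N <= (2 * N).+1.
Proof.
have [h1 [h2|h2]] := find_bits_iter N N; apply/andP; split=> //.
by apply: leq_trans (ltn_expl N (ltnSn 1)) _; rewrite leq_exp2l.
Qed.

Lemma find_base_iter k D j (b := iter j (fun b => if b ^ k.+1 <= D then b.+1 else b) 1) :
  [/\ 0 < b, b.-1 ^ k.+1 <= D & j < b \/ D < b ^ k.+1].
Proof.
rewrite {}/b; elim: j => [|j [IH1 IH2 IH3]]; first by split=> //; [rewrite exp0n|left].
rewrite iterS; case: ifP => h; last by split=> //; right; rewrite ltnNge h.
by split=> //; left; lia.
Qed.

Lemma find_baseP k D (b := find_base k.+1 D) :
  [/\ 0 < b, b.-1 ^ k.+1 <= D & D < b ^ k.+1].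
Proof.
have [h1 h2 [h3|h3]] := find_base_iter k D D; split=> //.
apply: leq_trans h3 _; rewrite -[X in X <= _]expn1 leq_pexp2l //.
Qed.

(** The classes of wires are compared through the number of variables that they lead to, which the
    annotation returns anyway. *)
Fixpoint best (f : nat -> nat * nat * seq agate) k :=
  if k is k'.+1 then
    if (f k).1.2 <= (best f k').1.2 then f k else best f k'
  else f 0.

Lemma bestP f k : exists2 j, j <= k & best f k = f j.
Proof.
elim: k => [|k [j jk e]] /=; first by exists 0.
by case: ifP => _; [exists k.+1|exists j; rewrite ?leqW].
Qed.

Lemma best_le f k j : j <= k -> (best f k).1.2 <= (f j).1.2.
Proof.
elim: k => [|k IH]; first by rewrite leqn0 => /eqP ->.
rewrite leq_eqVlt ltnS => /= /predU1P[->|/IH h]; case: ifP => [h'|/negbT h']; lia.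
Qed.

Notation instance := (nat * (seq rgate * vert))%type (only parsing).

Section Reduction.
Variables (k Q : nat).

Implicit Type x : instance.

Definition nvertices x := x.1 + size x.2.1.
Definition bits x := find_bits (nvertices x).
Definition final_levels x := levels x.2.1 (nvertices x).
Definition base x := find_base k.+1 (foldr maxn 0 (final_levels x)).
Definition annotation x j :=
  annotate (bits x) (bits x * Q) (cut_wire (final_levels x) (base x ^ j) (base x)) x.1 x.2.1.
Definition best_annotation x := best (annotation x) k.
(** Levels are at most [nvertices x], so [(nvertices x).+1] rounds make all tables final, and one
    more round yields the clauses. *)
Definition reduction x : nat * seq (seq lit) :=
  ((best_annotation x).1.2, formula (best_annotation x).2 x.2.2 (nvertices x).+2).

End Reduction.

(** * Sizes of the tables *)

Definition table_bound c l w V (S : ntable) : bool :=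
  (size S <= c) &&
  all (fun s : nat * seq lit => [&& s.1 <= w, size s.2 <= l & all (fun x : lit => x.2 < V) s.2]) S.

Definition clauses_bound c l V (F : seq (seq lit)) : bool :=
  (size F <= c) && all (fun s : seq lit => (size s <= l) && all (fun x : lit => x.2 < V) s) F.

Lemma table_bound_le c l w V c' l' w' S : c <= c' -> l <= l' -> w <= w' ->
  table_bound c l w V S -> table_bound c' l' w' V S.
Proof.
move=> hc hl hw /andP[h1 h2]; apply/andP; split; first exact: leq_trans hc.
apply: sub_all h2 => s /and3P[s1 s2 ->]; rewrite andbT.
by rewrite (leq_trans s1) // (leq_trans s2).
Qed.

Lemma add_table_bound c l w V c' l' w' S T :
  table_bound c l w V S -> table_bound c' l' w' V T ->
  table_bound (c * c') (l + l') (w + w') V (add_table S T).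
Proof.
move=> /andP[h1 /allP h2] /andP[h1' /allP h2']; apply/andP; split.
  by rewrite size_allpairs leq_mul.
apply/allP => _ /allpairsP[[s t] [/= /h2 /and3P[s1 s2 s3] /h2' /and3P[t1 t2 t3] ->]] /=.
by rewrite size_cat all_cat s3 t3 !leq_add.
Qed.

Lemma bits_table_bound V vs : all (fun i => i < V) vs ->
  table_bound (2 ^ size vs) (size vs) (2 ^ size vs).-1 V (bits_table vs).
Proof.
elim: vs => //= v vs IH /andP[vV /IH /andP[h1 /allP h2]].
have hd : table_bound (2 ^ size vs) (size vs) (2 ^ size vs).-1.*2 V
    (double_table (bits_table vs)).
  rewrite /table_bound size_map h1; apply/allP => _ /mapP[s /h2 /and3P[s1 s2 s3] ->] /=.
  by rewrite s2 s3 andbT -addnn leq_add.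
have hv : table_bound 2 1 1 V (var_table v) by rewrite /table_bound /= vV.
have := add_table_bound hv hd; apply: table_bound_le; rewrite ?add1n ?expnS //.
have := expn_gt0 2 (size vs); lia.
Qed.

Lemma size_flatten_le (T : eqType) (ss : seq (seq T)) B :
  {in ss, forall s, size s <= B} -> size (flatten ss) <= size ss * B.
Proof.
elim: ss => //= s ss IH hB; rewrite size_cat mulSn leq_add ?hB ?mem_head //.
by apply: IH => t ht; apply: hB; rewrite inE ht orbT.
Qed.

Lemma equality_clauses_bound c l w V c' l' w' S T :
  table_bound c l w V S -> table_bound c' l' w' V T ->
  clauses_bound (c * c') (l + l') V (equality_clauses S T).
Proof.
move=> /andP[h1 /allP h2] /andP[h1' /allP h2']; apply/andP; split.
  apply: leq_trans (@size_flatten_le _ _ 1 _) _; last by rewrite size_allpairs muln1 leq_mul.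
  by move=> _ /allpairsP[[s t] [_ _ ->]]; case: ifP.
apply/allP => f /flattenP[_ /allpairsP[[s t] [/= /h2 /and3P[s1 s2 s3] /h2' /and3P[t1 t2 t3] ->]]].
case: eqP => // _; rewrite inE => /eqP ->.
by rewrite /neg_term size_map size_cat leq_add //= all_map all_cat; apply/andP.
Qed.

Lemma clauses_bound_cat c l V c' F F' :
  clauses_bound c l V F -> clauses_bound c' l V F' -> clauses_bound (c + c') l V (F ++ F').
Proof.
by move=> /andP[h1 h2] /andP[h1' h2']; rewrite /clauses_bound size_cat leq_add // all_cat h2.
Qed.

Lemma clauses_bound_le c l V c' l' F : c <= c' -> l <= l' ->
  clauses_bound c l V F -> clauses_bound c' l' V F.
Proof.
move=> hc hl /andP[h1 h2]; rewrite /clauses_bound (leq_trans h1) //=.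
by apply: sub_all h2 => f /andP[f1 ->]; rewrite (leq_trans f1).
Qed.

(** * Growth of the tables along the scan of one gate *)

Section WiresBound.
Variables (p m V : nat) (tab : seq entry).
Hypotheses (p_gt0 : 0 < p) (m_gt0 : 0 < m).

Definition wire_ok (w : awire) :=
  [&& size w.2.1 <= 1, (size w.2.2 == 0) || (size w.2.2 == p),
      all (fun i => i < V) (w.2.1 ++ w.2.2)
    & (0 < size w.2.1) || table_bound (2 ^ m) m 1 V (vert_table tab w.1)].

Lemma wire_operand_bound w : wire_ok w ->
  table_bound (2 ^ m) m 1 V
    (if 0 < size w.2.1 then bits_table w.2.1 else vert_table tab w.1).
Proof.
case/and4P=> w1 _ w3 w4; case: ifP w4 => // w5 _.
rewrite all_cat in w3; case/andP: w3 => w3 _.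
have w6 : size w.2.1 = 1 by lia.
have := bits_table_bound w3; rewrite w6; apply: table_bound_le => //.
by rewrite leq_exp2l.
Qed.

(** The bits introduced last contribute [p] literals to a term, and each wire scanned since then at
    most [m]. *)
Lemma wires_table_bound ws : all wire_ok ws ->
  table_bound (2 ^ (p + m * gap ws)) (p + m * gap ws) (2 ^ p + gap ws) V
    (wires_entry tab ws).1.
Proof.
elim: ws => [_|w ws IH /= /andP[hw /IH {}IH]].
  by rewrite /table_bound /= expn_gt0.
rewrite /wire_step /=; case: ifP => hr /=.
  case/and4P: hw => _ w2 w3 _; rewrite all_cat in w3; case/andP: w3 => _ w3.
  have wp : size w.2.2 = p by move: w2 hr; case/orP => /eqP ->.
  rewrite muln0 !addn0 -wp; apply: table_bound_le (bits_table_bound w3) => //; lia.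
have := add_table_bound IH (wire_operand_bound hw); apply: table_bound_le.
- by rewrite -expnD mulnS leq_exp2l //; lia.
- by rewrite mulnS; lia.
- lia.
Qed.

Variables (E L : nat).
Hypotheses (E_ge : p + m * L <= E).

Lemma wire_sum_bound w ws : all wire_ok (w :: ws) -> gap ws < L ->
  table_bound (2 ^ E) E (2 ^ p + L) V
    (add_table (wires_entry tab ws).1
       (if 0 < size w.2.1 then bits_table w.2.1 else vert_table tab w.1)).
Proof.
move=> /= /andP[hw /wires_table_bound hws] gL.
have := add_table_bound hws (wire_operand_bound hw); apply: table_bound_le; last by lia.
- by rewrite -expnD leq_exp2l //; nia.
- nia.
Qed.

(** Per wire, equating a table with the variable of a cut costs at most [2 ^ E * 2] clauses, and
    equating a partial count with its bits at most [2 ^ E * 2 ^ p]. *)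
Lemma wires_clauses_bound ws : all wire_ok ws ->
    (forall l1 l2, ws = l1 ++ l2 -> gap l2 < L) ->
    {in ws, forall w, table_bound (2 ^ E) E 1 V (vert_table tab w.1)} ->
  clauses_bound (size ws * (2 ^ E * 2 + 2 ^ E * 2 ^ p)) (2 * E) V (wires_entry tab ws).2.
Proof.
elim: ws => // w ws IH hall hgap htab.
have [hw hws] := andP hall.
have {}IH : clauses_bound (size ws * (2 ^ E * 2 + 2 ^ E * 2 ^ p)) (2 * E) V (wires_entry tab ws).2.
  apply: IH => // [l1 l2 e|w' hw']; last by apply: htab; rewrite inE hw' orbT.
  by apply: (hgap (w :: l1)); rewrite e.
have gL : gap ws < L by exact: (hgap [:: w]).
have L0 : 0 < L by lia.
have mL : m * 1 <= m * L by rewrite leq_mul2l L0 orbT.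
have hS := wire_sum_bound hall gL.
case/and4P: hw => w1 w2 w3 _; rewrite all_cat in w3; case/andP: w3 => w3 w4.
rewrite mulSn /= /wire_step /=; set S := add_table _ _ in hS *.
set F := (if 0 < size w.2.1 then _ else _) ++ _.
have hF : clauses_bound (2 ^ E * 2 + size ws * (2 ^ E * 2 + 2 ^ E * 2 ^ p)) (2 * E) V F.
  apply: clauses_bound_cat IH; case: ifP => [hc|_]; last by rewrite /clauses_bound.
  have w5 : size w.2.1 = 1 by lia.
  have := equality_clauses_bound (htab _ (mem_head _ _)) (bits_table_bound w3).
  by rewrite w5; apply: clauses_bound_le => //; lia.
case: ifP => hr /=; last by apply: clauses_bound_le hF => //; lia.
have wp : size w.2.2 = p by move: w2 hr; case/orP => /eqP ->.
have := equality_clauses_bound hS (bits_table_bound w4); rewrite wp => hT.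
have lE : E + p <= 2 * E by lia.
by apply: clauses_bound_le (clauses_bound_cat (clauses_bound_le (leqnn _) lE hT) hF); lia.
Qed.

End WiresBound.

(** * Growth of the tables with the height [h] along uncut wires *)

Section TablesBound.
Variables (p Q V d : nat) (A : seq agate) (h : nat -> nat).
Local Notation gt := (nth ((0, 0), [::]) A).
Local Notation L := (p * Q).
Local Notation M := (p * Q.+1).

Hypotheses (p_gt0 : 0 < p) (Q_gt0 : 0 < Q).
Hypothesis h_lt : forall i, i < size A -> h i < d.
Hypothesis A_wires : forall i w, i < size A -> w \in (gt i).2 ->
  [/\ size w.2.1 <= 1, (size w.2.2 == 0) || (size w.2.2 == p),
      all (fun i => i < V) (w.2.1 ++ w.2.2), ~~ w.1.1 -> w.1.2 < V
    & size w.2.1 = 0 -> w.1.1 -> w.1.2 < size A -> h w.1.2 < h i].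
Hypothesis A_gap : forall i l1 l2, i < size A -> (gt i).2 = l1 ++ l2 -> gap l2 < L.

Lemma base_gt0 n : 0 < M ^ n.
Proof. by rewrite expn_gt0; apply/orP; left; nia. Qed.

Lemma vert_table_bound m tab (u : vert) : 0 < m -> (~~ u.1 -> u.2 < V) ->
    (u.1 -> table_bound (2 ^ m) m 1 V (nth ([::], [::]) tab u.2).1) ->
  table_bound (2 ^ m) m 1 V (vert_table tab u).
Proof.
move=> m0 hu; rewrite /vert_table; case: ifP hu => [_ _ h'|_ /(_ isT) hu _]; first exact: h'.
have := @bits_table_bound V [:: u.2]; rewrite /= hu => /(_ isT); apply: table_bound_le => //.
by rewrite leq_exp2l.
Qed.

Lemma gate_wires_ok r i : i < size A ->
    (forall j, table_bound (2 ^ M ^ (h j).+1) (M ^ (h j).+1) 1 V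
       (nth ([::], [::]) (tables A r) j).1) ->
  all (wire_ok p (M ^ h i) V (tables A r)) (gt i).2.
Proof.
move=> hi htab; apply/allP => w hw; have [w1 w2 w3 w4 w5] := A_wires hi hw.
rewrite /wire_ok w1 w2 w3 /=; case: posnP => //= w0.
apply: vert_table_bound => //; first exact: base_gt0.
move=> u1; case: (ltnP w.1.2 (size A)) => hu; last first.
  by rewrite nth_default //; case: (r) => //= r'; rewrite size_map.
have hl : M ^ (h w.1.2).+1 <= M ^ h i by rewrite leq_pexp2l ?w5 //; nia.
by apply: table_bound_le (htab _) => //; rewrite leq_exp2l.
Qed.

(** If the wires into a gate carry terms of length at most [m], the gate has terms of length at most
    [p + m * (p * Q)], hence at most [m * (p * Q.+1)]: this is the origin of [M]. The induction is
    on rounds, so that unfinished tables are bounded too. *)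
Lemma gate_table_bound r i : table_bound (2 ^ M ^ (h i).+1) (M ^ (h i).+1) 1 V
  (nth ([::], [::]) (tables A r) i).1.
Proof.
elim: r i => [|r IH] i; first by rewrite nth_nil.
case: (ltnP i (size A)) => hi; last by rewrite nth_default // size_map.
rewrite nth_tables //.
have := wires_table_bound p_gt0 (base_gt0 _) (gate_wires_ok hi IH).
have := A_gap hi (l1 := [::]) erefl; set S := (wires_entry _ _).1; move=> gL.
have e : p + M ^ h i * gap (gt i).2 <= M ^ (h i).+1.
  by rewrite expnS; have := base_gt0 (h i); nia.
case/andP=> S1 /allP S2; rewrite /table_bound size_map (leq_trans S1) ?leq_exp2l //=.
apply/allP => _ /mapP[s /S2 /and3P[_ s2 s3] ->] /=.
by rewrite s3 (leq_trans s2) // leq_b1.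
Qed.

Local Notation E := (M ^ d).

Lemma all_table_bound r u : (~~ u.1 -> u.2 < V) ->
  table_bound (2 ^ E) E 1 V (vert_table (tables A r) u).
Proof.
move=> hu; apply: vert_table_bound => //; first exact: base_gt0.
move=> u1; case: (ltnP u.2 (size A)) => hi; last first.
  by rewrite nth_default //; case: (r) => //= r'; rewrite size_map.
have e : M ^ (h u.2).+1 <= E by rewrite leq_pexp2l ?h_lt //; nia.
by apply: table_bound_le (gate_table_bound _ _) => //; rewrite leq_exp2l.
Qed.

Lemma gate_work_le i : i < size A -> p + M ^ h i * L <= E.
Proof.
move=> hi; apply: (@leq_trans (M ^ (h i).+1)); last by rewrite leq_pexp2l ?h_lt //; nia.
by rewrite expnS; have := base_gt0 (h i); nia.
Qed.

(** The estimate at an intermediate point of a scan, needed for the running time. *)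
Lemma wires_suffix_bound r i l1 w l2 : i < size A -> (gt i).2 = l1 ++ w :: l2 ->
  table_bound (2 ^ E) E (2 ^ p + L) V
    (add_table (wires_entry (tables A r) l2).1
      (if 0 < size w.2.1 then bits_table w.2.1 else vert_table (tables A r) w.1)) /\
  table_bound (2 ^ E) E (2 ^ p + L) V (wires_entry (tables A r) l2).1.
Proof.
move=> hi e; have hok := gate_wires_ok hi (gate_table_bound r); have hE := gate_work_le hi.
rewrite e all_cat in hok; case/andP: hok => _ hok.
have gL : gap l2 < L by apply: (A_gap hi (l1 := rcons l1 w)); rewrite cat_rcons.
split; first exact: (wire_sum_bound p_gt0 (base_gt0 (h i)) hE hok gL).
have [_ hok'] := andP hok.
apply: table_bound_le (wires_table_bound p_gt0 (base_gt0 _) hok') => //.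
- by rewrite leq_exp2l //; have := base_gt0 (h i); nia.
- by have := base_gt0 (h i); nia.
- lia.
Qed.

Lemma gate_bound r i : i < size A ->
  table_bound (2 ^ E) E (2 ^ p + L) V (wires_entry (tables A r) (gt i).2).1 /\
  clauses_bound (size (gt i).2 * (2 ^ E * 2 + 2 ^ E * 2 ^ p)) (2 * E) V
    (wires_entry (tables A r) (gt i).2).2.
Proof.
move=> hi; have hok := gate_wires_ok hi (gate_table_bound r); have hE := gate_work_le hi.
have gL : gap (gt i).2 < L by apply: (A_gap hi (l1 := [::])).
split.
  apply: table_bound_le (wires_table_bound p_gt0 (base_gt0 _) hok) => //.
  - by rewrite leq_exp2l //; have := base_gt0 (h i); nia.
  - by have := base_gt0 (h i); nia.
  - lia.
apply: (wires_clauses_bound p_gt0 (base_gt0 (h i)) hE hok).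
  by move=> l1 l2; exact: A_gap.
by move=> w hw; apply: all_table_bound; have [] := A_wires hi hw.
Qed.

Lemma formula_bound f r (out : vert) : (~~ out.1 -> out.2 < V) ->
    (forall i, i < size A -> size (gt i).2 <= f) ->
  clauses_bound (2 ^ E + size A * (f * (2 ^ E * 2 + 2 ^ E * 2 ^ p))) (2 * E) V
    (formula A out r.+1).
Proof.
move=> ho hf; apply: clauses_bound_cat.
  have h1 : table_bound 1 0 1 V [:: (1, [::])] by [].
  apply: clauses_bound_le (equality_clauses_bound (all_table_bound r.+1 ho) h1); lia.
have hc g : g \in A ->
    clauses_bound (f * (2 ^ E * 2 + 2 ^ E * 2 ^ p)) (2 * E) V (gate_entry (tables A r) g).2.
  case/(nthP ((0, 0), [::])) => i hi <-; have [_] := gate_bound r hi.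
  by apply: clauses_bound_le => //; rewrite leq_mul2r hf ?orbT.
apply/andP; split.
  rewrite -[X in X * _](size_map (gate_entry (tables A r)) A).
  rewrite -[X in X * _](size_map (fun e : entry => e.2)).
  by apply: size_flatten_le => _ /mapP[_ /mapP[g /hc /andP[h1 _] ->] ->].
apply/allP => c /flattenP[_ /mapP[_ /mapP[g /hc /andP[_ /allP h1] ->] ->]].
exact: h1.
Qed.

End TablesBound.

(** * The reduction is computable in polynomial time *)

Section FPLevels.
Variable X : ctx.

(** Here and below, a single function [B] bounds all the sizes that occur, so that one polynomial
    bound is carried along instead of one for each argument. *)
Lemma FP_vert_level (lv : X -> seq nat) (u : X -> vert) B :
    bounded B -> (forall x, dom x -> size (lv x) <= B x) -> (forall x, dom x -> (u x).2 <= B x) ->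
  FP lv -> FP u -> FP (fun x => vert_level (lv x) (u x)).
Proof.
move=> bB h1 h2 fl fu; apply: FP_if; [exact: FP_fst| |exact: FP_const].
by apply: FP_nth; [|exact: FP_snd|exact: bounded_le bB h1|exact: bounded_le bB h2].
Qed.

End FPLevels.

Lemma FP_gate_level (X : ctx) (lv : X -> seq nat) (us : X -> seq vert) B :
    bounded B -> (forall x, dom x -> size (lv x) <= B x) ->
    (forall x, dom x -> {in lv x, forall l, l <= B x}) ->
    (forall x, dom x -> size (us x) <= B x) ->
    (forall x, dom x -> {in us x, forall u : vert, u.2 <= B x}) ->
  FP lv -> FP us -> FP (fun x => gate_level (lv x) (us x)).
Proof.
move=> bB h1 h2 h3 h4 fl fu.
apply: (FP_foldr (g := fun x u m => maxn (vert_level (lv x) u).+1 m)) => //.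
- exact: FP_const.
- exact: bounded_le bB h3.
have bB' := bounded_add bB (bounded_const X 1).
apply: FP_maxn.
- apply/FP_succ/(FP_vert_level (bounded_weak bB)).
  + by move=> w [hw _]; exact: h1.
  + by move=> w [hw [l1 [l2 [e _]]]]; apply: h4 => //; rewrite e mem_cat mem_head orbT.
  + exact: FP_weak.
  + exact: FP_fst FP_var.
- exact: FP_snd FP_var.
- apply: bounded_le (bounded_weak bB') _ => w [hw _]; rewrite addn1 ltnS.
  by apply: vert_level_le; exact: h2.
- apply: bounded_le (bounded_weak bB') _ => w [hw [l1 [l2 [_ ->]]]]; rewrite addn1.
  exact: (gate_level_le l2 (h2 _ hw)).
Qed.

Lemma FP_levels (X : ctx) (G : X -> seq rgate) (r : X -> nat) B :
    bounded B -> (forall x, dom x -> size (G x) <= B x) -> (forall x, dom x -> r x <= B x) ->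
    (forall x g, dom x -> g \in G x -> size g.2 <= B x /\ {in g.2, forall u, u.2 <= B x}) ->
  FP G -> FP r -> FP (fun x => levels (G x) (r x)).
Proof.
move=> bB h1 h2 h3 fG fr.
apply: (FP_iter (g := fun x lv => [seq gate_level lv g.2 | g <- G x])) => //.
- exact: FP_const.
- exact: bounded_le bB h2.
apply: (@FP_map (ext _) _ _ _ _ (fun w => G w.1) (fun w g => gate_level w.2 g.2)).
- exact: FP_weak fG.
- by apply: bounded_le (bounded_weak bB) _ => w [hw _]; exact: h1.
apply: (FP_gate_level (bounded_weak (bounded_weak bB))).
- by move=> w [[hw [j _ ->]] _]; apply: leq_trans (size_levels _ _) (h1 _ hw).
- move=> w [[hw [j jr ->]] _] l /levels_le le; apply: leq_trans le _.
  by apply: leq_trans (h2 _ hw); exact: ltnW.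
- by move=> w [[hw _] hg]; case: (h3 _ _ hw hg).
- by move=> w [[hw _] hg]; case: (h3 _ _ hw hg).
- exact: FP_weak FP_var.
- exact: FP_snd FP_var.
Qed.

Lemma FP_cut_wire (X : ctx) (lv : X -> seq nat) (c b : X -> nat) (g : X -> rgate) (u : X -> vert) B :
    bounded B -> (forall x, dom x -> size (lv x) <= B x) ->
    (forall x, dom x -> {in lv x, forall l, l <= B x}) ->
    (forall x, dom x -> size (g x).2 <= B x) ->
    (forall x, dom x -> {in (g x).2, forall u : vert, u.2 <= B x}) ->
    (forall x, dom x -> (u x).2 <= B x) ->
    (forall x, dom x -> 0 < c x <= B x) -> (forall x, dom x -> 0 < b x <= B x) ->
  FP lv -> FP c -> FP b -> FP g -> FP u ->
  FP (fun x => cut_wire (lv x) (c x) (b x) (g x) (u x)).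
Proof.
move=> bB h1 h2 h3 h4 h5 hc hb flv fc fb fg fu.
have bc : bounded c by apply: bounded_le bB _ => x /hc /andP[].
have bb : bounded b by apply: bounded_le bB _ => x /hb /andP[].
have bcb := bounded_mul bc bb.
have fcb : FP (fun x => c x * b x) by exact: FP_muln.
have fl1 : FP (fun x => vert_level (lv x) (u x)) by exact: FP_vert_level bB h1 h5 flv fu.
have fl2 : FP (fun x => gate_level (lv x) (g x).2).
  by apply: FP_gate_level bB h1 h2 h3 h4 flv _; exact: FP_snd.
have bl1 : bounded (fun x => vert_level (lv x) (u x)).
  by apply: bounded_le bB _ => x hx; apply: vert_level_le; exact: h2.
have bl2 : bounded (fun x => gate_level (lv x) (g x).2).
  apply: bounded_le (bounded_add bB (bounded_const X 1)) _ => x hx.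
  by rewrite addn1; apply: gate_level_le; exact: h2.
have c0 x : dom x -> 0 < c x by move/hc => /andP[].
have cb0 x : dom x -> 0 < c x * b x by move=> hx; rewrite muln_gt0 c0 //=; case/andP: (hb x hx).
have bdiv (f m : X -> nat) : bounded f -> bounded (fun x => f x %/ m x).
  by move=> bf; apply: bounded_le bf _ => x _; exact: leq_div.
have fdiv := FP_divn.
apply: FP_and; last apply: FP_not.
  by apply: FP_eqn; [exact: FP_divn|exact: FP_divn|exact: bdiv|exact: bdiv].
by apply: FP_eqn; [exact: FP_divn|exact: FP_divn|exact: bdiv|exact: bdiv].
Qed.

Lemma FP_fresh (X : ctx) (f p : X -> nat) : bounded f -> bounded p ->
  FP f -> FP p -> FP (fun x => fresh (f x) (p x)).
Proof.
move=> bf bp ff fp; apply: (FP_iter (g := fun x l => f x + size l :: l)) => //.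
  exact: FP_const.
apply: FP_cons; last exact: FP_var.
apply: FP_addn; [exact: FP_weak ff| |exact: bounded_weak bf].
apply: FP_size; first exact: FP_var.
apply: bounded_le (bounded_weak bp) _ => w [_ [j jp ->]].
by have := size_fresh (f w.1) j; rewrite /fresh => ->; exact: ltnW.
Qed.

Lemma annotate_wires_le p L cut c f us (r := foldr (annotate_wire p L cut) (c, f, [::]) us) :
  r.1.1 <= c + size us /\ r.1.2 <= f + (p + 1) * size us.
Proof.
rewrite {}/r; elim: us => [|u us] /=; first by rewrite muln0 !addn0.
case: (foldr _ _ us) => -[c1 f1] ws /= [h1 h2].
rewrite /annotate_wire /=; case: ifP => _ /=; case: (cut u); split; nia.
Qed.

Lemma annotate_gates_le p L cut n (G : seq rgate) (r := annotate p L cut n G) :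
  r.1.1 <= \sum_(g <- G) size g.2 /\ r.1.2 <= n + (p + 1) * \sum_(g <- G) size g.2.
Proof.
rewrite {}/r /annotate; elim: G => [|g G] /=; first by rewrite !big_nil muln0 addn0.
case: (foldr _ _ G) => -[c1 f1] A /= [h1 h2].
have [] := annotate_wires_le p L (cut g) c1 f1 g.2.
rewrite /annotate_gate /=; case: (foldr _ _ g.2) => -[c2 f2] ws /= h3 h4.
by rewrite !big_cons; split; nia.
Qed.

Lemma FP_annotate_wire (X : ctx) (p L : X -> nat) (cut : X -> vert -> bool) (u : X -> vert)
    (st : X -> nat * nat * seq awire) :
    bounded p -> bounded (fun x => (st x).1.1) -> bounded (fun x => (st x).1.2) ->
    FP p -> FP L -> FP (fun x => cut x (u x)) -> FP u -> FP st ->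
  FP (fun x => annotate_wire (p x) (L x) (cut x) (u x) (st x)).
Proof.
move=> bp bc bf fp fL fcut fu fst'.
have ff : FP (fun x => (st x).1.2) by exact/FP_snd/FP_fst.
have fc : FP (fun x => (st x).1.1) by exact/FP_fst/FP_fst.
have ff' : FP (fun x => if cut x (u x) then (st x).1.2.+1 else (st x).1.2).
  by apply: FP_if => //; exact: FP_succ.
have bf' : bounded (fun x => if cut x (u x) then (st x).1.2.+1 else (st x).1.2).
  apply: bounded_le (bounded_add bf (bounded_const X 1)) _ => x _.
  by case: ifP; rewrite addn1.
have fcu : FP (fun x => if cut x (u x) then [:: (st x).1.2] else [::]).
  by apply: FP_if => //; [apply: FP_cons => //|]; exact: FP_const.
apply: FP_if.
- apply: FP_leq; [done|exact: FP_succ|].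
  by apply: bounded_le (bounded_add bc (bounded_const X 1)) _ => x _; rewrite addn1.
- apply: FP_pair.
    by apply: FP_pair; [exact: FP_const|exact: FP_addn].
  apply: FP_cons; last exact: FP_snd.
  by do 2?apply: FP_pair => //; exact: FP_fresh.
- apply: FP_pair.
    by apply: FP_pair => //; exact: FP_succ.
  apply: FP_cons; last exact: FP_snd.
  by do 2?apply: FP_pair => //; exact: FP_const.
Qed.

Lemma FP_annotate (X : ctx) (p L n : X -> nat) (cut : X -> rgate -> vert -> bool)
    (G : X -> seq rgate) B :
    bounded B -> (forall x, dom x -> p x <= B x) -> (forall x, dom x -> n x <= B x) ->
    (forall x, dom x -> size (G x) <= B x) ->
    (forall x g, dom x -> g \in G x -> size g.2 <= B x) ->
    FP p -> FP L -> FP n -> FP G ->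
    FP (X := ext (fun x (gu : rgate * vert) => (gu.1 \in G x) && (gu.2 \in gu.1.2)))
       (fun w => cut w.1 w.2.1 w.2.2) ->
  FP (fun x => annotate (p x) (L x) (cut x) (n x) (G x)).
Proof.
move=> bB hp hn hG hg fp fL fn fG fcut.
have sG x l1 l2 : dom x -> G x = l1 ++ l2 -> \sum_(g <- l2) size g.2 <= B x * B x.
  move=> hx e; apply: (@leq_trans (\sum_(g <- l2) B x)).
    rewrite big_seq [X in _ <= X]big_seq; apply: leq_sum => g gl; apply: (hg x g hx).
    by rewrite e mem_cat gl orbT.
  rewrite big_const_seq count_predT iter_addn_0 leq_mul2l; apply/orP; right.
  by apply: leq_trans (hG x hx); rewrite e size_cat leq_addl.
apply: (FP_foldr (g := fun x => annotate_gate (p x) (L x) (cut x))) => //.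
- by apply: FP_pair; [apply: FP_pair => //|]; exact: FP_const.
- exact: bounded_le bB hG.
set Y := ext _.
have fr : FP (X := Y) (fun w => foldr (annotate_wire (p w.1) (L w.1) (cut w.1 w.2.1))
    (w.2.2.1, [::]) w.2.1.2).
  apply: (@FP_foldr Y vert (nat * nat * seq awire)%type _ _ (fun w => w.2.1.2)
    (fun w => (w.2.2.1, [::])) (fun w => annotate_wire (p w.1) (L w.1) (cut w.1 w.2.1))).
  - exact/FP_snd/FP_fst/FP_var.
  - by apply: FP_pair; [exact/FP_fst/FP_snd/FP_var|exact: FP_const].
  - apply: bounded_le (bounded_weak bB) _ => w [hw [l1 [l2 [e _]]]]; apply: hg => //.
    by rewrite e mem_cat mem_head orbT.
  have hB w : @dom Y w -> w.2.2.1.1 <= B w.1 * B w.1 /\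
      w.2.2.1.2 <= B w.1 + (B w.1 + 1) * (B w.1 * B w.1).
    move=> [hw [l1 [l2 [e ->]]]].
    have [h1 h2] := annotate_gates_le (p w.1) (L w.1) (cut w.1) (n w.1) l2.
    have hs := sG _ (rcons l1 w.2.1) l2 hw; rewrite cat_rcons in hs.
    split; first exact: leq_trans h1 (hs e).
    by apply: leq_trans h2 _; rewrite leq_add ?hn // leq_mul ?hs // leq_add2r hp.
  have hs w : @dom Y w -> size w.2.1.2 <= B w.1.
    by move=> [hw [l1 [l2 [e _]]]]; apply: hg => //; rewrite e mem_cat mem_head orbT.
  have bY (P : Y -> vert * (nat * nat * seq awire) -> Prop) :
    bounded (X := ext P) (fun w => B w.1.1) by exact: bounded_weak (bounded_weak bB).
  apply: FP_annotate_wire.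
  - by apply: bounded_le (bY _) _ => w [[hw _] _]; exact: hp.
  - apply: bounded_le (bounded_add (bounded_mul (bY _) (bY _)) (bY _)) _ => w [hw [l1 [l2 [e ->]]]].
    case: w.1.2.2.1 (hB _ hw) => c f /= [h1 _].
    have [h2 _] := annotate_wires_le (p w.1.1) (L w.1.1) (cut w.1.1 w.1.2.1) c f l2.
    apply: leq_trans h2 (leq_add h1 _); apply: leq_trans (hs _ hw).
    by rewrite e size_cat /=; lia.
  - apply: bounded_le (bounded_add (bounded_add (bY _)
      (bounded_mul (bounded_add (bY _) (bounded_const _ 1)) (bounded_mul (bY _) (bY _))))
      (bounded_mul (bounded_add (bY _) (bounded_const _ 1)) (bY _))) _ => w [hw [l1 [l2 [e ->]]]].
    case: w.1.2.2.1 (hB _ hw) => c f /= [_ h1].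
    have [_ h2] := annotate_wires_le (p w.1.1) (L w.1.1) (cut w.1.1 w.1.2.1) c f l2.
    apply: leq_trans h2 (leq_add h1 _); apply: leq_mul.
      by rewrite leq_add2r; apply: hp; case: hw.
    apply: leq_trans (hs _ hw).
    by rewrite e size_cat /=; lia.
  - exact: FP_weak (FP_weak fp).
  - exact: FP_weak (FP_weak fL).
  - apply: (@FP_subst_expr (ext (X := Y) _) _ _ _ _ fcut (fun w => (w.1.1, (w.1.2.1, w.2.1)))
      (Node (Node (Left (Left (Right (Var 0)))) (Left (Left (Var 0)))) (Right (Right (Var 0))))).
      move=> [[x [g st]] [u st']] [[/= hx [l1 [l2 [e _]]]] [k1 [k2 [e' _]]]]; do !split=> //=.
      by rewrite /= in e' *; rewrite e e' !mem_cat !mem_head !orbT.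
    by move=> [[x [g st]] [u st']] s _ /= ->.
  - exact: FP_fst FP_var.
  - exact: FP_snd FP_var.
apply: FP_pair; first exact: FP_fst fr.
apply: FP_cons; last exact/FP_snd/FP_snd/FP_var.
by apply: FP_pair; [exact/FP_fst/FP_fst/FP_var|exact: FP_snd fr].
Qed.

Lemma FP_add_table (X : ctx) (S T : X -> ntable) B V :
    bounded B -> (forall x, dom x -> table_bound (B x) (B x) (B x) (V x) (S x)) ->
    (forall x, dom x -> size (T x) <= B x) ->
  FP S -> FP T -> FP (fun x => add_table (S x) (T x)).
Proof.
move=> bB hS hT fS fT.
apply: (FP_allpairs (f := fun _ (s t : nat * seq lit) => (s.1 + t.1, s.2 ++ t.2))) => //.
- by apply: bounded_le bB _ => x /hS /andP[].
- exact: bounded_le bB hT.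
have hs w : @dom (ext (fun x (ab : nat * seq lit * (nat * seq lit)) =>
    (ab.1 \in S x) && (ab.2 \in T x))) w -> w.2.1.1 <= B w.1 /\ size w.2.1.2 <= B w.1.
  case=> hw /andP[sS _]; have [/andP[_ /allP h]] := (hS _ hw).
  by case/and3P: (h _ sS).
apply: FP_pair; [apply: FP_addn|apply: FP_cat].
- exact/FP_fst/FP_fst/FP_var.
- exact/FP_fst/FP_snd/FP_var.
- by apply: bounded_le (bounded_weak bB) _ => w /hs[].
- exact/FP_snd/FP_fst/FP_var.
- exact/FP_snd/FP_snd/FP_var.
- by apply: bounded_le (bounded_weak bB) _ => w /hs[].
Qed.

Lemma FP_bits_table (X : ctx) (vs : X -> seq nat) B V :
    bounded B -> (forall x, dom x -> 2 ^ size (vs x) <= B x) ->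
    (forall x, dom x -> all (fun i => i < V x) (vs x)) ->
  FP vs -> FP (fun x => bits_table (vs x)).
Proof.
move=> bB hB hV fvs.
apply: (FP_foldr (g := fun _ v S => add_table (var_table v) (double_table S))) => //.
- exact: FP_const.
- by apply: bounded_le bB _ => x /hB; apply: leq_trans; exact/ltnW/ltn_expl.
set Y := ext _.
have hY w : @dom Y w -> w.2.1 < V w.1 /\ table_bound (B w.1) (B w.1) (B w.1) (V w.1) w.2.2.
  move=> [hw [l1 [l2 [e ->]]]]; have := hV _ hw; rewrite e all_cat /= => /and3P[_ h1 h2].
  split=> //; have := bits_table_bound h2; apply: table_bound_le.
  - apply: leq_trans (hB _ hw); rewrite leq_exp2l // e size_cat /=; lia.
  - apply: leq_trans (hB _ hw); apply: leq_trans (ltnW (ltn_expl _ (ltnSn 1))) _.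
    by rewrite leq_exp2l // e size_cat /=; lia.
  - apply: leq_trans (leq_pred _) _; apply: leq_trans (hB _ hw).
    by rewrite leq_exp2l // e size_cat /=; lia.
have bY : bounded (X := Y) (fun w => B w.1 + 2).
  exact: bounded_add (bounded_weak bB) (bounded_const _ _).
apply: (@FP_add_table Y (fun w => var_table w.2.1) (fun w => double_table w.2.2) _ (fun w => V w.1) bY).
- move=> w /hY[h _]; rewrite /table_bound /= h andbT; lia.
- by move=> w /hY[_ /andP[h _]]; rewrite size_map; lia.
- have fv : FP (X := Y) (fun w => w.2.1) by exact/FP_fst/FP_var.
  have fl b : FP (X := Y) (fun w => [:: (b, w.2.1)]).
    by apply: FP_cons; [apply: FP_pair => //|]; exact: FP_const.
  apply: FP_cons; first by apply: FP_pair => //; exact: FP_const.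
  by apply: FP_cons; [apply: FP_pair => //|]; exact: FP_const.
- apply: (@FP_map Y _ _ _ _ (fun w => w.2.2) (fun _ s => (s.1 + s.1, s.2))).
  + exact/FP_snd/FP_var.
  + by apply: bounded_le bY _ => w /hY[_ /andP[h _]]; exact: leq_trans h (leq_addr _ _).
  have fs T (eT : encoding T) P : FP (X := ext (X := Y) P) (fun w => w.2 : T) by exact: FP_var.
  apply: FP_pair; last exact/FP_snd/fs.
  apply: FP_addn; [exact/FP_fst/fs|exact/FP_fst/fs|].
  apply: bounded_le (bounded_weak bY) _ => w [/hY[_ /andP[_ /allP h]] /h /and3P[h' _ _]].
  exact: leq_trans h' (leq_addr _ _).
Qed.

Lemma FP_equality_clauses (X : ctx) (S T : X -> ntable) B V :
    bounded B -> (forall x, dom x -> table_bound (B x) (B x) (B x) (V x) (S x)) ->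
    (forall x, dom x -> table_bound (B x) (B x) (B x) (V x) (T x)) ->
  FP S -> FP T -> FP (fun x => equality_clauses (S x) (T x)).
Proof.
move=> bB hS hT fS fT.
apply: (FP_flatten (B := fun x => B x * B x + 1)).
- exact: bounded_add (bounded_mul bB bB) (bounded_const _ _).
- move=> x hx; rewrite size_allpairs.
  have /andP[h1 _] := hS x hx; have /andP[h2 _] := hT x hx.
  exact: leq_trans (leq_mul h1 h2) (leq_addr _ _).
- by move=> x r hx /allpairsP[[s t] [_ _ ->]]; case: ifP => //= _; rewrite addn1.
apply: (FP_allpairs (f := fun _ (s t : nat * seq lit) =>
  if s.1 == t.1 then [::] else [:: neg_term (s.2 ++ t.2)])) => //.
- by apply: bounded_le bB _ => x /hS /andP[].
- by apply: bounded_le bB _ => x /hT /andP[].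
set Y := ext _.
have hs w : @dom Y w -> [/\ w.2.1.1 <= B w.1, w.2.2.1 <= B w.1,
    size w.2.1.2 <= B w.1 & size w.2.2.2 <= B w.1].
  case=> hw /andP[sS sT]; have [/andP[_ /allP h]] := hS _ hw.
  have [/andP[_ /allP h']] := hT _ hw.
  by case/and3P: (h _ sS) => ? ? _; case/and3P: (h' _ sT) => ? ? _.
have bY := bounded_weak bB : bounded (X := Y) (fun w => B w.1).
have f1 : FP (X := Y) (fun w => w.2.1) by exact/FP_fst/FP_var.
have f2 : FP (X := Y) (fun w => w.2.2) by exact/FP_snd/FP_var.
apply: FP_if; [|exact: FP_const|].
  apply: FP_eqn; [exact: FP_fst|exact: FP_fst| |].
    by apply: bounded_le bY _ => w /hs[].
  by apply: bounded_le bY _ => w /hs[].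
apply: FP_cons; last exact: FP_const.
apply: (@FP_map Y _ _ _ _ (fun w => w.2.1.2 ++ w.2.2.2) (fun _ l => (~~ l.1, l.2))).
- apply: FP_cat; [exact: FP_snd|exact: FP_snd|].
  by apply: bounded_le bY _ => w /hs[].
- by apply: bounded_le (bounded_add bY bY) _ => w /hs[_ _ h1 h2]; rewrite size_cat leq_add.
- by apply: FP_pair; [exact/FP_not/FP_fst/FP_var|exact/FP_snd/FP_var].
Qed.

Lemma FP_vert_table (X : ctx) (tab : X -> seq entry) (u : X -> vert) B :
    bounded B -> (forall x, dom x -> size (tab x) <= B x) -> (forall x, dom x -> (u x).2 <= B x) ->
  FP tab -> FP u -> FP (fun x => vert_table (tab x) (u x)).
Proof.
move=> bB h1 h2 ftab fu; apply: FP_if; first exact: FP_fst.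
  by apply/FP_fst/FP_nth; [|exact: FP_snd|exact: bounded_le bB h1|exact: bounded_le bB h2].
apply: (FP_bits_table (B := fun _ => 2) (V := fun x => (u x).2.+1)).
- exact: bounded_const.
- by [].
- by move=> x _ /=; rewrite ltnSn.
- by apply: FP_cons; [exact: FP_snd|exact: FP_const].
Qed.

Definition wire_operand tab (w : awire) :=
  if 0 < size w.2.1 then bits_table w.2.1 else vert_table tab w.1.

Lemma FP_wire_step (X : ctx) (tab : X -> seq entry) (w : X -> awire) (e : X -> entry) B V :
    bounded B -> (forall x, dom x -> size (tab x) <= B x) -> (forall x, dom x -> (w x).1.2 <= B x) ->
    (forall x, dom x -> 2 ^ size (w x).2.1 <= B x) -> (forall x, dom x -> 2 ^ size (w x).2.2 <= B x) ->
    (forall x, dom x -> all (fun i => i < V x) ((w x).2.1 ++ (w x).2.2)) ->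
    (forall x, dom x -> table_bound (B x) (B x) (B x) (V x) (vert_table (tab x) (w x).1)) ->
    (forall x, dom x -> table_bound (B x) (B x) (B x) (V x) (e x).1) ->
    (forall x, dom x -> table_bound (B x) (B x) (B x) (V x)
       (add_table (e x).1 (wire_operand (tab x) (w x)))) ->
  FP tab -> FP w -> FP e -> FP (fun x => wire_step (tab x) (w x) (e x)).
Proof.
move=> bB htab hu hc hr hV hvt he hS ftab fw fe.
have f0 : FP (fun _ : X => [::] : seq (seq lit)) by exact: FP_const.
have fcs : FP (fun x => (w x).2.1) by exact/FP_fst/FP_snd.
have frs : FP (fun x => (w x).2.2) by exact/FP_snd/FP_snd.
have Vc x : dom x -> all (fun i => i < V x) (w x).2.1.
  by move/hV; rewrite all_cat => /andP[].
have Vr x : dom x -> all (fun i => i < V x) (w x).2.2.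
  by move/hV; rewrite all_cat => /andP[].
have fbc : FP (fun x => bits_table (w x).2.1) by exact: (FP_bits_table bB hc Vc).
have fbr : FP (fun x => bits_table (w x).2.2) by exact: (FP_bits_table bB hr Vr).
have tb x (vs : seq nat) : 2 ^ size vs <= B x -> all (fun i => i < V x) vs ->
    table_bound (B x) (B x) (B x) (V x) (bits_table vs).
  move=> h1 /bits_table_bound; apply: table_bound_le => //.
    exact: leq_trans (ltnW (ltn_expl _ (ltnSn 1))) h1.
  exact: leq_trans (leq_pred _) h1.
have fvt : FP (fun x => vert_table (tab x) (w x).1).
  by apply: (FP_vert_table bB) => //; exact: FP_fst.
have fop : FP (fun x => wire_operand (tab x) (w x)) by apply: FP_if => //; exact: FP_nonnil.
have hop x : dom x -> size (wire_operand (tab x) (w x)) <= B x.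
  move=> hx; rewrite /wire_operand; case: ifP => _; last by case/andP: (hvt x hx).
  by case/andP: (tb _ _ (hc x hx) (Vc x hx)).
have fS : FP (fun x => add_table (e x).1 (wire_operand (tab x) (w x))).
  by apply: (FP_add_table bB he hop) => //; exact: FP_fst.
have fF : FP (fun x => (if 0 < size (w x).2.1
    then equality_clauses (vert_table (tab x) (w x).1) (bits_table (w x).2.1) else [::]) ++ (e x).2).
  apply: FP_cat; [|exact: FP_snd|].
    apply: FP_if; [exact: FP_nonnil| |done].
    by apply: (FP_equality_clauses bB hvt) => // x hx; apply: tb; [exact: hc|exact: Vc].
  apply: bounded_le (bounded_mul bB bB) _ => x hx; case: ifP => // _.
  have [/andP[h _]] := equality_clauses_bound (hvt x hx) (tb _ _ (hc x hx) (Vc x hx)).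
  exact: h.
apply: FP_if; [exact: FP_nonnil| |exact: FP_pair].
apply: FP_pair => //; apply: FP_cat => //.
  by apply: (FP_equality_clauses bB hS) => // x hx; apply: tb; [exact: hr|exact: Vr].
apply: bounded_le (bounded_mul bB bB) _ => x hx.
by have [/andP[h _]] := equality_clauses_bound (hS x hx) (tb _ _ (hr x hx) (Vr x hx)).
Qed.

(** The decomposition of [ws] matches the invariant of [FP_foldr]: when [w] is processed, the
    accumulator is the entry of the suffix [l2]. *)
Definition wires_bounded B V tab (ws : seq awire) :=
  forall l1 w l2, ws = l1 ++ w :: l2 ->
  [/\ [/\ w.1.2 <= B, 2 ^ size w.2.1 <= B & 2 ^ size w.2.2 <= B],
      all (fun i => i < V) (w.2.1 ++ w.2.2),
      table_bound B B B V (vert_table tab w.1), table_bound B B B V (wires_entry tab l2).1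
    & table_bound B B B V (add_table (wires_entry tab l2).1 (wire_operand tab w))].

Lemma FP_wires_entry (X : ctx) (tab : X -> seq entry) (ws : X -> seq awire) B V :
    bounded B -> (forall x, dom x -> size (tab x) <= B x) -> (forall x, dom x -> size (ws x) <= B x) ->
    (forall x, dom x -> wires_bounded (B x) (V x) (tab x) (ws x)) ->
  FP tab -> FP ws -> FP (fun x => wires_entry (tab x) (ws x)).
Proof.
move=> bB htab hws hb ftab fws.
apply: (FP_foldr (g := fun x => wire_step (tab x))) => //.
- exact: FP_const.
- exact: bounded_le bB hws.
apply: (@FP_wire_step (ext _) (fun w => tab w.1) (fun w => w.2.1) (fun w => w.2.2) _
  (fun w => V w.1) (bounded_weak bB)).
- by move=> w [hw _]; exact: htab.
- by move=> w [hw [l1 [l2 [e _]]]]; have [[]] := hb _ hw _ _ _ e.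
- by move=> w [hw [l1 [l2 [e _]]]]; have [[]] := hb _ hw _ _ _ e.
- by move=> w [hw [l1 [l2 [e _]]]]; have [[]] := hb _ hw _ _ _ e.
- by move=> w [hw [l1 [l2 [e _]]]]; have [] := hb _ hw _ _ _ e.
- by move=> w [hw [l1 [l2 [e _]]]]; have [] := hb _ hw _ _ _ e.
- by move=> w [hw [l1 [l2 [e ->]]]]; have [] := hb _ hw _ _ _ e.
- by move=> w [hw [l1 [l2 [e ->]]]]; have [] := hb _ hw _ _ _ e.
- exact: FP_weak ftab.
- exact: FP_fst FP_var.
- exact: FP_snd FP_var.
Qed.

Lemma FP_gate_bit (X : ctx) (l : X -> nat * nat) (f w : X -> nat) :
  bounded w -> FP l -> FP f -> FP w -> FP (fun x => gate_bit (l x) (f x) (w x)).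
Proof.
move=> bw fl ff fw; have fl1 := FP_fst fl.
apply: FP_if; [exact: FP_pos| |exact/FP_not/FP_pos].
apply: FP_leq => //; apply: FP_if => //; first exact/FP_pos/FP_pred.
by apply: FP_if; [exact/FP_pos/FP_pred/FP_pred|exact: FP_snd|exact: FP_const].
Qed.

Lemma FP_gate_entry (X : ctx) (tab : X -> seq entry) (g : X -> agate) B V :
    bounded B -> (forall x, dom x -> size (tab x) <= B x) ->
    (forall x, dom x -> size (g x).2 <= B x) ->
    (forall x, dom x -> wires_bounded (B x) (V x) (tab x) (g x).2) ->
    (forall x, dom x -> table_bound (B x) (B x) (B x) (V x) (wires_entry (tab x) (g x).2).1) ->
  FP tab -> FP g -> FP (fun x => gate_entry (tab x) (g x)).
Proof.
move=> bB htab hg hb ht ftab fg.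
have fw : FP (fun x => wires_entry (tab x) (g x).2).
  by apply: (FP_wires_entry bB htab hg hb) => //; exact: FP_snd.
apply: FP_pair; last exact: FP_snd.
apply: (FP_map (f := fun x (s : nat * seq lit) => (gate_bit (g x).1 (size (g x).2) s.1 : nat, s.2))).
- exact: FP_fst.
- by apply: bounded_le bB _ => x /ht /andP[].
apply: FP_pair; last exact/FP_snd/FP_var.
apply: FP_if; [|exact: FP_const|exact: FP_const].
apply: FP_gate_bit.
- apply: bounded_le (bounded_weak bB) _ => w [/ht /andP[_ /allP h]] /h.
  by case/and3P.
- exact: FP_weak (FP_fst fg).
- apply: FP_size; first exact: FP_weak (FP_snd fg).
  by apply: bounded_le (bounded_weak bB) _ => w [/hg].
- exact/FP_fst/FP_var.
Qed.

Lemma FP_formula (X : ctx) (A : X -> seq agate) (out : X -> vert) (r : X -> nat) B V :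
    bounded B -> (forall x, dom x -> r x <= B x) -> (forall x, dom x -> size (A x) <= B x) ->
    (forall x, dom x -> (out x).2 <= B x) ->
    (forall x g, dom x -> g \in A x -> size g.2 <= B x) ->
    (forall x g j, dom x -> g \in A x -> wires_bounded (B x) (V x) (tables (A x) j) g.2) ->
    (forall x g j, dom x -> g \in A x ->
      table_bound (B x) (B x) (B x) (V x) (wires_entry (tables (A x) j) g.2).1) ->
    (forall x j, dom x -> table_bound (B x) (B x) (B x) (V x) (vert_table (tables (A x) j) (out x))) ->
    (forall x e, dom x -> e \in tables (A x) (r x) -> size e.2 <= B x) ->
  FP A -> FP out -> FP r -> FP (fun x => formula (A x) (out x) (r x)).
Proof.
move=> bB hr hA ho hg hb ht hvt hF fA fout fr.
have sT x j : dom x -> size (tables (A x) j) <= B x.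
  by move=> hx; case: j => //= j; rewrite size_map; exact: hA.
have fT : FP (fun x => tables (A x) (r x)).
  apply: (FP_iter (g := fun x tab => [seq gate_entry tab g | g <- A x])) => //.
  - exact: FP_const.
  - exact: bounded_le bB hr.
  apply: (@FP_map (ext _) _ _ _ _ (fun w => A w.1) (fun w => gate_entry w.2)).
  - exact: FP_weak fA.
  - by apply: bounded_le (bounded_weak bB) _ => w [hw _]; exact: hA.
  apply: (@FP_gate_entry (ext (X := ext _) _) (fun w => w.1.2) (fun w => w.2) _
    (fun w => V w.1.1) (bounded_weak (bounded_weak bB))).
  - by move=> w [[hw [j _ ->]] _]; exact: sT.
  - by move=> w [[hw _] gA]; exact: hg.
  - by move=> w [[hw [j _ ->]] gA]; exact: (hb _ _ j).
  - by move=> w [[hw [j _ ->]] gA]; exact: (ht _ _ j).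
  - exact: FP_weak FP_var.
  - exact: FP_var.
have h1 x : dom x -> table_bound (B x + 1) (B x + 1) (B x + 1) (V x) [:: (1, [::])].
  by move=> _; rewrite /table_bound /=; lia.
have bB1 := bounded_add bB (bounded_const X 1).
have h2 x : dom x -> table_bound (B x + 1) (B x + 1) (B x + 1) (V x)
    (vert_table (tables (A x) (r x)) (out x)).
  by move=> hx; apply: table_bound_le (hvt x (r x) hx); exact: leq_addr.
apply: FP_cat.
- apply: (FP_equality_clauses bB1 h2 h1); last exact: FP_const.
  by apply: (FP_vert_table bB) => // x hx; exact: sT.
- apply: (FP_flatten (B := B)) => //.
  + by move=> x hx; rewrite size_map; exact: sT.
  + by move=> x s hx /mapP[e he ->]; exact: hF.
  apply: (FP_map (f := fun _ (e : entry) => e.2)) => //.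
  + by apply: bounded_le bB _ => x hx; exact: sT.
  + exact/FP_snd/FP_var.
- apply: bounded_le (bounded_mul bB1 bB1) _ => x hx.
  by case/andP: (equality_clauses_bound (h2 x hx) (h1 x hx)).
Qed.

(** The last condition stands for acyclicity: levels that another round leaves unchanged satisfy the
    defining recursion, and so increase strictly along wires. *)
Definition well_formed (x : instance) :=
  [/\ forall g u, g \in x.2.1 -> u \in g.2 -> is_vertex x.1 x.2.1 u,
      forall g, g \in x.2.1 -> size g.2 <= nvertices x,
      is_vertex x.1 x.2.1 x.2.2
    & levels x.2.1 (nvertices x).+1 = levels x.2.1 (nvertices x)].

Lemma is_vertex_lt (x : instance) u : is_vertex x.1 x.2.1 u -> u.2 < nvertices x.
Proof.
rewrite /is_vertex /nvertices; case: ifP => _ h; first exact: leq_trans h (leq_addl _ _).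
exact: leq_trans h (leq_addr _ _).
Qed.

(** * Correctness and size of the reduction on a well-formed instance *)

Section WellFormed.
Variables (k Q : nat) (Q_gt0 : 0 < Q) (x : instance) (x_wf : well_formed x).

Local Notation n := x.1.
Local Notation G := x.2.1.
Local Notation out := x.2.2.
Local Notation N := (nvertices x).
Local Notation p := (bits x).
Local Notation b := (base k x).
Local Notation lv := (final_levels x).
Local Notation lev := (nth 0 lv).
Local Notation gt := (nth ((0, 0), [::]) G).

(** Bounds the length of all terms in the tables of vertices: once the digit is dropped, heights are
    below [b ^ k], and each step of height costs a factor [p * Q.+1]. *)
Definition work := (p * Q.+1) ^ (b ^ k).

Lemma nvertices_gt0 : 0 < N.
Proof. by case: x_wf => _ _ /is_vertex_lt h _; exact: leq_ltn_trans h. Qed.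

Lemma nvertices_lt : N < 2 ^ p.
Proof. by case/andP: (find_bitsP N). Qed.

Lemma bits_gt0 : 0 < p.
Proof. 
rewrite lt0n; apply/eqP => e; have := nvertices_lt.
by rewrite e expn0 ltnNge nvertices_gt0.
Qed.

Lemma levelE i : i < size G -> lev i = gate_level lv (gt i).2.
Proof.
case: x_wf => _ _ _ st hi; rewrite /final_levels -[in LHS]st /=.
by rewrite (nth_map ((0, 0), [::])).
Qed.

Lemma level_lt i u : i < size G -> u \in (gt i).2 -> vert_level lv u < lev i.
Proof. by move=> hi hu; rewrite levelE //; exact: gate_level_ge. Qed.

Lemma level_le i : lev i <= N.
Proof.
case: (ltnP i (size lv)) => hi; last by rewrite nth_default.
by apply: (@levels_le G); exact: mem_nth.
Qed.

Lemma max_level_le : foldr maxn 0 lv <= N.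
Proof.
have := @levels_le G N; rewrite /final_levels; elim: (levels _ _) => //= l s IH h.
rewrite geq_max h ?mem_head // IH // => i hi.
by apply: h; rewrite inE hi orbT.
Qed.

Lemma level_lt_base i : lev i < b ^ k.+1.
Proof.
have [_ _] := find_baseP k (foldr maxn 0 lv); apply: leq_ltn_trans.
elim: (lv) i => [|l s IH] [|i] //=; first by rewrite leq_maxl.
by apply: leq_trans (IH i) _; rewrite leq_maxr.
Qed.

Lemma base_pos : 0 < b.
Proof. by case: (find_baseP k (foldr maxn 0 lv)). Qed.

Lemma work_ge : p * Q.+1 <= work.
Proof.
rewrite -[X in X <= _]expn1 /work leq_pexp2l ?expn_gt0 ?base_pos //.
by rewrite muln_gt0 bits_gt0.
Qed.

Lemma wires_okW i u : i < size G -> u \in (gt i).2 ->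
  is_vertex n G u /\ (u.1 -> lev u.2 < lev i).
Proof.
case: x_wf => ok _ _ _ hi hu; split; first by apply: ok hu; exact: mem_nth.
by move=> u1; have := level_lt hi hu; rewrite /vert_level u1.
Qed.

Lemma gap_bound_gt0 : 0 < p * Q.
Proof. by rewrite muln_gt0 bits_gt0. Qed.

Section Annotation.
Variables (j : nat) (j_le : j <= k).

Local Notation cut := (cut_wire lv (b ^ j) b).
Local Notation A := (annotation k Q x j).2.
Local Notation V := (annotation k Q x j).1.2.
Local Notation gtA := (nth ((0, 0), [::]) A).

Definition cut_level i := drop_digit b j (lev i).
Local Notation h := cut_level.

Lemma annotation_gates : [seq (g.1, [seq w.1 | w <- g.2]) | g <- A] = G.
Proof. by have [] := annotateP bits_gt0 cut n G gap_bound_gt0. Qed.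

Lemma annotation_fresh : fresh_in (gates_vars A) n V.
Proof. by have [] := annotateP bits_gt0 cut n G gap_bound_gt0. Qed.

Lemma annotation_sized :
  all (fun g : agate => all (well_sized p (cut (g.1, [seq w.1 | w <- g.2]))) g.2) A.
Proof. by have [] := annotateP bits_gt0 cut n G gap_bound_gt0. Qed.

Lemma annotation_gap i l1 l2 : i < size A -> (gtA i).2 = l1 ++ l2 -> gap l2 < p * Q.
Proof.
move=> hi; have [_ _ _ _] := annotateP bits_gt0 cut n G gap_bound_gt0; apply.
exact: mem_nth.
Qed.

Lemma annotation_size : size A = size G.
Proof. by rewrite -annotation_gates size_map. Qed.

Lemma annotation_nth i : i < size A ->
  ((gtA i).1, [seq w.1 | w <- (gtA i).2]) = gt i.
Proof. by move=> hi; rewrite -annotation_gates (nth_map ((0, 0), [::])). Qed.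

Lemma annotation_n_le : n <= V.
Proof. by case/and3P: annotation_fresh. Qed.

Lemma drop_level_lt i : i < size A -> h i < b ^ k.
Proof. by move=> _; apply: drop_digit_lt; rewrite ?base_pos ?level_lt_base. Qed.

Lemma annotation_wires i w : i < size A -> w \in (gtA i).2 ->
  [/\ size w.2.1 <= 1, (size w.2.2 == 0) || (size w.2.2 == p),
      all (fun i => i < V) (w.2.1 ++ w.2.2), ~~ w.1.1 -> w.1.2 < V
    & size w.2.1 = 0 -> w.1.1 -> w.1.2 < size A -> h w.1.2 < h i].
Proof.
move=> hi hw; have hg := mem_nth ((0, 0), [::]) hi.
have := allP (allP annotation_sized _ hg) _ hw; rewrite annotation_nth //.
case/andP=> /eqP s1 s2; have hi' : i < size G by rewrite -annotation_size.
have hu : w.1 \in (gt i).2 by rewrite -annotation_nth // map_f.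
have [hv hl] := wires_okW hi' hu; split.
- by rewrite s1 leq_b1.
- by move: s2; rewrite !inE.
- case/and3P: annotation_fresh => _ _ /allP hV; apply/allP => i' hi''.
  have /hV /andP[] // : i' \in gates_vars A.
  apply/flattenP; exists (wires_vars (gtA i).2); first exact: map_f.
  by apply/flattenP; exists (w.2.1 ++ w.2.2) => //; exact: map_f.
- move=> w1; move: hv; rewrite /is_vertex (negbTE w1) => hv.
  exact: leq_trans hv annotation_n_le.
- rewrite s1 => /eqP; rewrite eqb0 => nc w1 _; apply: drop_digit_mono base_pos (hl w1) _.
  by move: nc; rewrite /cut_wire /vert_level w1 -levelE.
Qed.

Lemma annotation_sat : raw_sat G out <->
  exists y, all (sat_clause y) (formula A out N.+2).
Proof.
case: x_wf => _ fan ok _.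
apply: (formula_sat wires_okW ok annotation_gates annotation_fresh annotation_sized).
- by move=> g /fan hg; apply: leq_ltn_trans hg nvertices_lt.
- by move=> i _; rewrite ltnS level_le.
Qed.

Lemma annotation_tables r u : (~~ u.1 -> u.2 < V) ->
  table_bound (2 ^ work) work 1 V (vert_table (tables A r) u).
Proof. exact: (all_table_bound bits_gt0 Q_gt0 drop_level_lt annotation_wires annotation_gap). Qed.

Lemma annotation_fanin g : g \in A -> size g.2 <= N.
Proof.
move=> gA; case: x_wf => _ fan _ _; rewrite -(size_map (fun w => w.1)).
apply: (fan (g.1, _)); rewrite -annotation_gates.
exact: (map_f (fun g : agate => (g.1, [seq w.1 | w <- g.2]))).
Qed.

Definition work_bound := 2 ^ work * 2 ^ work + 2 ^ work * work + N.

Lemma annotation_wires_bounded r g : g \in A ->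
  wires_bounded work_bound V (tables A r) g.2 /\
  table_bound work_bound work_bound work_bound V (wires_entry (tables A r) g.2).1.
Proof.
case/(nthP ((0, 0), [::])) => i hi <-.
have E1 : p * Q.+1 <= work := work_ge.
have E2 : 2 ^ p <= 2 ^ work by rewrite leq_exp2l //; have := bits_gt0; nia.
have E3 : 1 < 2 ^ p by have := nvertices_lt; have := nvertices_gt0; lia.
have E4 : p * Q <= work by have := bits_gt0; nia.
have le1 : 2 ^ work <= work_bound by rewrite /work_bound; nia.
have le2 : work <= work_bound by rewrite /work_bound; nia.
have le3 : 2 ^ p + p * Q <= work_bound by rewrite /work_bound; nia.
split.
  move=> l1 w l2 e.
  have hw : w \in (gtA i).2 by rewrite e mem_cat mem_head orbT.
  have [w1 w2 w3 w4 w5] := annotation_wires hi hw.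
  have [h1 h2] := wires_suffix_bound bits_gt0 Q_gt0 drop_level_lt annotation_wires annotation_gap r hi e.
  split=> //.
  - split.
    + have hu : w.1 \in (gt i).2 by rewrite -annotation_nth // map_f.
      have hi' : i < size G by rewrite -annotation_size.
      have [hv _] := wires_okW hi' hu; move: hv; rewrite /is_vertex /work_bound /nvertices; case: ifP; lia.
    + apply: leq_trans le1; apply: leq_trans E2; rewrite leq_exp2l //.
      exact: leq_trans w1 bits_gt0.
    + apply: leq_trans le1; apply: leq_trans E2; rewrite leq_exp2l //.
      by case/orP: w2 => /eqP ->.
  - by apply: table_bound_le (annotation_tables _ w4) => //; lia.
  - exact: table_bound_le h2.
  - exact: table_bound_le h1.
have [h1 _] := gate_bound bits_gt0 Q_gt0 drop_level_lt annotation_wires annotation_gap r hi.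
exact: table_bound_le h1.
Qed.

Lemma annotation_gate_clauses r g : g \in A ->
  clauses_bound (N * (2 ^ work * 2 + 2 ^ work * 2 ^ p)) (2 * work) V
    (wires_entry (tables A r) g.2).2.
Proof.
move=> gA; have := annotation_fanin gA.
case/(nthP ((0, 0), [::])): gA => i hi <- hN.
have [_] := gate_bound bits_gt0 Q_gt0 drop_level_lt annotation_wires annotation_gap r hi.
by apply: clauses_bound_le => //; rewrite leq_mul2r hN orbT.
Qed.

Lemma annotation_formula :
  clauses_bound (2 ^ work + size G * (N * (2 ^ work * 2 + 2 ^ work * 2 ^ p))) (2 * work) V
    (formula A out N.+2).
Proof.
rewrite -annotation_size.
apply: (formula_bound bits_gt0 Q_gt0 drop_level_lt annotation_wires annotation_gap).
  case: x_wf => _ _ + _; rewrite /is_vertex; case: ifP => //= _ ho _.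
  exact: leq_trans ho annotation_n_le.
by move=> i hi; apply: annotation_fanin; exact: mem_nth.
Qed.

End Annotation.

Lemma reduction_sat : raw_sat G out <->
  exists y, all (sat_clause y) (reduction k Q x).2.
Proof.
have [j jk e] := bestP (annotation k Q x) k.
by rewrite /reduction /best_annotation e; exact: annotation_sat.
Qed.

Lemma reduction_bound :
  clauses_bound (2 ^ work + size G * (N * (2 ^ work * 2 + 2 ^ work * 2 ^ p))) (2 * work)
    (reduction k Q x).1 (reduction k Q x).2.
Proof.
have [j jk e] := bestP (annotation k Q x) k.
by rewrite /reduction /best_annotation e; exact: annotation_formula.
Qed.

(* Averaging over the [k.+1] disjoint classes of wires. *)
Lemma reduction_vars : exists c e,
  [/\ n <= (reduction k Q x).1 <= n + c + e, k.+1 * c <= \sum_(g <- G) size g.2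
    & Q * e <= \sum_(g <- G) size g.2].
Proof.
pose cuts j := \sum_(g <- G) count (cut_wire lv (b ^ j) b g) g.2.
have [j jk hj] : exists2 j, j <= k & k.+1 * cuts j <= \sum_(g <- G) size g.2.
  pose j := [arg min_(i < (ord0 : 'I_k.+1)) cuts i].
  exists j; first by rewrite -ltnS.
  apply: leq_trans (sum_cut_wires lv b k.+1 G).
  rewrite -[X in X * _](card_ord k.+1) -sum_nat_const; apply: leq_sum => i _.
  by rewrite /j; case: arg_minnP => // i' _; exact.
have [_ _ _ [e VE eL] _] := annotateP bits_gt0 (cut_wire lv (b ^ j) b) n G gap_bound_gt0.
exists (cuts j), (p * e); split=> //; last by apply: leq_trans eL; rewrite mulnA (mulnC Q).
apply/andP; split.
  have [i ik e'] := bestP (annotation k Q x) k.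
  by rewrite /reduction /best_annotation e' annotation_n_le.
by have := best_le (annotation k Q x) jk; rewrite /= {2}/annotation VE.
Qed.

End WellFormed.

Lemma wires_bounded_le B B' V tab ws : B <= B' ->
  wires_bounded B V tab ws -> wires_bounded B' V tab ws.
Proof.
move=> le h l1 w l2 e; have [[h1 h2 h3] h4 h5 h6 h7] := h l1 w l2 e.
split=> //.
- by split; [exact: leq_trans h1 le|exact: leq_trans h2 le|exact: leq_trans h3 le].
- exact: table_bound_le h5.
- exact: table_bound_le h6.
- exact: table_bound_le h7.
Qed.

Lemma sum_fanin_le x : well_formed x ->
  \sum_(g <- x.2.1) size g.2 <= nvertices x * nvertices x.
Proof.
case=> _ fan _ _; apply: (@leq_trans (\sum_(g <- x.2.1) nvertices x)).
  by rewrite big_seq [X in _ <= X]big_seq; apply: leq_sum => g /fan.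
rewrite big_const_seq count_predT iter_addn_0 leq_mul2l; apply/orP; right.
exact: leq_addl.
Qed.

(** * A program for the reduction *)

Section FPReduction.
Variables (k Q : nat) (Q_gt0 : 0 < Q).

(** The measure [2 ^ work] dominates the number of tuples in any table as well as the number of
    vertices, which is less than [2 ^ bits x]; the thresholds are left out of it. *)
Definition instances : ctx := Ctx well_formed enc (fun x => 2 ^ work k Q x).
Local Notation X := instances.

Let f_id : FP (X := X) (fun x => x).
Proof.
exists (Assign 0 (Var 0)), (fun _ => 2); first exact: bounded_const.
by move=> x _ s s0; exists 2, (update s 0 (s 0)); split=> //; exact: (ExecAssign 0 (Var 0)).
Qed.

Let f_n : FP (X := X) (fun x => x.1). Proof. exact: FP_fst f_id. Qed.
Let f_G : FP (X := X) (fun x => x.2.1). Proof. exact: FP_fst (FP_snd f_id). Qed.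
Let f_out : FP (X := X) (fun x => x.2.2). Proof. exact: FP_snd (FP_snd f_id). Qed.

Let b_work2 : bounded (X := X) (fun x => 2 ^ work k Q x). Proof. exact: bounded_mu. Qed.

Let b_work : bounded (X := X) (work k Q).
Proof. by apply: bounded_le b_work2 _ => x _; exact/ltnW/ltn_expl. Qed.

Let b_2p : bounded (X := X) (fun x => 2 ^ bits x).
Proof.
apply: bounded_le b_work2 _ => x hx; rewrite leq_exp2l //.
by apply: leq_trans (work_ge k Q hx); rewrite leq_pmulr.
Qed.

Let b_p : bounded (X := X) bits.
Proof. by apply: bounded_le b_2p _ => x _; exact/ltnW/ltn_expl. Qed.

Let b_N : bounded (X := X) nvertices.
Proof. by apply: bounded_le b_2p _ => x _; exact/ltnW/nvertices_lt. Qed.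

Let b_N1 : bounded (X := X) (fun x => nvertices x + 1).
Proof. exact: bounded_add b_N (bounded_const _ 1). Qed.

Let f_N : FP (X := X) nvertices.
Proof.
rewrite /nvertices; apply: FP_addn => //.
- by apply: FP_size => //; apply: bounded_le b_N _ => x _; exact: leq_addl.
- by apply: bounded_le b_N _ => x _; exact: leq_addr.
Qed.

Let f_p : FP (X := X) bits.
Proof.
rewrite /bits /find_bits.
apply: (FP_iter (X := X) (g := fun x p => if 2 ^ p <= nvertices x then p.+1 else p)) => //.
  exact: FP_const.
set Y := ext _.
have b2 : bounded (X := Y) (fun w => 2 ^ w.2).
  apply: bounded_le (bounded_weak (bounded_add (bounded_mul (bounded_const X 2) b_N) (bounded_const X 1))) _.
  by move=> w [_ [j _ ->]]; rewrite addn1; case: (find_bits_iter (nvertices w.1) j).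
have fv : FP (X := Y) (fun w => w.2) by exact: FP_var.
apply: FP_if => //; last exact: FP_succ.
apply: FP_leq; [|exact: FP_weak f_N|exact: bounded_weak b_N].
apply: FP_pow2 => //; apply: bounded_le b2 _ => w _; exact/ltnW/ltn_expl.
Qed.

Let f_lv : FP (X := X) final_levels.
Proof.
rewrite /final_levels; apply: (FP_levels b_N) => //.
- by move=> x _; exact: leq_addl.
- move=> x g [ver fan _ _] hg; split; first exact: fan.
  by move=> u /(ver _ _ hg) /is_vertex_lt /ltnW.
Qed.

Let b_lv : bounded (X := X) (fun x => size (final_levels x)).
Proof.
by apply: bounded_le b_N _ => x _; apply: leq_trans (size_levels _ _) (leq_addl _ _).
Qed.

Let b_D : bounded (X := X) (fun x => foldr maxn 0 (final_levels x)).
Proof. by apply: bounded_le b_N _ => x _; exact: max_level_le. Qed.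

Let f_D : FP (X := X) (fun x => foldr maxn 0 (final_levels x)).
Proof.
apply: (FP_foldr (g := fun _ => maxn)) => //; first exact: FP_const.
set Y := ext _.
have hY w : @dom Y w -> w.2.1 <= nvertices w.1 /\ w.2.2 <= nvertices w.1.
  move=> [hw [l1 [l2 [e ->]]]].
  have h := @levels_le w.1.2.1 (nvertices w.1); rewrite -/(final_levels w.1) e in h.
  split; first by apply: h; rewrite mem_cat mem_head orbT.
  elim: (l2) (h) => //= l s IH h'; rewrite geq_max h' ?IH //.
    by move=> i hi; apply: h'; move: hi; rewrite !mem_cat !inE => /or3P[] ->; rewrite ?orbT.
  by rewrite mem_cat !inE eqxx !orbT.
apply: FP_maxn; [exact/FP_fst/FP_var|exact/FP_snd/FP_var| |].
- by apply: bounded_le (bounded_weak b_N) _ => w /hY[].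
- by apply: bounded_le (bounded_weak b_N) _ => w /hY[].
Qed.

Lemma base_le x : base k x <= nvertices x + 1.
Proof.
have [_ h _] := find_baseP k (foldr maxn 0 (final_levels x)).
have := leq_trans h (max_level_le x).
set b := find_base _ _; rewrite -/(base k x) => h'.
suff : b.-1 <= nvertices x by rewrite /base -/b; lia.
case: (posnP b.-1) => [-> //|b0]; apply: leq_trans h'.
by rewrite -[X in X <= _]expn1 leq_pexp2l.
Qed.

Let b_b : bounded (X := X) (base k).
Proof. by apply: bounded_le b_N1 _ => x _; exact: base_le. Qed.

Let f_b : FP (X := X) (base k).
Proof.
rewrite /base /find_base.
apply: (FP_iter (X := X) (g := fun x b => if b ^ k.+1 <= foldr maxn 0 (final_levels x) then b.+1 else b)) => //.
  exact: FP_const.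
set Y := ext _.
have fv : FP (X := Y) (fun w => w.2) by exact: FP_var.
apply: FP_if => //; last exact: FP_succ.
apply: FP_leq; [|exact: FP_weak f_D|exact: bounded_weak b_D].
apply: FP_exp => //; apply: bounded_le (bounded_weak b_N1) _ => w [_ [j _ ->]].
have [_ h _] := find_base_iter k (foldr maxn 0 (final_levels w.1)) j.
have := leq_trans h (max_level_le w.1); set b := iter _ _ _ => h'.
suff : b.-1 <= nvertices w.1 by lia.
case: (posnP b.-1) => [-> //|b0]; apply: leq_trans h'.
by rewrite -[X in X <= _]expn1 leq_pexp2l.
Qed.

Let f_annotation j : FP (X := X) (fun x => annotation k Q x j).
Proof.
pose B x := nvertices x + bits x + (base k x + (base k x) ^ j).
have bB : bounded (X := X) B.
  exact: bounded_add (bounded_add b_N b_p) (bounded_add b_b (bounded_exp j b_b)).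
have NB x : nvertices x <= B x by rewrite /B; lia.
rewrite /annotation; apply: (FP_annotate (X := X) (B := B)) => //.
- by move=> x _; rewrite /B; lia.
- by move=> x _; apply: leq_trans (NB x); exact: leq_addr.
- by move=> x _; apply: leq_trans (NB x); exact: leq_addl.
- by move=> x g [_ fan _ _] /fan; move/leq_trans; apply.
- apply: FP_muln => //; [exact: FP_const|exact: bounded_const].
set Y := ext _.
have bY : bounded (X := Y) (fun w => B w.1) by exact: bounded_weak.
apply: (FP_cut_wire bY).
- move=> w _; apply: leq_trans (NB _).
  exact: leq_trans (size_levels _ _) (leq_addl _ _).
- move=> w _ l /levels_le h; exact: leq_trans (NB _).
- by move=> w [[_ fan _ _] /andP[/fan h _]]; exact: leq_trans (NB _).
- move=> w [[ver _ _ _] /andP[hg _]] u /(ver _ _ hg) /is_vertex_lt /ltnW h.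
  exact: leq_trans (NB _).
- move=> w [[ver _ _ _] /andP[hg hu]].
  exact: leq_trans (ltnW (is_vertex_lt (ver _ _ hg hu))) (NB _).
- move=> w _; rewrite expn_gt0 base_pos /= /B; lia.
- move=> w _; rewrite base_pos /= /B; lia.
- exact: FP_weak f_lv.
- exact: FP_weak (FP_exp j f_b b_b).
- exact: FP_weak f_b.
- exact/FP_fst/FP_var.
- exact/FP_snd/FP_var.
Qed.

Lemma annotation_vars_le x j : well_formed x ->
  (annotation k Q x j).1.2 <= nvertices x + (bits x + 1) * (nvertices x * nvertices x).
Proof.
move=> hx; have [_ h] := annotate_gates_le (bits x) (bits x * Q)
  (cut_wire (final_levels x) (base k x ^ j) (base k x)) x.1 x.2.1.
apply: leq_trans h _; apply: leq_add; first exact: leq_addr.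
by rewrite leq_mul2l sum_fanin_le // orbT.
Qed.

Lemma best_vars_le x i : well_formed x ->
  (best (annotation k Q x) i).1.2 <= nvertices x + (bits x + 1) * (nvertices x * nvertices x).
Proof. by move=> hx; have [j _ ->] := bestP (annotation k Q x) i; exact: annotation_vars_le. Qed.

Let f_best i : FP (X := X) (fun x => best (annotation k Q x) i).
Proof.
elim: i => [|i IH]; first exact: f_annotation.
apply: FP_if => //; apply: FP_leq; [exact/FP_snd/FP_fst|exact/FP_snd/FP_fst|].
apply: bounded_le (bounded_add b_N (bounded_mul (bounded_add b_p (bounded_const X 1)) (bounded_mul b_N b_N))) _.
by move=> x hx; exact: best_vars_le.
Qed.

Lemma FP_reduction : FP (X := X) (reduction k Q).
Proof.
rewrite /reduction; apply: FP_pair; first exact/FP_snd/FP_fst/f_best.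
pose B x := work_bound k Q x + nvertices x * (2 ^ work k Q x * 2 + 2 ^ work k Q x * 2 ^ bits x) + 2.
have bB : bounded (X := X) B.
  exact: bounded_add (bounded_add (bounded_add (bounded_add (bounded_mul b_work2 b_work2)
    (bounded_mul b_work2 b_work)) b_N) (bounded_mul b_N (bounded_add
    (bounded_mul b_work2 (bounded_const X 2)) (bounded_mul b_work2 b_2p)))) (bounded_const X 2).
have NB x : nvertices x + 2 <= B x by rewrite /B /work_bound; lia.
have NB' x : nvertices x <= B x by rewrite /B /work_bound; lia.
have WB x : work_bound k Q x <= B x by rewrite /B; lia.
apply: (FP_formula (X := X) (B := B) (V := fun x => (best_annotation k Q x).1.2)) => //.
- by move=> x _; rewrite -addn2 NB.
- move=> x hx; rewrite /best_annotation; have [j jk ->] := bestP (annotation k Q x) k.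
  by rewrite annotation_size //; apply: leq_trans (NB' x); exact: leq_addl.
- by move=> x [_ _ /is_vertex_lt /ltnW ho _]; exact: leq_trans (NB' x).
- move=> x g hx; rewrite /best_annotation; have [j jk ->] := bestP (annotation k Q x) k.
  by move/(annotation_fanin Q_gt0 hx)/leq_trans; apply.
- move=> x g r hx; rewrite /best_annotation; have [j jk ->] := bestP (annotation k Q x) k.
  by move/(annotation_wires_bounded Q_gt0 hx jk r) => [h _]; exact: wires_bounded_le h.
- move=> x g r hx; rewrite /best_annotation; have [j jk ->] := bestP (annotation k Q x) k.
  by move/(annotation_wires_bounded Q_gt0 hx jk r) => [_ h]; exact: table_bound_le h.
- move=> x r hx; rewrite /best_annotation; have [j jk ->] := bestP (annotation k Q x) k.
  have hu : ~~ x.2.2.1 -> x.2.2.2 < (annotation k Q x j).1.2.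
    have [_ _ ho _] := hx; move: ho; rewrite /is_vertex; case: ifP => //= _ ho _.
    exact: leq_trans ho (annotation_n_le k Q_gt0 hx j).
  have h2 : 0 < 2 ^ work k Q x by rewrite expn_gt0.
  have h3 := ltn_expl (work k Q x) (ltnSn 1).
  have h1 : 2 ^ work k Q x <= B x by apply: leq_trans (WB x); rewrite /work_bound; nia.
  by apply: table_bound_le (annotation_tables Q_gt0 hx jk r hu); lia.
- move=> x e hx; rewrite /best_annotation; have [j jk ->] := bestP (annotation k Q x) k.
  move=> /mapP[g /(annotation_gate_clauses Q_gt0 hx jk (nvertices x).+1) /andP[h _] ->].
  apply: leq_trans h _; rewrite /B; lia.
- exact/FP_snd/f_best.
- by do 2!apply: FP_succ.
Qed.

End FPReduction.

(** * From circuits to instances of the reduction *)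

Lemma gate_level_attained lv us j : gate_level lv us = j.+1 ->
  exists2 u, u \in us & vert_level lv u = j.
Proof.
elim: us => //= u us IH; rewrite /maxn; case: ifP => _ => [/IH[w hw e]|[e]].
  by exists w; rewrite // inE hw orbT.
by exists u; rewrite ?mem_head.
Qed.

Lemma gate_level_mono lv lv' us : (forall i, nth 0 lv i <= nth 0 lv' i) ->
  gate_level lv us <= gate_level lv' us.
Proof.
move=> le; elim: us => //= u us IH; rewrite geq_max !leq_max IH orbT andbT ltnS.
by apply/orP; left; rewrite /vert_level; case: ifP.
Qed.

Lemma levels_mono G r i : nth 0 (levels G r) i <= nth 0 (levels G r.+1) i.
Proof.
elim: r i => [|r IH] i; first by rewrite nth_nil.
case: (ltnP i (size G)) => hi; last by rewrite nth_default //; exact: leq_trans (size_levels _ _) hi.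
by rewrite /= !(nth_map ((0, 0), [::])) //; exact: gate_level_mono.
Qed.

(* A level that changes in a round is as large as the number of rounds. *)
Lemma levels_step G r i : nth 0 (levels G r.+1) i = nth 0 (levels G r) i \/
  nth 0 (levels G r.+1) i = r.+1.
Proof.
elim: r i => [|r IH] i.
  case: (ltnP i (size (levels G 1))) => hi; last by left; rewrite nth_default // nth_nil.
  have := levels_le (mem_nth 0 hi); rewrite nth_nil leq_eqVlt ltnS leqn0.
  by case/orP => /eqP ->; [right|left].
case: (eqVneq (nth 0 (levels G r.+2) i) (nth 0 (levels G r.+1) i)) => [->|ne]; first by left.
right; have := levels_mono G r.+1 i; rewrite leq_eqVlt eq_sym (negbTE ne) orFb.
case: (ltnP i (size G)) => hi; last first.
  have hs r' : size (levels G r') <= i by exact: leq_trans (size_levels _ _) hi.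
  by rewrite !nth_default.
set g := nth ((0, 0), [::]) G i.
have e2 : nth 0 (levels G r.+2) i = gate_level (levels G r.+1) g.2.
  by rewrite /= (nth_map ((0, 0), [::])).
have e1 : nth 0 (levels G r.+1) i = gate_level (levels G r) g.2.
  by rewrite /= (nth_map ((0, 0), [::])).
rewrite e1 e2; case e: (gate_level (levels G r.+1) g.2) => [//|j].
(* A predecessor [u] that attains the new level has itself changed in the preceding round, since
   otherwise the level would have been as large already; the induction hypothesis then gives the
   level of [u]. *)
have [u hu uj] := gate_level_attained e; have := gate_level_ge (levels G r) hu.
move: uj; rewrite /vert_level; case: ifP => [_|_ <-]; last by case: gate_level => [|[]].
by case: (IH u.2) => -> <- // lt1; rewrite ltnS leqNgt lt1.
Qed.

Section Circuit.
Variables (n : nat) (C : circuit n).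
Local Notation m := (ngates C).
Local Notation V := (vertex n m).

Definition raw_vertex (u : V) : vert :=
  match u with inl i => (false, val i) | inr g => (true, val g) end.

Definition raw_label (l : gate_label) : nat * nat :=
  match l with NEG => (0, 0) | AND => (1, 0) | OR => (2, 0) | TH t => (3, t) end.

Definition raw_gate (g : 'I_m) : rgate :=
  (raw_label (label g), [seq raw_vertex u | u <- enum (fanin g)]).

Definition raw_circuit : instance :=
  (n, ([seq raw_gate g | g <- enum 'I_m], raw_vertex (output C))).

Local Notation G := raw_circuit.2.1.
Local Notation gt := (nth ((0, 0), [::]) G).

(** The raw instance and the circuit are the same tree, so that no conversion has to be
    programmed. *)
Lemma enc_raw_circuit : enc raw_circuit = enc_circuit C.
Proof.
have mapE T U (eU : encoding U) (f : T -> U) (s : seq T) :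
    enc (map f s) = enc_seq (fun x => enc (f x)) s.
  by elim: s => //= x s; rewrite /enc /seq_encoding /= => ->.
have vertE (u : V) : enc (raw_vertex u) = enc_vertex u by case: u.
rewrite -[LHS]/(node (enc_nat n) (node (enc G) (enc (raw_vertex (output C))))) mapE vertE.
congr (node _ (node _ _)); elim: (enum _) => //= g s ->; congr node.
rewrite -[LHS]/(node (enc (raw_label (label g))) (enc [seq raw_vertex u | u <- enum (fanin g)])).
rewrite mapE; congr node; first by case: (label g).
by elim: (enum _) => //= u s' ->; rewrite vertE.
Qed.

Lemma size_raw_gates : size G = m.
Proof. by rewrite size_map size_enum_ord. Qed.

Lemma nth_raw_gates (g : 'I_m) : gt g = raw_gate g.
Proof. by rewrite (nth_map g) ?size_enum_ord // nth_ord_enum. Qed.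

Lemma nvertices_raw : nvertices raw_circuit = #|{: V}|.
Proof. by rewrite /nvertices size_raw_gates card_sum !card_ord. Qed.

Lemma is_vertex_raw (u : V) : is_vertex n G (raw_vertex u).
Proof. by case: u => i; rewrite /is_vertex /= ?size_raw_gates. Qed.

Lemma nwires_raw : \sum_(g <- G) size g.2 = nwires C.
Proof.
rewrite big_map big_enum /= /nwires.
under eq_bigr => g _ do rewrite size_map -cardE.
pose pairs (v : V) := [set e : V * V | (e.2 == v) && wire e.1 e.2].
rewrite -sum1_card (partition_big (fun e : V * V => e.2) xpredT) //= big_sumType /=.
rewrite [X in _ = X + _]big1 ?add0n => [|i _]; last first.
  by rewrite big1 // => -[u v] /= /andP[+ /eqP e]; rewrite inE /= e.
apply: eq_bigr => g _; rewrite -sum1_card.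
rewrite (reindex_onto (fun u : V => (u, inr g : V)) fst) /=.
  by apply: eq_bigl => u; rewrite inE /= !eqxx !andbT.
by move=> [u v] /= /andP[_ /eqP ->].
Qed.

(** All kinds of gates depend on their inputs only through the number of true ones; this is why a
    scan that counts is enough. *)
Lemma gate_value_raw l (S : {set V}) (v : V -> bool) :
  gate_value l S v = gate_bit (raw_label l) #|S| (count v (enum S)).
Proof.
have cE : #|[set u in S | v u]| = count v (enum S).
  rewrite -sum1_card -sum1_count big_enum_cond /=.
  by apply: eq_bigl => u; rewrite inE.
have allE (a : pred V) : [forall u in S, a u] = all a (enum S).
  apply/forall_inP/allP => h u; first by rewrite mem_enum; exact: h.
  by move=> hu; apply: h; rewrite mem_enum.
case: l => [|||t] /=; rewrite /gate_bit /=.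
- by rewrite allE -has_count -all_predC.
- by rewrite allE all_count cardE eqn_leq count_size.
- rewrite -has_count; apply/exists_inP/hasP => -[u hu vu]; exists u => //.
    by rewrite mem_enum.
  by rewrite -mem_enum.
- by rewrite cE.
Qed.

Definition extend k (f : {ffun 'I_k -> bool}) (i : nat) : bool :=
  if insub i is Some j then f j else false.

Lemma extendE k (f : {ffun 'I_k -> bool}) (i : 'I_k) : extend f i = f i.
Proof. by rewrite /extend valK. Qed.

Lemma raw_satP : raw_sat G (raw_vertex (output C)) <-> circuit_sat C.
Proof.
split=> [[a [v [hv ho]]]|].
  apply/existsP; exists [ffun i : 'I_n => a i].
  apply/existsP; exists [ffun u : V => vert_value a v (raw_vertex u)].
  rewrite ffunE ho andbT; apply/andP; split.
    by apply/forallP => i; rewrite !ffunE.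
  apply/forallP => g; rewrite gate_value_raw ffunE /= /vert_value /= hv ?size_raw_gates //.
  rewrite nth_raw_gates /= size_map -cardE count_map; apply/eqP; congr (gate_bit _ _ _).
  by apply: eq_count => u /=; rewrite ffunE.
case/existsP=> a /existsP[v /andP[/andP[/forallP va /forallP vg] vo]].
pose v' i := if insub i is Some g then v (inr g : V) else false.
have vE u : vert_value (extend a) v' (raw_vertex u) = v u.
  case: u => i; rewrite /vert_value /=; first by rewrite extendE (eqP (va i)).
  by rewrite /v' valK.
exists (extend a), v'; split; last by rewrite vE.
move=> i; rewrite size_raw_gates => hi; rewrite -[i]/(nat_of_ord (Ordinal hi)).
have -> : v' (Ordinal hi) = v (inr (Ordinal hi)) by rewrite /v' valK.
rewrite nth_raw_gates (eqP (vg _)) gate_value_raw /= size_map -cardE count_map.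
by congr (gate_bit _ _ _); apply: eq_count => u /=; rewrite vE.
Qed.

Hypothesis C_threshold : threshold_circuit C.

Lemma wire_path_uniq x p : path (wire (C := C)) x p -> uniq (x :: p).
Proof.
have [acyc _ _] := C_threshold.
elim: p x => // y p IH x xyp; rewrite cons_uniq; apply/andP; split; last first.
  by apply: IH; case/andP: xyp.
apply/negP => xp; case/splitPr: xp xyp => p1 p2.
rewrite cat_path /= => /and3P[h1 h2 _].
have c : cycle (wire (C := C)) (x :: p1) by rewrite /= rcons_path h1.
by have := acyc _ c.
Qed.

Lemma level_path r u : exists x p,
  [/\ path (wire (C := C)) x p, size p = vert_level (levels G r) (raw_vertex u) & last x p = u].
Proof.
elim: r u => [|r IH] u; first by exists u, [::]; case: u => i; rewrite /vert_level /= ?nth_nil.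
case: u => [i|g]; first by exists (inl i), [::].
rewrite {1}/vert_level /= (nth_map ((0, 0), [::])) ?size_raw_gates // nth_raw_gates /=.
case e: (gate_level _ _) => [|j]; first by exists (inr g), [::].
have [_ /mapP[w hw ->] wj] := gate_level_attained e.
have [x [p [hp sp lp]]] := IH w; exists x, (rcons p (inr g)).
rewrite rcons_path hp lp size_rcons sp wj last_rcons; split=> //=.
by rewrite mem_enum in hw.
Qed.

Lemma level_lt_card r u : vert_level (levels G r) (raw_vertex u) < #|{: V}|.
Proof.
have [x [p [/wire_path_uniq up <- _]]] := level_path r u.
by rewrite -[X in X <= _]/(size (x :: p)) -(card_uniqP up) max_card.
Qed.

Lemma level_depth r u : vert_level (levels G r) (raw_vertex u) <= depth C.
Proof.
have lt := level_lt_card r u; have [x [p [hp sp _]]] := level_path r u.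
apply: (bigmax_sup (Ordinal lt)) => //=; apply/existsP; exists x; apply/existsP.
by exists (Tuple (introT eqP sp)).
Qed.

Lemma raw_well_formed : well_formed raw_circuit.
Proof.
split.
- by move=> _ _ /mapP[g _ ->] /mapP[u _ ->]; exact: is_vertex_raw.
- by move=> _ /mapP[g _ ->]; rewrite size_map -cardE nvertices_raw max_card.
- exact: is_vertex_raw.
apply: (@eq_from_nth _ 0) => [|i].
  rewrite size_map; case e: (nvertices _) => [|N]; last by rewrite /= !size_map.
  by move/eqP: e; rewrite addn_eq0 => /andP[_ /eqP].
(* A level still changing in round [N + 1], for [N] vertices, would be equal to [N + 1]; but a level
   is the length of a path, which is simple and so shorter than [N]. *)
rewrite size_map => hi; case: (levels_step G (nvertices raw_circuit) i) => // e.
have hi' : i < m by rewrite -size_raw_gates.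
have := level_lt_card (nvertices raw_circuit).+1 (inr (Ordinal hi')).
by rewrite /vert_level [raw_vertex _]/= [X in X < _]e -nvertices_raw ltnNge leqnSn.
Qed.

Lemma max_level_depth : foldr maxn 0 (final_levels raw_circuit) <= depth C.
Proof.
have h : {in final_levels raw_circuit, forall l, l <= depth C}.
  move=> l /(nthP 0)[i hi <-].
  have hi' : i < m by rewrite -size_raw_gates; apply: leq_trans hi _; exact: size_levels.
  exact: (level_depth _ (inr (Ordinal hi'))).
elim: (final_levels _) h => //= l s IH h; rewrite geq_max h ?mem_head // IH // => i hi.
by apply: h; rewrite inE hi orbT.
Qed.

(** Makes the number of vertices linear in [n], and therefore [bits] of order [log n]. *)
Lemma ngates_le_nwires : m <= nwires C.
Proof.
have [_ fan _] := C_threshold; rewrite -nwires_raw big_map big_enum /=.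
rewrite -[X in X <= _](card_ord m) -sum1_card; apply: leq_sum => g _.
by rewrite size_map -cardE card_gt0.
Qed.

End Circuit.

(** * Formulas *)

Lemma sum_size_le (T : Type) (e : T -> tree) B (s : seq T) :
  all (fun x => tree_size (e x) <= B) s -> tree_size (enc_seq e s) <= size s * B.+1 + 1.
Proof. by elim: s => //= x s IH /andP[h1 /IH h2]; lia. Qed.

Lemma tree_size_nat i : tree_size (enc_nat i) = i.*2.+1.
Proof. by elim: i => //= i; rewrite /enc_nat /= => ->; lia. Qed.

(* Literals on variables outside [0, V) are dropped. *)
Definition typed_clause V (c : seq lit) : clause V :=
  pmap (fun l : lit => if insub l.2 is Some i then Some (l.1, i) else None) c.

Definition typed_cnf V (F : seq (seq lit)) : cnf V := [seq typed_clause V c | c <- F].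

Definition below V (F : seq (seq lit)) := all (all (fun l : lit => l.2 < V)) F.

Lemma enc_typed_cnf V F : below V F -> enc_cnf (typed_cnf V F) = enc (V, F).
Proof.
move=> hF; rewrite /enc_cnf /enc /pair_encoding /=; congr node.
elim: F hF => //= c F IH /andP[hc /IH e]; rewrite /enc /seq_encoding /= in e *.
rewrite e; congr node; elim: c hc => //= -[s i] c IH' /andP[/= hi /IH' e'].
by rewrite insubT /= e'.
Qed.

Lemma typed_cnf_sat V F : below V F ->
  (exists y, all (sat_clause y) F) <-> cnf_sat (typed_cnf V F).
Proof.
move=> hF; have clE (a : {ffun 'I_V -> bool}) (y : nat -> bool) : (forall i : 'I_V, y i = a i) ->
    all (sat_clause y) F = all (fun C : clause V => has (fun l : literal V => a l.2 == l.1) C) (typed_cnf V F).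
  move=> ya; elim: (F) hF => //= c F' IH /andP[hc /IH ->]; congr andb.
  elim: c hc => //= -[s i] c IH' /andP[/= hi /IH' ->].
  by rewrite insubT /= /sat_lit /= -ya.
split=> [[y hy]|/existsP[a ha]].
  by apply/existsP; exists [ffun i : 'I_V => y i]; rewrite -(clE _ y) // => i; rewrite ffunE.
by exists (extend a); rewrite (clE a) // => i; exact: extendE.
Qed.

Lemma tree_size_formula c l V F : clauses_bound c l V F ->
  tree_size (enc (V, F)) <= 2 * V + 3 + c * (l * (2 * V + 8) + 2).
Proof.
case/andP=> hc /allP hF; rewrite /enc /pair_encoding /= tree_size_nat.
have h1 : tree_size (enc_seq enc F) <= size F * (l * (2 * V + 8) + 1).+1 + 1.
  apply: sum_size_le; apply/allP => s /hF /andP[sl /allP sV].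
  have h : tree_size (enc_seq (@enc lit _) s) <= size s * (2 * V + 7).+1 + 1.
    apply/sum_size_le/allP => -[b i] /sV /= hi; rewrite tree_size_nat.
    by case: b => /=; lia.
  by apply: leq_trans h _; rewrite leq_add2r -[(2 * V + 7).+1]addnS leq_mul2r sl orbT.
have h2 : size F * (l * (2 * V + 8) + 1).+1 <= c * (l * (2 * V + 8) + 1).+1.
  by rewrite leq_mul2r hc orbT.
apply: (@leq_trans (V.*2.+1 + (size F * (l * (2 * V + 8) + 1).+1 + 1)).+1); last by lia.
by rewrite ltnS leq_add2l; exact: h1.
Qed.

(** * The reduction takes time [2 ^ o(n)] *)

Lemma sqr_le_exp2 l : l * l <= 2 ^ l.+1.
Proof.
case: (ltnP l 3) => [|l3]; first by case: l => [|[|[]]].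
rewrite -(subnK l3); elim: (l - 3) => [//|i IH].
rewrite expnS addSn; nia.
Qed.

Lemma linear_le_exp2 a e l : 4 * (a + e) < l -> a + e * l <= 2 ^ l.-1.
Proof.
case: l => // l hl; have := sqr_le_exp2 l.+1; rewrite expnS expnS /= => h.
suff : 4 * (a + e * l.+1) <= l.+1 * l.+1 by lia.
nia.
Qed.

(** With [l] about [log z], the exponent on the left is at most [g + (A + l * J.+1) * (B * z ^ J)],
    while [z.-1 ^ J.+1] is at least [z ^ J.+1] divided by [2 ^ J.+1]. After division by [z ^ J] it
    remains to compare a linear function of [l] with [z], which the lower bound on [z] settles. *)
Lemma exp_tower_large A B J g z : 2 ^ (4 * (2 ^ J.+1 * (g + A * B) + 2 ^ J.+1 * (J.+1 * B))).+1 <= z ->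
  g * (A * z ^ J.+1) ^ (B * z ^ J) <= 2 ^ (z.-1 ^ J.+1).
Proof.
set l0 := (_ * (_ + _)).+1 => hz; pose l := (trunc_log 2 z).+1.
have z0 : 0 < z by apply: leq_trans hz; rewrite expn_gt0.
have z2 : 2 <= z by apply: leq_trans hz; rewrite -[X in X <= _]expn1 leq_exp2l.
have [lz zl] : 2 ^ l.-1 <= z /\ z <= 2 ^ l.
  by have /andP[h1 h2] := trunc_log_bounds (ltnSn 1) z0; split=> //; exact: ltnW.
have ll : l0 <= l.
  by rewrite -(leq_exp2l _ _ (ltnSn 1)); exact: leq_trans hz zl.
have hl := leq_trans (linear_le_exp2 ll) lz.
have zJ : 0 < z ^ J by rewrite expn_gt0 z0.
have pow a : a <= 2 ^ a by exact/ltnW/ltn_expl.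
apply: (@leq_trans (2 ^ (g + (A + l * J.+1) * (B * z ^ J)))).
  rewrite expnD leq_mul // [in X in _ <= X]expnM; case: (posnP (B * z ^ J)) => [->|e0]; first by rewrite !expn0.
  by rewrite leq_exp2r // expnD leq_mul // expnM leq_exp2r.
rewrite leq_exp2l //.
have zz : z ^ J.+1 <= 2 ^ J.+1 * z.-1 ^ J.+1 by rewrite -expnMn leq_exp2r //; lia.
suff h : 2 ^ J.+1 * (g + (A + l * J.+1) * (B * z ^ J)) <= 2 ^ J.+1 * z.-1 ^ J.+1.
  by rewrite leq_pmul2l ?expn_gt0 // in h.
apply: leq_trans zz; rewrite (expnS z).
apply: (@leq_trans (2 ^ J.+1 * (g + (A + l * J.+1) * B) * z ^ J)).
  rewrite -[X in _ <= X]mulnA leq_mul2l; apply/orP; right; rewrite [X in _ <= X]mulnDl mulnA leq_add2r.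
  exact: leq_pmulr.
rewrite leq_mul2r; apply/orP; right; move: hl; congr (_ <= _).
by set X := 2 ^ J.+1; nia.
Qed.

Lemma exp_tower A B J g : exists K, forall z,
  g * (A * z ^ J.+1) ^ (B * z ^ J) <= 2 ^ (z.-1 ^ J.+1) + K.
Proof.
set z0 := 2 ^ (4 * (2 ^ J.+1 * (g + A * B) + 2 ^ J.+1 * (J.+1 * B))).+1.
(* The finitely many small values of [z] are paid for by the additive constant. *)
exists (\sum_(z < z0) g * (A * z ^ J.+1) ^ (B * z ^ J)) => z.
case: (leqP z0 z) => hz; first by apply: leq_trans (exp_tower_large hz) (leq_addr _ _).
apply: leq_trans (leq_addl _ _); rewrite (bigD1 (Ordinal hz)) //=; exact: leq_addr.
Qed.

(* With [z = lam ^ (1 / q ^ 2)] and [lam] about [log n], [b] is at most about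
   [z ^ q.+1], so that the exponent is [O(z ^ (q ^ 2 - 1))], while [n] is
   [2 ^ (z ^ (q ^ 2))]. *)
Lemma work_small k Q c g : exists K, forall n m D p b, 0 < n -> m <= c * n ->
    2 ^ p <= (2 * (n + m)).+1 -> D ^ k.+1 <= (trunc_log 2 n).+1 ^ k.+2 ->
    b.-1 ^ k.+1 <= D ->
  g * (p * Q.+1) ^ (b ^ k) <= n + K.
Proof.
pose J := k * k.+2; have JE : J.+1 = k.+1 * k.+1 by rewrite /J; lia.
pose A := (2 * c + 4) * Q.+1; pose B := 2 ^ k.
have [K hK] := exp_tower A B J g.
exists K => n m D p b n0 mn hp hD hb.
set lam := (trunc_log 2 n).+1 in hD.
have /andP[ln nl] := trunc_log_bounds (ltnSn 1) n0; rewrite -/lam in nl.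
(* An integer substitute for the root of [lam] of order [J.+1], rounded up. By minimality
   [z.-1 ^ J.+1 < lam], hence [2 ^ (z.-1 ^ J.+1) <= n]; the predecessor in [exp_tower] comes from
   this rounding. *)
have exz : exists z, lam <= z ^ J.+1 by exists lam; rewrite expnS leq_pmulr // expn_gt0.
pose z := ex_minn exz.
have [hz zmin] : lam <= z ^ J.+1 /\ forall z', lam <= z' ^ J.+1 -> z <= z'.
  by rewrite /z; case: ex_minnP.
have z0 : 0 < z by case: (z) hz => //; rewrite exp0n.
have zn : 2 ^ (z.-1 ^ J.+1) <= n.
  apply: leq_trans ln; rewrite leq_exp2l // -ltnS -/lam ltnNge; apply/negP => /zmin; lia.
have plam : p <= (2 * c + 4) * lam.
  have : 2 ^ p < 2 ^ ((2 * c + 3) + lam).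
    apply: leq_ltn_trans hp _; rewrite expnD.
    apply: (@leq_ltn_trans ((2 * c + 3) * n)); first by nia.
    by rewrite ltn_mul // ltn_expl.
  rewrite ltn_exp2l // /lam; nia.
have pz : p * Q.+1 <= A * z ^ J.+1.
  rewrite /A -mulnA [Q.+1 * _]mulnC mulnA leq_mul2r; apply/orP; right.
  by apply: leq_trans plam _; rewrite leq_mul2l hz orbT.
(* Compare the powers of exponent [J.+1 = k.+1 * k.+1]: the left one is at most [D ^ k.+1], hence at
   most [lam ^ k.+2]. *)
have bz : b.-1 <= z ^ k.+2.
  rewrite -(leq_exp2r _ _ (_ : 0 < J.+1)) // {1}JE expnM.
  apply: (@leq_trans (D ^ k.+1)); first by rewrite leq_exp2r.
  apply: leq_trans hD _; rewrite -expnM mulnC expnM leq_exp2r //.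
(* The gain of the depth reduction: [k * k.+2] is one less than [k.+1 * k.+1], the exponent at which
   [z] reaches [lam]. *)
have bk : b ^ k <= B * z ^ J.
  have zk : 0 < z ^ k.+2 by rewrite expn_gt0 z0.
  have b2 : b <= 2 * z ^ k.+2 by lia.
  rewrite /B /J (mulnC k) expnM -expnMn.
  by case: (posnP k) => [->|k0]; [rewrite !expn0|rewrite leq_exp2r].
apply: leq_trans (leq_trans (hK z) _); last by rewrite leq_add2r.
rewrite leq_mul2l; apply/orP; right.
have A0 : 0 < A * z ^ J.+1 by rewrite muln_gt0 expn_gt0 z0 /A muln_gt0 addn4.
apply: (@leq_trans ((A * z ^ J.+1) ^ (b ^ k))); last by rewrite leq_pexp2l.
by case: (b ^ k) => // e; rewrite leq_exp2r.
Qed.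

(* Polynomials in [X >= 2] are dominated by powers of [X]. *)
Lemma reduction_size k Q x : 0 < Q -> well_formed x ->
  tree_size (enc (reduction k Q x)) <= (2 ^ work k Q x) ^ 16.
Proof.
move=> Q0 hx; have := tree_size_formula (reduction_bound k Q0 hx); rewrite -surjective_pairing => hF.
have [c [e [/andP[_ hV] hc he]]] := reduction_vars k Q0 hx.
have hW := sum_fanin_le hx.
have E1 : bits x <= work k Q x by apply: leq_trans (work_ge k Q hx); rewrite leq_pmulr.
have p0 := bits_gt0 hx.
set w := work k Q x in E1 *; set X := 2 ^ w.
have X2 : 2 <= X by rewrite /X -[X in X <= _]expn1 leq_exp2l //; lia.
have pX : 2 ^ bits x <= X by rewrite leq_exp2l.
have NX : nvertices x <= X by apply: leq_trans pX; exact/ltnW/nvertices_lt.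
have wX : w <= X by exact/ltnW/ltn_expl.
have GX : size x.2.1 <= X by apply: leq_trans NX; exact: leq_addl.
have nX : x.1 <= X by apply: leq_trans NX; exact: leq_addr.
have XS i : X ^ i + X ^ i <= X ^ i.+1 by rewrite addnn -mul2n expnS leq_mul2r X2 orbT.
have Xle i j : i <= j -> X ^ i <= X ^ j by rewrite leq_exp2l.
apply: leq_trans hF _; set V := (reduction k Q x).1 in hV *.
have WX : \sum_(g <- x.2.1) size g.2 <= X ^ 2.
  by apply: leq_trans hW _; rewrite -mulnn leq_mul.
have XD i a b : a <= X ^ i -> b <= X ^ i -> a + b <= X ^ i.+1.
  by move=> ha hb; apply: leq_trans (XS i); exact: leq_add.
have Xw i j a : a <= X ^ i -> i <= j -> a <= X ^ j by move=> ha /Xle; exact: leq_trans.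
have X1 a : a <= X -> a <= X ^ 1 by rewrite expn1.
have hV' : V <= X ^ 4.
  have c1 : c <= X ^ 2 by nia.
  have e1 : e <= X ^ 2 by nia.
  apply: leq_trans hV _; rewrite -addnA; apply: (XD); last exact: (XD).
  exact: (Xw) (X1 _ nX) _.
set cF := _ + size _ * _.
have hcF : cF <= X ^ 6.
  apply: (XD); first exact: (Xw) (X1 _ (leqnn X)) _.
  rewrite -[X ^ 5]/(X ^ (1 + 4)) expnD leq_mul // (expnS X 3) leq_mul //; apply: (XD).
    by rewrite -mulnn leq_mul.
  by rewrite -mulnn leq_mul.
have h1 : 2 * V + 8 <= X ^ 6.
  apply: (XD); first by rewrite expnS leq_mul.
  by apply: (@leq_trans (2 ^ 5)) => //; rewrite leq_exp2r.
have h3 : 2 * w * (2 * V + 8) + 2 <= X ^ 9.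
  apply: (XD); first by rewrite -[X ^ 8]/(X ^ (2 + 6)) expnD leq_mul // -mulnn leq_mul.
  exact: (Xw) (X1 _ X2) _.
apply: (XD); last by rewrite -[X ^ 15]/(X ^ (6 + 9)) expnD leq_mul.
by apply: (Xw) (_ : _ <= X ^ 6) _ => //; apply: leq_trans h1; rewrite leq_add2l.
Qed.

Import Order.TTheory GRing.Theory Num.Theory.

(** * The theorem *)

Section Program.
Local Open Scope ring_scope.
Variables (R : realType) (solver : cmd) (k Q : nat) (Q_gt0 : (0 < Q)%N).

(** The program, the exponent [a] and the constant [M] are chosen before [n] and the circuit. The
    cost of the solver stays an unspecified bound [B], so that the estimates can be done
    separately. *)
Lemma decide_circuits : exists c a M, forall n (C : circuit n), threshold_circuit C ->
  exists V (F : cnf V), [/\ V = (reduction k Q (raw_circuit C)).1,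
    enc_cnf F = enc (reduction k Q (raw_circuit C))
  & forall B : R, decides_within solver (enc_cnf F) (cnf_sat F) B ->
      decides_within c (enc_circuit C) (circuit_sat C)
        ((((2 ^ work k Q (raw_circuit C)).+2 ^ a + M)%N)%:R + B)].
Proof.
have [cr [h [a ha] exr]] := FP_reduction k Q_gt0.
have [M0 hM0] := cmd_below_ex solver; pose M := M0.+1.
have hM : cmd_below M solver by exact: cmd_below_leq hM0.
pose clr := Seq (Assign M (Var 0)) (Seq (clear M) (Assign 0 (Var M))).
exists (Seq cr (Seq clr solver)), a, (2 * M + 6)%N => n C hC.
have wf := raw_well_formed hC.
set x := raw_circuit C in wf *.
have hb : below (reduction k Q x).1 (reduction k Q x).2.
  have /andP[_] := reduction_bound k Q_gt0 wf.
  by apply: sub_all => s /andP[].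
exists (reduction k Q x).1, (typed_cnf (reduction k Q x).1 (reduction k Q x).2).
have eF := enc_typed_cnf hb; rewrite -surjective_pairing in eF.
split=> // B [t2 [s2 [ex2 hs2 ht2]]].
have [t1 [s1 [ex1 s10 ht1]]] := exr x wf (initial_store (enc_circuit C)) (esym (enc_raw_circuit C)).
(* The reduction leaves intermediate results in the variables, whereas nothing is known about the
   solver outside initial stores. *)
have [tc [sc [exc hsc htc]]] := exec_clear M s1 (enc (reduction k Q x)).
have [|s3 ex3 hs3] := exec_agree (s := sc) ex2 hM; first by rewrite eF; exact: hsc.
exists (t1 + (tc + t2))%N, s3; split.
- exact: ExecSeq ex1 (ExecSeq exc ex3).
- rewrite hs3 // hs2; apply/idP/idP.
    by move/(typed_cnf_sat hb)/(reduction_sat k Q_gt0 wf)/raw_satP.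
  by move/raw_satP/(reduction_sat k Q_gt0 wf)/(typed_cnf_sat hb).
- rewrite addnA natrD lerD // ler_nat leq_add //.
  exact: leq_trans ht1 (ha _ wf).
Qed.

End Program.

(** * Estimates on exponents *)

Section Estimates.
Local Open Scope ring_scope.
Variable R : realType.
Implicit Types (x e c : R).

Lemma powR2D x y : 2 `^ (x + y) = 2 `^ x * 2 `^ y :> R.
Proof. by rewrite powRD // pnatr_eq0 implybT. Qed.

Lemma powR2_le x y : x <= y -> 2 `^ x <= 2 `^ y :> R.
Proof. by apply: ler_powR; rewrite ler1n. Qed.

Lemma powR2_nat n : 2 `^ n%:R = (2 ^ n)%N%:R :> R.
Proof. by rewrite powR_mulrn // natrX. Qed.

Lemma log2_le n l : (0 < n)%N -> (n <= 2 ^ l)%N -> 0 <= log2 (n%:R : R) <= l%:R.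
Proof.
move=> n0 nl; have l2 : 0 < ln 2 :> R by rewrite ln_gt0 // ltr1n.
rewrite /log2; apply/andP; split.
  by apply: divr_ge0; [rewrite ln_ge0 // ler1n|exact: ltW].
rewrite ler_pdivrMr // mulr_natl -lnXn ?ltr0n // ler_ln ?posrE ?exprn_gt0 ?ltr0n //.
by rewrite -natrX ler_nat.
Qed.

(** Raising to the power [k.+1] removes the fraction, as [(1 + 1 / k.+1) * k.+1 = k.+2]. *)
Lemma depth_bound d n k : (0 < n)%N ->
    d%:R <= log2 (n%:R : R) `^ (1 + k.+1%:R^-1) ->
  (d ^ k.+1 <= (trunc_log 2 n).+1 ^ k.+2)%N.
Proof.
move=> n0 hd; have /andP[_ nl] := trunc_log_bounds (ltnSn 1) n0.
have /andP[l0 ll] := log2_le n0 (ltnW nl).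
rewrite -(ler_nat R) !natrX; apply: (@le_trans _ _ (log2 (n%:R : R) ^+ k.+2)); last first.
  by rewrite lerXn2r ?nnegrE.
apply: (@le_trans _ _ ((log2 (n%:R : R) `^ (1 + k.+1%:R^-1)) ^+ k.+1)).
  by rewrite lerXn2r ?nnegrE ?powR_ge0.
rewrite -powR_mulrn ?powR_ge0 // -powRrM mulrDl mul1r mulVf ?pnatr_eq0 // -natr1.
by rewrite natr1 natr1 powR_mulrn.
Qed.

(** The solver runs in [2 ^ ((1 - e) (1 + e / 4) n)], which is at most [2 ^ ((1 - 3 e / 4) n)]. The
    polynomial factors, [2 ^ (a w)] for the reduction and [2 ^ (16 k0 w)] for the size of the
    formula, together cost another [e / 4] in the exponent by the choice of [g]. The absolute value
    allows for a negative [K]. *)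
Lemma time_estimate e eps K a M k0 g n w V s K' :
    0 < e <= 1 / 2 -> e <= eps -> (4 * (a + 16 * k0)%:R <= e * g%:R) ->
    (g * w <= n + K')%N -> V%:R <= (1 + e / 4) * n%:R -> (s <= (2 ^ w) ^ 16)%N ->
  ((((2 ^ w).+2 ^ a + M)%N)%:R + K * s%:R ^+ k0 * 2 `^ ((1 - eps) * V%:R)) <=
  ((2 ^ (2 * a) + M)%N%:R + `|K|) * 2 `^ (e / 4 * K'%:R) * 2 `^ ((1 - e / 2) * n%:R) :> R.
Proof.
move=> /andP[e0 e1] ee hg gw hV hs.
set T := 2 `^ ((1 - 3 * e / 4) * n%:R) : R; set P := (2 ^ ((a + 16 * k0) * w))%N%:R : R.
have n0 : 0 <= n%:R :> R by [].
have T1 : 1 <= T.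
  by rewrite /T -[X in X <= _](powRr0 2) powR2_le // mulr_ge0 //; lra.
have P1 : 1 <= P by rewrite /P ler1n expn_gt0.
have hVT : 2 `^ ((1 - eps) * V%:R) <= T.
  apply: powR2_le; have V0 : 0 <= V%:R :> R by [].
  apply: (@le_trans _ _ ((1 - e) * V%:R)); first by rewrite ler_wpM2r //; lra.
  apply: (@le_trans _ _ ((1 - e) * ((1 + e / 4) * n%:R))); first by rewrite ler_wpM2l //; lra.
  by rewrite mulrA ler_wpM2r //; nra.
have h1 : ((2 ^ w).+2 ^ a)%N%:R <= (2 ^ (2 * a))%N%:R * P.
  rewrite -natrM ler_nat -expnD; apply: (@leq_trans ((2 ^ (w + 2)) ^ a)).
    case: (a) => // a'; rewrite leq_exp2r // expnD.
    by have := expn_gt0 2 w; lia.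
  by rewrite -expnM leq_exp2l //; nia.
have h2 : s%:R ^+ k0 <= P.
  rewrite -natrX ler_nat; apply: (@leq_trans (((2 ^ w) ^ 16) ^ k0)).
    by case: (k0) => // k'; rewrite leq_exp2r.
  by rewrite -!expnM leq_exp2l //; nia.
have hP : P <= 2 `^ (e / 4 * n%:R) * 2 `^ (e / 4 * K'%:R).
  rewrite -powR2D /P -powR2_nat; apply: powR2_le.
  have : (g * w)%N%:R <= (n + K')%N%:R :> R by rewrite ler_nat.
  rewrite !natrM natrD => gw'; have w0 : 0 <= w%:R :> R by [].
  move: hg; set b := (a + 16 * k0)%:R : R => hg.
  have : 4 * b * w%:R <= e * g%:R * w%:R by rewrite ler_wpM2r.
  have : e * (g%:R * w%:R) <= e * (n%:R + K'%:R) by rewrite ler_wpM2l // ltW.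
  by rewrite mulrA; lra.
have hT : 2 `^ ((1 - e / 2) * n%:R) = T * 2 `^ (e / 4 * n%:R).
  by rewrite -powR2D; congr (_ `^ _); lra.
set c := _ + `|K|; have c0 : 0 <= c by rewrite addr_ge0.
apply: (@le_trans _ _ (c * (P * T))); last first.
  rewrite hT -mulrA ler_wpM2l // mulrCA [X in _ <= X]mulrA mulrC.
  have T0 : 0 <= T by lra.
  by rewrite -mulrA ler_wpM2l // mulrC.
have PT1 : P <= P * T by rewrite ler_peMr //; lra.
rewrite natrD /c natrD [X in _ <= X]mulrDl [X in _ <= X + _]mulrDl; apply: lerD; first apply: lerD.
- by apply: le_trans h1 _; rewrite ler_wpM2l.
- by rewrite ler_peMr //; lra.
- apply: (@le_trans _ _ (`|K| * s%:R ^+ k0 * 2 `^ ((1 - eps) * V%:R))).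
    apply: ler_wpM2r; first exact: powR_ge0.
    by apply: ler_wpM2r; [exact: exprn_ge0|exact: ler_norm].
  by rewrite -mulrA ler_wpM2l // ler_pM ?exprn_ge0 ?powR_ge0.
Qed.

End Estimates.

Local Open Scope ring_scope.
Unset Implicit Arguments.

Theorem theorem1p6 (R : realType) :
  (exists2 eps : R, 0 < eps & cnf_sat_solvable eps) ->
  exists2 eps' : R, 0 < eps' &
    forall c : R, 0 < c ->
      exists2 delta : R, 0 < delta & threshold_sat_solvable eps' c delta.
Proof.
case=> eps eps0 [solver [K [k0 hsolver]]].
(* The minimum keeps [1 - e] positive, so that replacing the number of variables by its upper bound
   increases the time bound. *)
pose e := Num.min eps (1 / 2); have e0 : 0 < e by rewrite lt_min eps0; lra.
have e1 : e <= 1 / 2 by rewrite ge_min lexx orbT.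
have ee : e <= eps by rewrite ge_min lexx.
exists (e / 2); first by lra.
(* Cut wires and partial counts each add at most [cw * n / k.+1] variables; the factor 8 makes this
   at most [e * n / 8], that is [e * n / 4] in total. *)
move=> cw cw0; pose k := Num.bound (8 * cw / e).
have hk : 8 * cw < e * k.+1%:R.
  have h : 8 * cw / e < k%:R by apply: archi_boundP; rewrite divr_ge0 ?ltW // mulr_gt0.
  move: h; rewrite ltr_pdivrMr // [_ * e]mulrC => h; apply: lt_le_trans h _.
  by rewrite ler_wpM2l ?ler_nat // ltW.
pose cn := Num.bound cw; have hcn : cw <= cn%:R by apply/ltW/archi_boundP/ltW.
exists k.+1%:R^-1; first by rewrite invr_gt0.
have [prog [a [M hprog]]] := decide_circuits R solver k (ltn0Sn k).
(* Chosen so that [g * work <= n + K'] bounds [(a + 16 * k0) * work] by [e / 4 * (n + K')]. *)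
pose g := Num.bound (4 * (a + 16 * k0)%:R / e).
have hg : 4 * (a + 16 * k0)%:R <= e * g%:R.
  have h : 4 * (a + 16 * k0)%:R / e < g%:R by apply: archi_boundP; rewrite divr_ge0 ?mulr_ge0 // ltW.
  by move: h; rewrite ltr_pdivrMr // [_ * e]mulrC => /ltW.
have [K' hK'] := work_small k k.+1 cn g.
exists prog, (((2 ^ (2 * a) + M)%N%:R + `|K|) * 2 `^ (e / 4 * K'%:R)).
move=> n C hC hdepth hwires; have wf := raw_well_formed hC.
have [V [F [VE eF /(_ _ (hsolver V F))]]] := hprog n C hC.
case=> t [s [ext hs ht]]; exists t, s; split=> //; apply: le_trans ht _.
(* Without inputs there would be no wires, hence no gates, and no vertex could be the output. *)
have n0 : (0 < n)%N.
  rewrite lt0n; apply/eqP => n0; have := nvertices_gt0 wf.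
  have nw0 : nwires C = 0%N.
    by apply/eqP; rewrite -(lern0 R); apply: le_trans hwires _; rewrite n0 mulr0.
  have := ngates_le_nwires hC; rewrite nw0 leqn0 => /eqP m0.
  by rewrite /nvertices size_raw_gates m0 addn0 /= n0.
have hm : (ngates C <= cn * n)%N.
  apply: leq_trans (ngates_le_nwires hC) _; rewrite -(ler_nat R) natrM.
  by apply: le_trans hwires _; rewrite ler_wpM2r.
apply: (@time_estimate _ _ _ _ _ _ _ g _ (work k k.+1 (raw_circuit C))) => //; first by rewrite e0.
- have [_ hb _] := find_baseP k (foldr maxn 0%N (final_levels (raw_circuit C))).
  apply: (hK' n (ngates C) (depth C)) => //.
  + have /andP[_] := find_bitsP (nvertices (raw_circuit C)).
    by rewrite [X in (_ <= (2 * X).+1)%N]/nvertices size_raw_gates.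
  + exact: depth_bound n0 hdepth.
  + exact: leq_trans hb (max_level_depth hC).
- have [c1 [c2 [/andP[_ hV] h1 h2]]] := reduction_vars k (ltn0Sn k) wf.
  rewrite -VE nwires_raw in hV h1 h2.
  have hV' : V%:R <= n%:R + c1%:R + c2%:R :> R by rewrite -!natrD ler_nat.
  have h1' : k.+1%:R * c1%:R <= cw * n%:R by apply: le_trans hwires; rewrite -natrM ler_nat.
  have h2' : k.+1%:R * c2%:R <= cw * n%:R by apply: le_trans hwires; rewrite -natrM ler_nat.
  have small c' : k.+1%:R * c'%:R <= cw * n%:R -> 8 * c'%:R <= e * n%:R :> R.
    move=> h; rewrite -(ler_pM2l (_ : 0 < k.+1%:R)) //.
    have h' : 8 * (k.+1%:R * c'%:R) <= 8 * (cw * n%:R) by rewrite ler_wpM2l.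
    have h'' : 8 * cw * n%:R <= e * k.+1%:R * n%:R by rewrite ler_wpM2r // ltW.
    lra.
  by have := small _ h1'; have := small _ h2'; lra.
- by rewrite eF reduction_size.
Qed.
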